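(* Let $k$ be an algebraically closed field. Let $B$ be a unirational UFD over $k$ of finite transcendence degree $n\ge 1$ over $k$. If $B$ admits an effective unmixed $\mathbb{Z}^{n-1}$-grading with $B_0=k$, then $B\cong_k k[\Delta]^{[m]}$ for some reduced trinomial data $\Delta$ over $k$ and some integer $m\ge 0$.
   Context: Trinomial data $\Delta$ over a field $k$ consist of: (i) an integer $N\ge 2$ and a partition $N=n_0+\cdots+n_r$ with $r\ge 1$ and all $n_i\ge 1$ ($0\le i\le r$); (ii) tuples $\beta_i=(\beta_{i1},\dots,\beta_{in_i})$ of positive integers, $0\le i\le r$, such that with $d_i=\gcd(\beta_{i1},\dots,\beta_{in_i})$ one has $\gcd(d_i,d_j)=1$ for $i\ne j$; (iii) distinct elements $\lambda_2,\dots,\lambda_r\in k^*$ (the empty sequence if $r=1$). The associated ring is $$k[\Delta]=k[t_{ij}\mid 0\le i\le r,\ 1\le j\le n_i]/(T_0^{\beta_0}+\lambda_iT_1^{\beta_1}+T_i^{\beta_i})_{2\le i\le r},$$ where the $t_{ij}$ are $N$ independent variables and $T_i^{\beta_i}=t_{i1}^{\beta_{i1}}\cdots t_{in_i}^{\beta_{in_i}}$. If $r=1$, $k[\Delta]$ is the polynomial ring in $N$ variables. Write $|\beta_i|=\sum_j\beta_{ij}$. $\Delta$ is reduced if either $r=1$ and $\beta_{01}=\beta_{11}=1$, or $r\ge 2$ and $|\beta_i|\ge 2$ for every $i\in\{0,\dots,r\}$. $R^{[m]}$ denotes the polynomial ring in $m$ variables over $R$; $\cong_k$ means isomorphic as $k$-algebras.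 ''Unirational'' means that $\mathrm{frac}(B)$ embeds over $k$ in a purely transcendental extension $k(x_1,\dots,x_s)$ for some $s$. For $G=\mathbb{Z}^s$, a $G$-grading $B=\bigoplus_{g\in G}B_g$ (always with $k\subset B_0$) has weight monoid $M=\{g\in G\mid B_g\ne 0\}$. It is effective if $M$ generates $G$ as a group, and unmixed if $\{g\in M\mid -g\in M\}$ is trivial. *)

(* Defs.v *)
From HB Require Import structures.
From mathcomp Require Import all_boot all_order all_algebra.
From mathcomp Require Import boolp.
From mathcomp Require Import mpoly.

Set Implicit Arguments.
Unset Strict Implicit.
Unset Printing Implicit Defensive.

Import GRing.Theory.
Local Open Scope ring_scope.
Local Open Scope quotient_scope.

(* Throughout, a commutative k-algebra A is a ring together with its structure
   morphism k -> A. *)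

Section UFD.
Variable B : idomainType.

Definition irreducible_elt (p : B) : Prop :=
  [/\ p != 0, p \isn't a GRing.unit
    & forall a b : B, p = a * b -> a \is a GRing.unit \/ b \is a GRing.unit].

Definition associates (x y : B) : Prop :=
  exists2 u : B, u \is a GRing.unit & y = u * x.

Definition is_UFD : Prop :=
  (forall x : B, x != 0 -> x \isn't a GRing.unit ->
     exists2 s : seq B, {in s, forall p, irreducible_elt p}
                      & x = \prod_(p <- s) p)
  /\
  (forall s t : seq B,
     {in s, forall p, irreducible_elt p} ->
     {in t, forall q, irreducible_elt q} ->
     \prod_(p <- s) p = \prod_(q <- t) q ->
     exists t' : seq B, [/\ perm_eq t t', size s = size t'
       & forall i, (i < size s)%N -> associates s`_i t'`_i]).

End UFD.

Section Fractions.
Variables (k : fieldType).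

Definition algindep (A : comNzRingType) (iota : k -> A) (n : nat)
    (x : 'I_n -> A) : Prop :=
  forall p : {mpoly k[n]}, mmap iota x p = 0 -> p = 0.

Definition has_trdeg (L : fieldType) (iota : k -> L) (n : nat) : Prop :=
  (exists x : 'I_n -> L, algindep iota x) /\
  (forall (m : nat) (x : 'I_m -> L), algindep iota x -> (m <= n)%N).

Variables (B : idomainType) (iota : {rmorphism k -> B}).

(* The transcendence degree of B is that of its field of fractions. *)
Definition domain_trdeg (n : nat) : Prop :=
  has_trdeg (fun c : k => tofrac (iota c)) n.

Definition unirational : Prop :=
  exists (s : nat) (f : {rmorphism {fraction B} -> {fraction {mpoly k[s]}}}),
    forall c : k, f (tofrac (iota c)) = tofrac (c%:MP : {mpoly k[s]}).

End Fractions.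

Section Gradings.
Variables (k : fieldType) (B : idomainType) (iota : {rmorphism k -> B}).
Variable G : zmodType.

Record grading := Grading {
  gcomp :> G -> B -> Prop;
  gcomp0 : forall g, gcomp g 0;
  gcompB : forall g x y, gcomp g x -> gcomp g y -> gcomp g (x - y);
  gcompM : forall g h x y, gcomp g x -> gcomp h y -> gcomp (g + h) (x * y);
  gcomp_span : forall x : B, exists (s : seq G) (f : G -> B),
    (forall g, gcomp g (f g)) /\ x = \sum_(g <- s) f g;
  gcomp_direct : forall (s : seq G) (f : G -> B), uniq s ->
    (forall g, gcomp g (f g)) -> \sum_(g <- s) f g = 0 ->
    forall g, g \in s -> f g = 0;
  gcomp_base : forall c : k, gcomp 0 (iota c)
}.

Variable D : grading.

Definition weight (g : G) : Prop := exists2 b : B, D g b & b != 0.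

Definition effective : Prop :=
  forall H : G -> Prop,
    H 0 -> (forall g h, H g -> H h -> H (g - h)) ->
    (forall g, weight g -> H g) -> forall g, H g.

Definition unmixed : Prop := forall g : G, weight g -> weight (- g) -> g = 0.

Definition degree0_is_base : Prop :=
  forall b : B, D 0 b <-> exists c : k, b = iota c.

End Gradings.

(* The blocks are indexed by i : 'I_r.+1, so N is \sum_i td_n i, and N >= 2
   follows from td_r_gt0 and td_n_gt0.  Only the values td_lambda i with
   2 <= i matter. *)
Record trinomial_data (k : fieldType) := TrinomialData {
  td_r : nat;
  td_n : 'I_td_r.+1 -> nat;
  td_beta : forall i : 'I_td_r.+1, 'I_(td_n i) -> nat;
  td_lambda : 'I_td_r.+1 -> k;
  td_r_gt0 : (0 < td_r)%N;
  td_n_gt0 : forall i, (0 < td_n i)%N;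
  td_beta_gt0 : forall i (j : 'I_(td_n i)), (0 < td_beta j)%N;
  td_coprime : forall i i', i != i' ->
    coprime (\big[gcdn/0%N]_(j < td_n i) td_beta j)
            (\big[gcdn/0%N]_(j < td_n i') td_beta j);
  td_lambda_neq0 : forall i : 'I_td_r.+1, (2 <= i)%N -> td_lambda i != 0;
  td_lambda_inj : forall i i' : 'I_td_r.+1, (2 <= i)%N -> (2 <= i')%N ->
    td_lambda i = td_lambda i' -> i = i'
}.

Section TrinomialRing.
Variables (k : fieldType) (Delta : trinomial_data k).

Local Notation r := (td_r Delta).
Local Notation n_ := (@td_n k Delta).
Local Notation beta i := (@td_beta k Delta i).

Definition td_size (i : 'I_r.+1) : nat := (\sum_(j < n_ i) beta i j)%N.

(* Ordinal (td_n_gt0 i) is the first index of block i: for r = 1 the condition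
   is beta_01 = beta_11 = 1. *)
Definition td_reduced : Prop :=
  (r = 1%N /\ forall i : 'I_r.+1, beta i (Ordinal (td_n_gt0 i)) = 1%N)
  \/ ((2 <= r)%N /\ forall i : 'I_r.+1, (2 <= td_size i)%N).

Definition td_N : nat := (\sum_(i < r.+1) n_ i)%N.

Definition tvar (i : 'I_r.+1) (j : 'I_(n_ i)) : {mpoly k[td_N]} :=
  'X_(tagnat.Rank i j).

Definition tmonom (i : 'I_r.+1) : {mpoly k[td_N]} :=
  \prod_(j < n_ i) tvar j ^+ beta i j.

Definition trinomial (i : 'I_r.+1) : {mpoly k[td_N]} :=
  tmonom (inord 0) + td_lambda i *: tmonom (inord 1) + tmonom i.

Definition trinomial_ideal : {pred {mpoly k[td_N]}} := fun p =>
  `[< exists c : 'I_r.+1 -> {mpoly k[td_N]},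
        p = \sum_(i < r.+1 | (2 <= i)%N) c i * trinomial i >].

Lemma trinomial_idealP p : reflect
  (exists c : 'I_r.+1 -> {mpoly k[td_N]},
     p = \sum_(i < r.+1 | (2 <= i)%N) c i * trinomial i)
  (p \in trinomial_ideal).
Proof. exact: asboolP. Qed.

Lemma tmonom_at0 i : (tmonom i).@[fun=> 0] = 0.
Proof.
rewrite /tmonom rmorph_prod /= (bigD1 (Ordinal (td_n_gt0 i))) //=.
by rewrite rmorphXn /= mevalXU expr0n -[_ == _]negbK -lt0n td_beta_gt0 mul0r.
Qed.

Lemma trinomial_ideal_closed : idealr_closed trinomial_ideal.
Proof.
split.
- apply/trinomial_idealP; exists (fun=> 0).
  by rewrite big1 // => i _; rewrite mul0r.
- apply/trinomial_idealP => -[c /(congr1 (meval (fun=> 0)))/eqP].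
  rewrite meval1 raddf_sum big1 ?oner_eq0 // => i _ /=.
  by rewrite mevalM !mevalD mevalZ !tmonom_at0 mulr0 !addr0 mulr0.
- move=> a _ _ /trinomial_idealP[c ->] /trinomial_idealP[d ->].
  apply/trinomial_idealP; exists (fun i => a * c i + d i).
  rewrite mulr_sumr -big_split; apply: eq_bigr => i _ /=.
  by rewrite mulrDl mulrA.
Qed.

HB.instance Definition _ :=
  isIdealr.Build {mpoly k[td_N]} trinomial_ideal trinomial_ideal_closed.

(* For r = 1 the ideal is zero, so this is the polynomial ring in N variables. *)
Definition trinomial_ring : comNzRingType := {ideal_quot trinomial_ideal}.

Definition trinomial_const (c : k) : trinomial_ring :=
  \pi_({ideal_quot trinomial_ideal}) (c%:MP).

End TrinomialRing.

(* Main.v *)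
Require Import Defs.
From HB Require Import structures.
From mathcomp Require Import all_boot all_order all_algebra.
From mathcomp Require Import boolp mpoly.
From mathcomp Require Import zify ring.
Import Order.TTheory GRing.Theory Num.Theory.
Local Open Scope ring_scope.
Set Implicit Arguments.
Unset Strict Implicit.
Unset Printing Implicit Defensive.

(* Let L be the field of degree 0 homogeneous fractions of B. It has
   transcendence degree one over k, and it embeds in a purely transcendental
   extension, so by Lueroth L = k(f/g) with f, g coprime and homogeneous of the
   same degree. Consequently, if two products of homogeneous primes have the
   same degree, their quotient is a product of members of the pencil spanned by
   f and g. Distinct members have no common prime factor, and the homogeneous
   primes have degrees in a lattice of rank n - 1, so all but finitely many
   members are prime and only finitely many homogeneous primes divide no member;
   since the lattice is torsion-free, the gcds d_i of the multiplicities of the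
   prime factors of distinct members are pairwise coprime. The prime factors
   t_ij of the nonprime members (completed to at least two members) together
   with the primes dividing no member generate B. The linear dependence of any
   three members gives the trinomial relations, and there are no others: modulo
   them a homogeneous polynomial is a monomial times a binary form in the first
   two members, which splits into linear factors over the algebraically closed
   field k. *)

(** The finiteness, coprimality and absence of further relations all come from one identity. If x
    and y are homogeneous of equal degree, then v_p(x) - v_p(y) = c_a v_p(F_a) for each prime factor
    p of a member F_a, where the integer c_a depends on a alone and the c_a sum to 0. Factorization
    stays among homogeneous primes: divisors of homogeneous elements are homogeneous because the
    group of degrees can be ordered, and units are constants because the grading is unmixed.
    Unirationality only embeds L in k(x_1, ..., x_s), whereas Lueroth's argument takes place in one
    variable. Variables are removed by places: L is algebraic over k(u) for any nonconstant u, so a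
    place at which the value of u stays nonconstant is finite on all of L and embeds L into a field
    with one variable fewer. Finite generation of B is a conclusion here, not a premise. That L is
    larger than k is therefore shown by counting monomials against the lattice points of a box. *)

Definition prop_pick (T : Type) (x0 : T) (P : T -> Prop) : T :=
  if pselect (exists x, P x) is left e then projT1 (cid e) else x0.

Lemma prop_pickP (T : Type) (x0 : T) (P : T -> Prop) :
  (exists x, P x) -> P (prop_pick x0 P).
Proof. by move=> e; rewrite /prop_pick; case: pselect => // {}e; case: cid. Qed.

(** The choice depends on the predicate only, not on the default; this makes [canon] constant on
    classes of associates. *)
Lemma eq_prop_pick (T : Type) (x0 y0 : T) (P Q : T -> Prop) :
  (exists x, P x) -> (forall x, P x <-> Q x) -> prop_pick x0 P = prop_pick y0 Q.
Proof.
move=> ex PQ; have <- : P = Q by apply/funext => x; apply/propext.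
by rewrite /prop_pick; case: pselect.
Qed.

(** * Multiplicities in factorial domains *)

Section UniqueFactorization.
Variable B : idomainType.
Hypothesis hU : is_UFD B.
Implicit Types p q x y z : B.

Definition dvd p x := exists z, x = z * p.

Lemma dvd_mulr p x y : dvd p x -> dvd p (x * y).
Proof. by case=> z ->; exists (z * y); rewrite mulrAC. Qed.

Lemma dvd_mull p x y : dvd p y -> dvd p (x * y).
Proof. by rewrite mulrC; exact: dvd_mulr. Qed.

Lemma dvd_trans p q x : dvd p q -> dvd q x -> dvd p x.
Proof. by case=> a -> [b ->]; exists (b * a); rewrite mulrA. Qed.

Lemma dvd_refl p : dvd p p. Proof. by exists 1; rewrite mul1r. Qed.

Lemma irreducible_neq0 p : irreducible_elt p -> p != 0. Proof. by case. Qed.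

Lemma associates_sym x y : associates x y -> associates y x.
Proof.
by case=> u Uu ->; exists u^-1; rewrite ?unitrV // mulrA mulVr // mul1r.
Qed.

Lemma associates_trans y x z : associates x y -> associates y z -> associates x z.
Proof.
by case=> u Uu -> [v Uv ->]; exists (v * u); rewrite ?unitrM ?Uu ?Uv // mulrA.
Qed.

Lemma associates_dvd x y z : associates x y -> dvd x z -> dvd y z.
Proof.
move=> /associates_sym [u _ ->] [w ->]; exists (w * u); by rewrite mulrA.
Qed.

Lemma irreducible_associates p q :
  associates p q -> irreducible_elt p -> irreducible_elt q.
Proof.
case=> u Uu -> [p0 pU pI]; split.
- by rewrite mulf_neq0 //; apply: contraTneq Uu => ->; rewrite unitr0.
- by rewrite unitrM Uu.
move=> a b e; have := pI (u^-1 * a) b.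
rewrite -mulrA -e mulrA mulVr // mul1r => /(_ erefl).
by rewrite unitrM unitrV Uu.
Qed.

Lemma irreducible_dvdP p q :
  irreducible_elt p -> irreducible_elt q -> dvd p q -> associates p q.
Proof.
move=> [p0 pU pI] [q0 qU qI] [z e].
case: (qI _ _ e) => U; last by rewrite U in pU.
by exists z.
Qed.

Lemma UFD_factor x : x != 0 ->
  exists (u : B) (s : seq B), [/\ u \is a GRing.unit,
    {in s, forall p, irreducible_elt p} & x = u * \prod_(p <- s) p].
Proof.
move=> x0; case: (boolP (x \is a GRing.unit)) => U.
  by exists x, [::]; rewrite big_nil mulr1.
have [s sI ->] := hU.1 x x0 U.
by exists 1, s; rewrite unitr1 mul1r.
Qed.

Lemma irreducible_prod_neq0 (s : seq B) :
  {in s, forall p, irreducible_elt p} -> \prod_(p <- s) p != 0.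
Proof. by move=> sI; rewrite prodf_seq_neq0; apply/allP => p /sI[]. Qed.

Lemma irreducible_prime p x y :
  irreducible_elt p -> dvd p (x * y) -> dvd p x \/ dvd p y.
Proof.
move=> pI [z e].
have [x0|x0] := eqVneq x 0; first by left; exists 0; rewrite mul0r.
have [y0|y0] := eqVneq y 0; first by right; exists 0; rewrite mul0r.
have z0 : z != 0.
  by apply/eqP => z0; have := mulf_neq0 x0 y0; rewrite e z0 mul0r eqxx.
have [u [s [Uu sI xE]]] := UFD_factor x0.
have [v [t [Uv tI yE]]] := UFD_factor y0.
have [w [r [Uw rI zE]]] := UFD_factor z0.
(* Uniqueness of factorization compares bare products of irreducibles, so the three units are
   gathered and absorbed into [p]. *)
pose w' := (u * v)^-1 * w.
have Uw' : w' \is a GRing.unit by rewrite unitrM unitrV unitrM Uu Uv Uw.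
have E : \prod_(q <- s ++ t) q = \prod_(q <- (w' * p) :: r) q.
  rewrite big_cat big_cons /= /w' -!mulrA; apply: (@mulrI _ (u * v)).
    by rewrite unitrM Uu.
  rewrite mulVKr ?unitrM ?Uu //.
  have -> : w * (p * \prod_(j <- r) j) = z * p by rewrite zE; ring.
  by rewrite -e xE yE; ring.
have stI : {in s ++ t, forall p, irreducible_elt p}.
  by move=> q; rewrite mem_cat => /orP[/sI|/tI].
have pI' : irreducible_elt (w' * p) by apply: irreducible_associates pI; exists w'.
have rI' : {in w' * p :: r, forall p, irreducible_elt p}.
  by move=> q; rewrite inE => /orP[/eqP->|/rI].
have [t' [pt ss aa]] := hU.2 _ _ rI' stI (esym E).
have := aa 0%N isT; rewrite [(_ :: _)`_0]/= => ass.
have : t'`_0 \in s ++ t by rewrite (perm_mem pt) mem_nth // -ss.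
have dp : dvd p t'`_0.
  by apply: (associates_dvd _ (dvd_refl _)) => [];
     apply: associates_sym; apply: associates_trans ass; exists w'.
rewrite mem_cat => /orP[] h; [left|right].
  by apply: dvd_trans dp _; rewrite xE (big_rem _ h) /= mulrCA; exact/dvd_mulr/dvd_refl.
by apply: dvd_trans dp _; rewrite yE (big_rem _ h) /= mulrCA; exact/dvd_mulr/dvd_refl.
Qed.

Lemma irreducible_ndvd_unit p x : irreducible_elt p -> x \is a GRing.unit -> ~ dvd p x.
Proof. by case=> _ /negP pU _ Ux [z e]; apply: pU; move: Ux; rewrite e unitrM => /andP[]. Qed.

Lemma pval_ex p x : irreducible_elt p -> x != 0 ->
  exists i, exists2 z, x = z * p ^+ i & ~ dvd p z.
Proof.
move=> pI /UFD_factor[u [s [Uu sI ->]]].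
elim: s sI => [_|q s IH sI].
  exists 0%N, u; first by rewrite big_nil expr0.
  exact: irreducible_ndvd_unit.
have qI := sI _ (mem_head _ _).
have [|i [z e nz]] := IH; first by move=> r rs; apply: sI; rewrite inE rs orbT.
rewrite big_cons mulrCA e => {e}.
have [/(irreducible_dvdP pI qI)[w Uw ->]|nd] := EM (dvd p q).
  exists i.+1, (w * z); first by rewrite exprS; ring.
  by case/(irreducible_prime pI) => // /(irreducible_ndvd_unit pI).
exists i, (q * z); first by rewrite mulrA.
by case/(irreducible_prime pI).
Qed.

Lemma pval_uniq p i j z w : p != 0 -> ~ dvd p z -> ~ dvd p w ->
  z * p ^+ i = w * p ^+ j -> i = j.
Proof.
move=> p0; wlog lt_ij : i j z w / (i < j)%N.
  by move=> H nz nw e; case: (ltngtP i j) => // l;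
    [exact: (H i j z w) | symmetry; exact: (H j i w z)].
move=> nz _; rewrite -(subnK (ltnW lt_ij)) exprD mulrA => /mulIf e; case: nz.
exists (w * p ^+ (j - i).-1); rewrite -mulrA -exprSr prednK ?subn_gt0 //.
by apply: e; rewrite expf_neq0.
Qed.

(** For irreducible [p] this is the [p]-adic valuation, with default value [0] at [x = 0]. *)
Definition pval p x : nat :=
  prop_pick 0%N (fun i => exists2 z, x = z * p ^+ i & ~ dvd p z).

Lemma pvalE p x i z : p != 0 -> x = z * p ^+ i -> ~ dvd p z -> pval p x = i.
Proof.
rewrite /pval => p0 xE nz; have [|w xE' nw] := @prop_pickP _ 0%N
    (fun i => exists2 z, x = z * p ^+ i & ~ dvd p z); first by exists i, z.
by apply: (pval_uniq p0 nw nz); rewrite -xE -xE'.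
Qed.

Lemma pvalP p x : irreducible_elt p -> x != 0 ->
  exists2 z, x = z * p ^+ pval p x & ~ dvd p z.
Proof.
move=> pI x0; have [i [z e nz]] := pval_ex pI x0.
by exists z => //; rewrite (pvalE (irreducible_neq0 pI) e nz).
Qed.

Lemma pval_ndvd p x : irreducible_elt p -> ~ dvd p x -> pval p x = 0%N.
Proof.
by move=> pI nd; apply: (@pvalE p x 0 x); rewrite ?irreducible_neq0 ?expr0 ?mulr1.
Qed.

Lemma pval_gt0 p x : irreducible_elt p -> x != 0 -> (0 < pval p x)%N <-> dvd p x.
Proof.
move=> pI x0; split; last first.
  move=> d; rewrite lt0n; apply/eqP => e.
  by have [z] := pvalP pI x0; rewrite e expr0 mulr1 => <-.
have [z {2}-> _] := pvalP pI x0; case: (pval p x) => // i _.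
by exists (z * p ^+ i); rewrite exprSr mulrA.
Qed.

Lemma pvalM p x y : irreducible_elt p -> x != 0 -> y != 0 ->
  pval p (x * y) = (pval p x + pval p y)%N.
Proof.
move=> pI x0 y0; have [z xE nz] := pvalP pI x0; have [w yE nw] := pvalP pI y0.
apply: (@pvalE _ _ _ (z * w)); first exact: irreducible_neq0.
  by rewrite {1}xE {1}yE exprD; ring.
by case/(irreducible_prime pI).
Qed.

Lemma pval_unit p x : irreducible_elt p -> x \is a GRing.unit -> pval p x = 0%N.
Proof. by move=> pI /(irreducible_ndvd_unit pI); exact: pval_ndvd. Qed.

Lemma pvalX p x i : irreducible_elt p -> x != 0 -> pval p (x ^+ i) = (i * pval p x)%N.
Proof.
move=> pI x0; elim: i => [|i IH]; first by rewrite expr0 pval_unit ?unitr1.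
by rewrite exprS pvalM ?expf_neq0 // IH mulSn.
Qed.

Lemma pval_prod (I : eqType) p (s : seq I) (P : pred I) (F : I -> B) :
  irreducible_elt p -> {in s, forall i, F i != 0} ->
  pval p (\prod_(i <- s | P i) F i) = (\sum_(i <- s | P i) pval p (F i))%N.
Proof.
move=> pI; elim: s => [|i s IH] F0; first by rewrite !big_nil pval_unit ?unitr1.
have F0' : {in s, forall i, F i != 0} by move=> j js; apply: F0; rewrite inE js orbT.
rewrite !big_cons; case: ifP => _; last exact: IH.
rewrite pvalM ?IH //; first by rewrite F0 ?mem_head.
rewrite prodf_seq_neq0; apply/allP => j /F0' ->; exact: implybT.
Qed.

(* A representative of the class of associates of p, depending only on the
   class. *)
Definition canon p : B := prop_pick p (associates p).

Lemma associates_refl p : associates p p.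
Proof. by exists 1; rewrite ?unitr1 ?mul1r. Qed.

Lemma canonP p : associates p (canon p).
Proof. by apply: prop_pickP; exists p; exact: associates_refl. Qed.

Lemma canon_associates p q : associates p q -> canon p = canon q.
Proof.
move=> a; apply: eq_prop_pick; first by exists p; exact: associates_refl.
by move=> r; split; [exact/associates_trans/associates_sym | exact: associates_trans].
Qed.

Definition prime_rep p := irreducible_elt p /\ canon p = p.

Lemma prime_rep_canon p : irreducible_elt p -> prime_rep (canon p).
Proof.
move=> pI; split; first exact: irreducible_associates (canonP p) pI.
exact/esym/canon_associates/canonP.
Qed.

Lemma pval_prime_rep p q : prime_rep p -> prime_rep q -> pval p q = (p == q).
Proof.
move=> [pI pc] [qI qc]; case: eqVneq => [<-|pq].
  apply: (@pvalE _ _ _ 1); rewrite ?irreducible_neq0 ?mul1r ?expr1 //.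
  by apply: irreducible_ndvd_unit; rewrite ?unitr1.
apply: pval_ndvd => // /(irreducible_dvdP pI qI)/canon_associates e.
by move: pq; rewrite -pc -qc e eqxx.
Qed.

Lemma prime_rep_factor x : x != 0 ->
  exists (u : B) (s : seq B), [/\ u \is a GRing.unit,
    {in s, forall p, prime_rep p} & x = u * \prod_(p <- s) p].
Proof.
case/UFD_factor => u [s [Uu sI ->]].
elim: s sI => [|p s IH] sI; first by exists u, [::]; rewrite big_nil.
have [|v [t [Uv tI e]]] := IH; first by move=> q qs; apply: sI; rewrite inE qs orbT.
have [w Uw cE] := associates_sym (canonP p).
exists (w * v), (canon p :: t); split; first by rewrite unitrM Uw.
  move=> q; rewrite inE => /orP[/eqP->|/tI //].
  exact/prime_rep_canon/sI/mem_head.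
by rewrite !big_cons {1}cE mulrCA e; ring.
Qed.

Lemma prime_rep_factor_pval x : x != 0 ->
  exists (u : B) (s : seq B), [/\ u \is a GRing.unit, uniq s,
    {in s, forall p, prime_rep p /\ dvd p x} &
    x = u * \prod_(p <- s) p ^+ pval p x].
Proof.
case/prime_rep_factor => u [s [Uu sI xE]].
have s0 : {in s, forall p, p != 0} by move=> p /sI[/irreducible_neq0].
exists u, (undup s); split; rewrite ?undup_uniq //.
  move=> p; rewrite mem_undup => ps; split; first exact: sI.
  by rewrite xE (big_rem _ ps) mulrCA; exact/dvd_mulr/dvd_refl.
rewrite {1}xE; congr (_ * _); rewrite -prodr_undup_exp_count.
apply: eq_big_seq => p; rewrite mem_undup => ps; congr (_ ^+ _).
have pR := sI _ ps; rewrite xE (pvalM pR.1) ?irreducible_prod_neq0 //; last 2 first.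
- by apply: contraTneq Uu => ->; rewrite unitr0.
- by move=> q /sI[].
rewrite (pval_unit pR.1) // (pval_prod _ pR.1) // add0n -sum1_count big_mkcond /=.
by apply: eq_big_seq => q qs; rewrite (pval_prime_rep pR (sI _ qs)) eq_sym; case: eqP.
Qed.

(** Each prime factor of [x] that divides what is left of [y] is moved into the common factor
    [h]. *)
Lemma coprime_cofactors x y : x != 0 ->
  exists h x' y', [/\ x = h * x', y = h * y' &
    forall p, irreducible_elt p -> dvd p x' -> dvd p y' -> False].
Proof.
case/UFD_factor => u [s [Uu sI ->]].
elim: s sI y => [_ y|p s IH sI y].
  exists 1, u, y; rewrite big_nil mulr1 !mul1r; split=> // p pI d.
  by have := irreducible_ndvd_unit pI Uu d.
have pI := sI _ (mem_head _ _).
have {}IH := IH (fun q qs => sI _ (mem_behead (s := p :: s) qs)).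
rewrite big_cons mulrCA.
have [[w ->]|nd] := EM (dvd p y).
  have [h [x' [y' [-> -> cop]]]] := IH w.
  by exists (p * h), x', y'; split=> //; ring.
have [h [x' [y' [-> yE cop]]]] := IH y.
exists h, (p * x'), y'; split=> //; first by ring.
move=> q qI /(irreducible_prime qI)[dq|]; last exact: cop.
move=> dq'; apply: nd; rewrite yE; apply: dvd_mull.
exact/(associates_dvd (irreducible_dvdP qI pI dq)).
Qed.

End UniqueFactorization.

(** * Homogeneous elements *)

Section LexPositive.
Variable m : nat.
Implicit Types g h : 'rV[int]_m.

Definition lex_pos g : Prop :=
  exists i, 0 < g 0 i /\ forall j : 'I_m, (j < i)%N -> g 0 j = 0.

Lemma lex_pos_total g : [\/ g = 0, lex_pos g | lex_pos (- g)].
Proof.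
case: (pickP (fun i => g 0 i != 0)) => [i0 n0|e]; last first.
  by apply: Or31; apply/rowP => i; rewrite mxE; apply/eqP/negbFE/e.
case: (arg_minnP (P := fun i => g 0 i != 0) (fun i : 'I_m => i : nat) n0) => i ni0 imin.
have e (j : 'I_m) : (j < i)%N -> g 0 j = 0.
  by move=> ji; apply: contraTeq ji => /imin; rewrite -leqNgt.
case: (ltrgtP (g 0 i) 0) ni0 => // gi _; [apply: Or33|apply: Or32]; exists i; split=> //.
  by rewrite mxE oppr_gt0.
by move=> j /e ej; rewrite mxE ej oppr0.
Qed.

Lemma lex_posD g h : lex_pos g -> lex_pos h -> lex_pos (g + h).
Proof.
case=> i [gi gj] [i' [hi hj]]; case: (ltngtP i i') => ii.
- exists i; split=> [|j ji]; first by rewrite mxE (hj _ ii) addr0.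
  by rewrite mxE gj // hj ?addr0 // (ltn_trans ji).
- exists i'; split=> [|j ji]; first by rewrite mxE (gj _ ii) add0r.
  by rewrite mxE hj // gj ?addr0 // (ltn_trans ji).
- move/ord_inj: ii => ii; subst i'.
  exists i; split=> [|j ji]; first by rewrite mxE addr_gt0.
  by rewrite mxE gj // hj // addr0.
Qed.

Lemma lex_pos_neq0 g : lex_pos g -> g != 0.
Proof. by case=> i [gi _]; apply: contraTneq gi => ->; rewrite mxE ltxx. Qed.

Lemma lex_max (s : seq 'rV[int]_m) : s != [::] ->
  exists2 g, g \in s & {in s, forall h, h = g \/ lex_pos (g - h)}.
Proof.
elim: s => // g s IH _; case: (eqVneq s [::]) => [->|/IH[k ks kmax]].
  by exists g; rewrite ?mem_head // => h; rewrite inE => /eqP; left.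
case: (lex_pos_total (g - k)) => [/eqP|gk|kg].
- rewrite subr_eq0 => /eqP ->; exists k; rewrite ?mem_head //.
  by move=> h; rewrite inE => /orP[/eqP|/kmax //]; left.
- exists g; rewrite ?mem_head // => h; rewrite inE => /orP[/eqP|/kmax[->|kh]].
  + by left.
  + by right.
  + by right; rewrite -(subrKA k); exact: lex_posD.
- exists k; rewrite ?inE ?ks ?orbT // => h; rewrite inE => /orP[/eqP->|/kmax //].
  by right; rewrite -opprB.
Qed.

(** The maximum of a sumset is attained by one pair only; hence the product of two top components
    cannot be cancelled by other terms. *)
Lemma lex_max_add (s t : seq 'rV[int]_m) g h :
  g \in s -> {in s, forall k, k = g \/ lex_pos (g - k)} ->
  {in t, forall k, k = h \/ lex_pos (h - k)} ->
  {in s & t, forall g' h', g' + h' = g + h -> g' = g /\ h' = h}.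
Proof.
move=> _ smax tmax g' h' /smax gg /tmax hh e.
have e' : (g - g') + (h - h') = 0 by rewrite addrACA -e -opprD subrr.
case: gg => [eg|gg]; first by split=> //; move: e; rewrite eg => /addrI.
case: hh => [eh|hh]; first by split=> //; move: e; rewrite eh => /addIr.
by have := lex_pos_neq0 (lex_posD gg hh); rewrite e' eqxx.
Qed.

End LexPositive.

(** * Homogeneous components, divisors and units *)

Section GradedDomain.
Variables (k : fieldType) (B : idomainType) (iota : {rmorphism k -> B}).
Variables (m : nat) (D : grading iota 'rV[int]_m).
Implicit Types (x y z : B) (g h : 'rV[int]_m).

Lemma gcompD g x y : D g x -> D g y -> D g (x + y).
Proof.
move=> Dx Dy; rewrite -[y]opprK; apply: gcompB => //.
by rewrite -sub0r; apply: gcompB => //; exact: gcomp0.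
Qed.

Lemma gcomp_sum (I : Type) (s : seq I) (P : pred I) (F : I -> B) g :
  (forall i, P i -> D g (F i)) -> D g (\sum_(i <- s | P i) F i).
Proof. by move=> h; apply: big_ind => //; [exact: gcomp0|exact: gcompD]. Qed.

Lemma gcomp1 : D 0 1.
Proof. by rewrite -(rmorph1 iota); exact: gcomp_base. Qed.

Lemma gcompZ c g x : D g x -> D g (iota c * x).
Proof. by move=> Dx; rewrite -[g]add0r; apply: gcompM => //; exact: gcomp_base. Qed.

Lemma gcompX g x i : D g x -> D (g *+ i) (x ^+ i).
Proof.
move=> Dx; elim: i => [|i IH]; first exact: gcomp1.
by rewrite exprS mulrS; exact: gcompM.
Qed.

Lemma gcomp_prod (I : eqType) (s : seq I) (F : I -> B) (d : I -> 'rV[int]_m) :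
  {in s, forall i, D (d i) (F i)} ->
  D (\sum_(i <- s) d i) (\prod_(i <- s) F i).
Proof.
elim: s => [|i s IH] h; first by rewrite !big_nil; exact: gcomp1.
rewrite !big_cons; apply: gcompM; first exact/h/mem_head.
by apply: IH => j js; apply: h; rewrite inE js orbT.
Qed.

(** Several indices may share a degree, so the terms are grouped by degree before directness of the
    sum applies. *)
Lemma gcomp_collect (I : eqType) (s : seq I) (d : I -> 'rV[int]_m) (w : I -> B) :
  (forall i, D (d i) (w i)) -> \sum_(i <- s) w i = 0 ->
  forall g, \sum_(i <- s | d i == g) w i = 0.
Proof.
move=> Dw e g; have [gs|gs] := boolP (g \in undup (map d s)).
  pose f g := \sum_(i <- s | d i == g) w i.
  apply: (@gcomp_direct _ _ _ _ D _ f (undup_uniq (map d s)) _ _ g gs) => //.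
    by move=> h; apply: gcomp_sum => i /eqP <-.
  rewrite -[RHS]e /f (exchange_big_dep predT) //=.
  apply: eq_big_seq => i si; rewrite (big_mkcond (fun j => d i == j)) (bigD1_seq (d i)) ?undup_uniq ?mem_undup ?map_f //=.
  by rewrite eqxx big1 ?addr0 // => h; rewrite eq_sym; case: eqP.
rewrite big1_seq // => i /andP[/eqP dig si].
by move: gs; rewrite -dig mem_undup map_f.
Qed.

Lemma gcomp_collect_hom (I : eqType) (s : seq I) (d : I -> 'rV[int]_m)
    (w : I -> B) e z :
  (forall i, D (d i) (w i)) -> D e z -> \sum_(i <- s) w i = z ->
  forall g, g != e -> \sum_(i <- s | d i == g) w i = 0.
Proof.
move=> Dw Dz E g ge.
(* The extra index [None] carries [- z], which makes the total zero. *)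
pose d' (o : option I) := if o is Some i then d i else e.
pose w' (o : option I) := if o is Some i then w i else - z.
have := @gcomp_collect _ (None :: map Some s) d' w' _ _ g; rewrite !big_cons !big_map /=.
rewrite eq_sym (negPf ge); apply; last by rewrite E addNr.
case=> //=; rewrite -sub0r; apply: gcompB => //; exact: gcomp0.
Qed.

Lemma gcomp_uniq g h x : D g x -> D h x -> x != 0 -> g = h.
Proof.
move=> Dg Dh; apply: contraNeq => gh; apply/eqP.
have := @gcomp_collect_hom unit [:: tt] (fun=> g) (fun=> x) h x.
by rewrite big_seq1 => /(_ (fun=> Dg) Dh erefl g gh); rewrite big_cons big_nil /= eqxx addr0.
Qed.

Lemma gcomp_decomp x : exists (s : seq 'rV[int]_m) (f : 'rV[int]_m -> B),
  [/\ uniq s, forall g, D g (f g), {in s, forall g, f g != 0} &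
      x = \sum_(g <- s) f g].
Proof.
have [s [f [Df ->]]] := gcomp_span D x.
pose f' g := \sum_(h <- s | h == g) f h.
have E : \sum_(g <- s) f g = \sum_(g <- undup s) f' g.
  rewrite /f' (exchange_big_dep predT) //=.
  apply: eq_big_seq => i si; rewrite (big_mkcond (fun j => i == j)) (bigD1_seq i) ?undup_uniq ?mem_undup //=.
  by rewrite eqxx big1 ?addr0 // => h; rewrite eq_sym; case: eqP.
exists [seq g <- undup s | f' g != 0], f'; split.
- by rewrite filter_uniq ?undup_uniq.
- by move=> g; apply: gcomp_sum => h /eqP <-.
- by move=> g; rewrite mem_filter => /andP[].
- by rewrite E big_filter [RHS]big_mkcond; apply: eq_bigr => g _; case: eqP.
Qed.

Lemma gcomp_top_product (s t : seq 'rV[int]_m) (f f' : 'rV[int]_m -> B) e g h :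
  uniq s -> uniq t -> (forall g, D g (f g)) -> (forall g, D g (f' g)) ->
  g \in s -> h \in t -> f g * f' h != 0 ->
  {in s & t, forall g' h', g' + h' = g + h -> g' = g /\ h' = h} ->
  D e ((\sum_(g <- s) f g) * (\sum_(h <- t) f' h)) -> g + h = e.
Proof.
move=> us ut Df Df' gs ht n0 uq De; apply/eqP; apply: contraNT n0 => ne.
pose r := [seq (g, h) | g <- s, h <- t].
have E : \sum_(i <- r) f i.1 * f' i.2 = (\sum_(g <- s) f g) * (\sum_(h <- t) f' h).
  by rewrite big_allpairs_dep big_distrlr.
have Dr (i : 'rV[int]_m * 'rV[int]_m) : D (i.1 + i.2) (f i.1 * f' i.2).
  exact: gcompM.
have := gcomp_collect_hom Dr De E ne.
rewrite big_mkcond big_allpairs_dep /= (bigD1_seq g) //= (bigD1_seq h) //= eqxx.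
rewrite big1_seq ?addr0; last first.
  move=> h' /andP[hh ht']; case: eqP => // /(uq _ _ gs ht')[_ /eqP].
  by rewrite (negPf hh).
rewrite big1_seq ?addr0; last first.
  move=> g' /andP[gg gs']; rewrite big1_seq // => h' /andP[_ ht'].
  by case: eqP => // /(uq _ _ gs' ht')[/eqP]; rewrite (negPf gg).
by move=> ->.
Qed.

(** In a domain the product of the two top components survives, and so does that of the two bottom
    ones. Both must have degree [e], so the top and bottom degrees of [x] coincide. *)
Lemma gcomp_divisor e x y : D e (x * y) -> x * y != 0 -> exists g, D g x.
Proof.
move=> De; rewrite mulf_eq0 negb_or => /andP[x0 y0].
have [s [f [us Df f0 xE]]] := gcomp_decomp x.
have [t [f' [ut Df' f'0 yE]]] := gcomp_decomp y.
have sn : s != [::] by apply: contraNneq x0 => s0; rewrite xE s0 big_nil.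
have tn : t != [::] by apply: contraNneq y0 => t0; rewrite yE t0 big_nil.
have [g gs gmax] := lex_max sn; have [h ht hmax] := lex_max tn.
(* The bottom degrees are the maxima of the negated lists. *)
have oppn (r : seq 'rV[int]_m) : r != [::] -> map -%R r != [::] by case: r.
have [_ /mapP[g' gs' ->] gmin] := lex_max (oppn _ sn).
have [_ /mapP[h' ht' ->] hmin] := lex_max (oppn _ tn).
rewrite xE yE in De.
have E : g + h = e.
  apply: (gcomp_top_product us ut Df Df' gs ht _ (lex_max_add gs gmax hmax) De).
  exact: mulf_neq0 (f0 _ gs) (f'0 _ ht).
have E' : g' + h' = e.
  apply: (gcomp_top_product us ut Df Df' gs' ht' _ _ De).
    exact: mulf_neq0 (f0 _ gs') (f'0 _ ht').
  move=> a b sa tb eab.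
  have [] := @lex_max_add _ _ _ (- g') (- h') _ gmin hmin (- a) (- b) _ _ _.
  - exact: map_f.
  - exact: map_f.
  - exact: map_f.
  - by rewrite -!opprD eab.
  by move=> /oppr_inj -> /oppr_inj ->.
have [gg _] : g' = g /\ h' = h.
  by apply: (lex_max_add gs gmax hmax) => //; rewrite E E'.
have sg : {in s, forall a, a = g}.
  move=> a sa; case: (gmax _ sa) => // ga.
  case: (gmin _ (map_f _ sa)) => [/oppr_inj -> //|]; rewrite gg opprK addrC => ag.
  by have := lex_pos_neq0 (lex_posD ga ag); rewrite addrA subrK subrr eqxx.
exists g; rewrite xE big_seq; apply: gcomp_sum => a /sg ->; exact: Df.
Qed.

Lemma gcomp_dvd e p x : D e x -> x != 0 -> dvd p x -> exists g, D g p.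
Proof.
by move=> De x0 [z xE]; apply: (@gcomp_divisor e p z); rewrite mulrC -xE.
Qed.

(* The degree of a homogeneous element; junk on other elements. *)
Definition deg x : 'rV[int]_m := prop_pick 0 (fun g => D g x).

Definition hom x := exists g, D g x.

Lemma degP x : hom x -> D (deg x) x.
Proof. exact: prop_pickP. Qed.

Lemma degE g x : D g x -> x != 0 -> deg x = g.
Proof. by move=> Dx x0; apply: gcomp_uniq x0 => //; apply: degP; exists g. Qed.

Hypotheses (hB0 : degree0_is_base D) (hunm : unmixed D).

(** A unit and its inverse divide [1], so they are homogeneous, of opposite degrees; unmixedness
    makes both degrees zero. *)
Lemma gcomp_unit x : x \is a GRing.unit -> exists2 c, c != 0 & x = iota c.
Proof.
move=> Ux; have x0 : x != 0 by apply: contraTneq Ux => ->; rewrite unitr0.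
have xi0 : x^-1 != 0 by rewrite invr_eq0.
have D1 : D 0 (x * x^-1) by rewrite divrr //; exact: gcomp1.
have [g Dg] : exists g, D g x.
  by apply: gcomp_divisor D1 _; rewrite divrr ?oner_neq0.
have [h Dh] : exists g, D g x^-1.
  by rewrite mulrC in D1; apply: gcomp_divisor D1 _; rewrite mulVr ?oner_neq0.
have gh : g + h = 0.
  apply: gcomp_uniq (gcompM Dg Dh) _ _; first by rewrite divrr //; exact: gcomp1.
  by rewrite divrr ?oner_neq0.
have hE : h = - g by apply/eqP; rewrite -addr_eq0 addrC gh.
have g0 : g = 0 by apply: hunm; [exists x | exists x^-1; rewrite -?hE].
rewrite g0 in Dg; have [c xE] := (hB0 x).1 Dg.
by exists c => //; apply: contraNneq x0 => c0; rewrite xE c0 rmorph0.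
Qed.

Lemma iota_unit c : c != 0 -> iota c \is a GRing.unit.
Proof. by move=> c0; rewrite rmorph_unit ?unitfE. Qed.

End GradedDomain.

(** * Lueroth's theorem *)

Lemma rmorphism_ex (R S : pzRingType) (f : R -> S) :
  zmod_morphism f -> monoid_morphism f ->
  exists g : {rmorphism R -> S}, g =1 f.
Proof.
move=> fB fM.
pose g := HB.pack_for {rmorphism R -> S} f
  (GRing.isZmodMorphism.Build _ _ f fB) (GRing.isMonoidMorphism.Build _ _ f fM).
by exists g.
Qed.

Local Open Scope quotient_scope.

Lemma fracP (A : idomainType) (x : {fraction A}) :
  exists a b : A, b != 0 /\ x = tofrac a / tofrac b.
Proof.
elim/quotW: x => x; exists (\n_x), (\d_x); split; first exact: denom_ratioP.
apply: (canRL (mulfK _)); first by rewrite tofrac_eq0 denom_ratioP.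
apply/eqP; rewrite -[_ * _]/(FracField.mul _ _) !piE.
rewrite FracField.equivfE /FracField.mulf.
by rewrite !numden_Ratio ?mulf_neq0 ?oner_eq0 // ?denom_ratioP // !mulr1 mulrC.
Qed.

Local Close Scope quotient_scope.

Lemma tofrac_div_eq (A : idomainType) (a b c d : A) : b != 0 -> d != 0 ->
  tofrac a / tofrac b = tofrac c / tofrac d -> a * d = c * b.
Proof.
move=> b0 d0 /eqP; rewrite eqr_div ?tofrac_eq0 // -!tofracM tofrac_eq.
by move/eqP.
Qed.

(* [pi] extends to the field [L] as soon as every element of [L] is a fraction
   whose denominator is not killed by [pi]: a place that is finite on [L]. *)
Lemma place_morphism (L : fieldType) (A : idomainType) (K : fieldType)
    (psi : {rmorphism L -> {fraction A}}) (pi : {rmorphism A -> K}) :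
  (forall w, exists a b, pi b != 0 /\ psi w = tofrac a / tofrac b) ->
  exists psi' : {rmorphism L -> K}, forall w a b,
    pi b != 0 -> psi w = tofrac a / tofrac b -> psi' w = pi a / pi b.
Proof.
move=> rep.
have [n nP] := choice rep; have [d dP] := choice nP.
pose f w := pi (n w) / pi (d w).
have pi0 b : pi b != 0 -> b != 0 by apply: contraNneq => ->; rewrite rmorph0.
have fE w a b : pi b != 0 -> psi w = tofrac a / tofrac b -> f w = pi a / pi b.
  move=> b0; have [d0 ->] := dP w => /(tofrac_div_eq (pi0 _ d0) (pi0 _ b0)) e.
  by apply/eqP; rewrite eqr_div // -!rmorphM e.
have fB : zmod_morphism f.
  move=> x y; have [dx xE] := dP x; have [dy yE] := dP y.
  rewrite (@fE _ (n x * d y - n y * d x) (d x * d y)) ?rmorphM ?mulf_neq0 //.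
    rewrite rmorphB ?rmorphM /= /f -[in RHS]mulNr addf_div //; congr (_ / _); ring.
  rewrite rmorphB /= xE yE -[in LHS]mulNr addf_div ?tofrac_eq0 ?pi0 //.
  by rewrite tofracB !tofracM; congr (_ / _); ring.
have fM : monoid_morphism f.
  split=> [|x y].
    by rewrite (@fE _ 1 1) ?rmorph1 ?oner_neq0 ?divr1.
  have [dx xE] := dP x; have [dy yE] := dP y.
  rewrite (@fE _ (n x * n y) (d x * d y)) ?rmorphM ?mulf_neq0 //.
    by rewrite ?rmorphM /= /f mulf_div.
  by rewrite /= xE yE mulf_div ?tofracM.
by have [g gE] := rmorphism_ex fB fM; exists g => w a b; rewrite gE; exact: fE.
Qed.

(** * Valuation rings and algebraic elements *)

Section AlgebraicValuation.
Variables (k : closedFieldType) (L : fieldType) (j : {rmorphism k -> L}).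
Implicit Types (u w : L) (p : {poly k}).

Definition peval u : {poly k} -> L := horner_eval u \o map_poly j.

HB.instance Definition _ u := GRing.RMorphism.on (peval u).

Arguments peval : simpl never.

Lemma pevalE u p : peval u p = (map_poly j p).[u]. Proof. by []. Qed.

Lemma pevalC u c : peval u c%:P = j c.
Proof. by rewrite pevalE map_polyC hornerC. Qed.

Lemma pevalX u : peval u 'X = u.
Proof. by rewrite pevalE map_polyX hornerX. Qed.

Lemma peval_split u p : exists c (s : seq k),
  [/\ p != 0 -> c != 0 & peval u p = j c * \prod_(r <- s) (u - j r)].
Proof.
have [s e] := closed_field_poly_normal p.
exists (lead_coef p), s; split; first by rewrite lead_coef_eq0.
rewrite {1}e -mul_polyC rmorphM /= pevalC rmorph_prod /=; congr (_ * _).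
by apply: eq_bigr => r _; rewrite rmorphB /= pevalX pevalC.
Qed.

(** For [u] outside [k] this is algebraicity over [k(u)]: [k] is algebraically closed, so [u] is
    transcendental and [P] stays nonzero under [peval u]. *)
Definition algebraic_over_gen u w :=
  exists2 P : {poly {poly k}}, P != 0 & (map_poly (peval u) P).[w] = 0.

(** Nonzero polynomials in [u] split into linear factors invertible in [O], so [O] contains [k(u)].
    If [v] lies in [O], dividing its equation over [k[u]] by powers of [v] until the constant term
    is nonzero expresses the inverse of [v] by elements of [O]. *)
Lemma valuation_ring_full (O : L -> Prop) u :
  (forall x y, O x -> O y -> O (x + y)) -> (forall x y, O x -> O y -> O (x * y)) ->
  (forall c, O (j c)) -> O u -> (forall r, O (u - j r)^-1) ->
  (forall r, u != j r) ->
  (forall w, w != 0 -> O w \/ O w^-1) ->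
  (forall w, algebraic_over_gen u w) -> forall w, O w.
Proof.
move=> OD OM Oj Ou Our uj OV alg w.
have [->|w0] := eqVneq w 0; first by rewrite -(rmorph0 j).
have [//|Ov] := OV w w0; rewrite -[w]invrK; set v := w^-1 in Ov *.
have v0 : v != 0 by rewrite invr_eq0.
have OP (p : {poly k}) : O (peval u p).
  elim/poly_ind: p => [|p c IH]; first by rewrite rmorph0 -(rmorph0 j).
  by rewrite rmorphD rmorphM /= pevalX pevalC; apply: (OD) => //; exact: OM.
have OPP (P : {poly {poly k}}) : O (map_poly (peval u) P).[v].
  elim/poly_ind: P => [|P c IH]; first by rewrite rmorph0 horner0 -(rmorph0 j).
  by rewrite rmorphD rmorphM /= map_polyX map_polyC hornerMXaddC; apply: (OD); [exact: OM | exact: OP].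
have [P P0 e] := alg v.
elim/poly_ind: P P0 e => [|P c IH]; first by rewrite eqxx.
rewrite rmorphD rmorphM /= map_polyX map_polyC hornerMXaddC.
have [-> P0|c0 _ e] := eqVneq c 0.
  rewrite raddf0 addr0 => /eqP; rewrite mulf_eq0 (negPf v0) orbF => /eqP.
  by apply: IH; apply: contraNneq P0 => ->; rewrite mul0r addr0.
have [a [s [/(_ c0) a0 cE]]] := peval_split u c.
have ja0 : j a != 0 by rewrite fmorph_eq0.
have cu0 : peval u c != 0.
  rewrite cE mulf_neq0 // prodf_seq_neq0; apply/allP => r _ /=.
  by rewrite subr_eq0.
have Oc : O (peval u c)^-1.
  rewrite cE invfM; apply: (OM); first by rewrite -fmorphV.
  elim: s {cE} => [|r s IHs]; first by rewrite big_nil invr1 -(rmorph1 j).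
  by rewrite big_cons invfM; apply: (OM).
have -> : v^-1 = j (- 1) * (map_poly (peval u) P).[v] * (peval u c)^-1.
  have e' : (map_poly (peval u) P).[v] * v = - peval u c.
    by apply/eqP; rewrite -addr_eq0; apply/eqP.
  apply: (mulIf v0); rewrite mulVf // mulrAC -(mulrA (j _)) e'.
  by rewrite rmorphN rmorph1 mulN1r opprK divff.
by apply: (OM) => //; exact: OM.
Qed.

End AlgebraicValuation.

(** * Constants outside finite sets *)

Section ClosedFieldPoints.
Variable k : closedFieldType.

Lemma closed_field_fresh (s : seq k) : exists c, c \notin s.
Proof.
(* [p] takes the value [1] on [s]; the additional factor at [0] keeps it nonconstant when [s] is
   empty. *)
pose p := \prod_(a <- 0 :: s) ('X - a%:P) + 1.
have [|c] := closed_rootP p _.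
  have e : size (\prod_(a <- 0 :: s) ('X - a%:P)) = (size s).+2.
    by rewrite size_prod_XsubC.
  by rewrite /p size_polyDl e ?size_poly1.
rewrite rootE hornerD horner_prod hornerC => c0; exists c; apply/negP => cs.
move: c0; rewrite big_cons (big_rem c cs) /= !hornerXsubC subrr mul0r mulr0 add0r.
by rewrite oner_eq0.
Qed.

Lemma closed_field_uniq_seq (t : seq k) (n : nat) :
  exists s : seq k, [/\ uniq s, size s = n & {in s, forall c, c \notin t}].
Proof.
elim: n => [|n [s [us ss st]]]; first by exists [::].
have [c] := closed_field_fresh (s ++ t); rewrite mem_cat negb_or => /andP[cs ct].
exists (c :: s); split; rewrite /= ?cs ?ss // => a.
by rewrite inE => /orP[/eqP ->|/st].
Qed.

Lemma poly_nonroot (R : idomainType) (j : {rmorphism k -> R}) (p : {poly R}) (t : seq k) :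
  p != 0 -> exists2 c, c \notin t & p.[j c] != 0.
Proof.
move=> p0; have [s [us ss st]] := closed_field_uniq_seq t (size p).
case: (boolP (all (root p) (map j s))) => [r|].
  have := max_poly_roots p0 r; rewrite map_inj_uniq ?us; last exact: fmorph_inj.
  by rewrite size_map ss ltnn => /(_ isT).
rewrite -has_predC => /hasP[_ /mapP[c cs ->]] nr.
by exists c; [exact: st | ].
Qed.

End ClosedFieldPoints.

(** * Removing variables by specialization *)

Section Specialization.
Variable k : closedFieldType.

Definition has_points (R : idomainType) (cR : {rmorphism k -> R}) : Prop :=
  forall a : R, a != 0 ->
    exists2 e : {rmorphism R -> k}, e a != 0 & forall c, e (cR c) = c.

Definition polyC_comp (R : idomainType) (cR : {rmorphism k -> R}) :
    {rmorphism k -> {poly R}} :=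
  GRing.RMorphism.clone _ _ (polyC \o cR) _.

Lemma has_points_poly (R : idomainType) (cR : {rmorphism k -> R}) :
  has_points cR -> has_points (polyC_comp cR).
Proof.
move=> h a a0.
have [c _ ac] := poly_nonroot cR [::] a0.
have [e ea eC] := h _ ac.
exists (GRing.RMorphism.clone _ _ (e \o horner_eval (cR c)) _) => //.
by move=> d; rewrite /= /horner_eval hornerC eC.
Qed.

(** The valuation ring of the place [X = x] is pulled back to [L]. The value of [u] there is not in
    [k], so each [u - r] is invertible in it and [valuation_ring_full] makes all of [L] finite at
    [x]; evaluation is the embedding. *)
Lemma place_at (S : idomainType) (cS : {rmorphism k -> S}) (L : fieldType)
    (j : {rmorphism k -> L}) (psi : {rmorphism L -> {fraction {poly S}}})
    (u : L) (x : S) (a b : {poly S}) :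
  (forall c, psi (j c) = tofrac (cS c)%:P) ->
  psi u = tofrac a / tofrac b -> b.[x] != 0 ->
  (forall r, a.[x] != cS r * b.[x]) -> (forall w, algebraic_over_gen j u w) ->
  exists psi' : {rmorphism L -> {fraction S}}, forall c, psi' (j c) = tofrac (cS c).
Proof.
move=> psiC uE bx abx alg.
pose pi : {rmorphism {poly S} -> {fraction S}} :=
  GRing.RMorphism.clone _ _ (@tofrac S \o horner_eval x) _.
have piE p : (pi p != 0) = (p.[x] != 0) by rewrite /pi /= tofrac_eq0.
pose O w := exists p q : {poly S}, q.[x] != 0 /\ psi w = tofrac p / tofrac q.
have nz (q : {poly S}) : q.[x] != 0 -> tofrac q != 0.
  by rewrite tofrac_eq0; apply: contraNneq => ->; rewrite horner0.
have OD v w : O v -> O w -> O (v + w).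
  case=> [p [q [q0 e]]] [p' [q' [q'0 e']]].
  exists (p * q' + p' * q), (q * q'); rewrite hornerM mulf_neq0 //; split=> //.
  by rewrite rmorphD /= e e' addf_div ?nz // tofracD !tofracM.
have OM v w : O v -> O w -> O (v * w).
  case=> [p [q [q0 e]]] [p' [q' [q'0 e']]].
  exists (p * p'), (q * q'); rewrite hornerM mulf_neq0 //; split=> //.
  by rewrite rmorphM /= e e' mulf_div !tofracM.
have Oj c : O (j c).
  by exists (cS c)%:P, 1; rewrite hornerC oner_neq0 tofrac1 divr1.
have Ou : O u by exists a, b.
have Our r : O (u - j r)^-1.
  exists b, (a - (cS r)%:P * b); split.
    by rewrite hornerD hornerN hornerM hornerC subr_eq0.
  rewrite fmorphV rmorphB /= psiC uE; apply: (canLR (@invrK _)).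
  rewrite invf_div tofracB tofracM mulrBl mulfK ?nz //.
have uj r : u != j r.
  apply: contraTneq (abx r) => uE'; rewrite negbK.
  have b0 : b != 0 by apply: contraNneq bx => ->; rewrite horner0.
  have := uE; rewrite uE' psiC -[X in X = _]divr1 -tofrac1.
  move/(tofrac_div_eq (oner_neq0 _) b0); rewrite mulr1 => <-.
  by rewrite hornerM hornerC.
have OV w : w != 0 -> O w \/ O w^-1.
  move=> w0; have [p [q [q0 wE]]] := fracP (psi w).
  have p0 : p != 0.
    apply: contraNneq w0 => p0; have := wE; rewrite p0 tofrac0 mul0r.
    by move/eqP; rewrite fmorph_eq0.
  have [n1 [p' p'x pE]] := multiplicity_XsubC p x.
  have [n2 [q' q'x qE]] := multiplicity_XsubC q x.
  rewrite p0 /= in p'x; rewrite q0 /= in q'x.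
  (* After the powers of [t] are split off, whichever of [w] and its inverse keeps a nonnegative
     power of [t] is finite at [x]. *)
  set t := 'X - x%:P in pE qE.
  have t0 : tofrac t != 0 by rewrite tofrac_eq0 polyXsubC_eq0.
  have p'0 : tofrac p' != 0 by rewrite nz.
  have q'0 : tofrac q' != 0 by rewrite nz.
  have wE' : psi w = (tofrac p' / tofrac q') * (tofrac t ^+ n1 / tofrac t ^+ n2).
    by rewrite wE pE qE !tofracM !tofracXn -mulf_div.
  have tX n n' : (n' <= n)%N -> tofrac t ^+ n / tofrac t ^+ n' = tofrac (t ^+ (n - n')).
    by move=> le; rewrite -expfB_cond ?(negPf t0) // tofracXn.
  case: (leqP n2 n1) => [n12|/ltnW n12]; [left|right].
    exists (p' * t ^+ (n1 - n2)), q'; split=> //.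
    by rewrite wE' tX // tofracM mulrAC.
  exists (q' * t ^+ (n2 - n1)), p'; split=> //.
  by rewrite fmorphV wE' invfM !invf_div tX // tofracM mulrAC.
have full := valuation_ring_full OD OM Oj Ou Our uj OV alg.
have [|psi' psi'E] := @place_morphism _ _ _ psi pi.
  by move=> w; have [p [q [q0 e]]] := full w; exists p, q; rewrite piE.
exists psi' => c; rewrite (psi'E _ (cS c)%:P 1) ?rmorph1 ?oner_neq0 //.
  by rewrite divr1 /= /horner_eval hornerC.
by rewrite psiC divr1.
Qed.

(* Specialize the outer variable to a constant [c] of [k] if some [c] keeps [u]
   nonconstant. Otherwise [u] depends on the outer variable only, and it stays
   nonconstant when that variable is specialized to the inner one. *)
Lemma place_step (R : idomainType) (cR : {rmorphism k -> R}) (L : fieldType)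
    (j : {rmorphism k -> L}) (u : L)
    (psi : {rmorphism L -> {fraction {poly {poly R}}}}) :
  has_points cR -> (forall c, psi (j c) = tofrac (cR c)%:P%:P) ->
  (forall r, u != j r) -> (forall w, algebraic_over_gen j u w) ->
  exists psi' : {rmorphism L -> {fraction {poly R}}},
    forall c, psi' (j c) = tofrac (cR c)%:P.
Proof.
move=> hR psiC uj alg.
have [a [b [b0 uE]]] := fracP (psi u).
pose cS := polyC_comp cR.
have {}psiC c : psi (j c) = tofrac (cS c)%:P by exact: psiC.
have [[c [bc abc]]|nc] := EM (exists c, b.[cS c] != 0 /\
    forall r, a.[cS c] != cS r * b.[cS c]).
  exact: place_at psiC uE bc abc alg.
have lb0 : lead_coef b != 0 by rewrite lead_coef_eq0.
have [e eb eC] := has_points_poly hR lb0.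
pose a0 := map_poly e a; pose b0' := map_poly e b.
have b0'0 : b0' != 0.
  apply: contraNneq eb => h; have := coef_map e b (size b).-1.
  by rewrite -/b0' h coef0 => <-.
(* Applying the point [e] to the coefficients does not change [u]: at a constant [c] with [b]
   nonzero, the value of [u] is some [r] in [k], and [e] fixes [r]. So the difference of the two
   sides vanishes at every such [c]. *)
have E : a * map_poly cS b0' = map_poly cS a0 * b.
  apply/eqP; rewrite -subr_eq0; apply: contraT => d0.
  have [c _] := poly_nonroot cS [::] (mulf_neq0 d0 b0).
  rewrite hornerM mulf_eq0 negb_or => /andP[dc bc].
  case: nc; exists c; split=> // r; apply: contraNneq dc => ac.
  rewrite hornerD hornerN !hornerM !horner_map.
  have -> : a0.[c] = r * b0'.[c].
    by rewrite -[c in LHS]eC -[c in RHS]eC !horner_map ac rmorphM /= eC.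
  by rewrite ac rmorphM /=; apply/eqP; ring.
have cb0 : map_poly cS b0' != 0 by rewrite map_poly_eq0.
have uE' : psi u = tofrac (map_poly cS a0) / tofrac (map_poly cS b0').
  by rewrite uE; apply/eqP; rewrite eqr_div ?tofrac_eq0 // -!tofracM E.
have X_at p : (map_poly cS p).['X] = map_poly cR p.
  rewrite /cS /= map_poly_comp; exact: comp_polyXr.
apply: (place_at psiC uE' (x := 'X) _ _ alg); first by rewrite X_at map_poly_eq0.
move=> r; rewrite !X_at; apply: contraTneq (uj r) => e'; rewrite negbK.
suff h : psi u = psi (j r) by rewrite (fmorph_inj _ h).
rewrite uE' psiC; apply: (canLR (mulfK _)); first by rewrite tofrac_eq0.
rewrite -tofracM; congr tofrac; rewrite -map_polyC -rmorphM; congr map_poly.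
apply: (map_inj_poly (fmorph_inj cR) (rmorph0 _)).
by rewrite e' rmorphM /= map_polyC.
Qed.

(** Univariate polynomials are iterated because [place_step] removes the outermost variable. *)
Fixpoint iter_poly (s : nat) : idomainType :=
  if s is s'.+1 then {poly iter_poly s'} else k.

Fixpoint iter_polyC (s : nat) : {rmorphism k -> iter_poly s} :=
  match s with
  | 0 => GRing.RMorphism.clone _ _ (@idfun k) _
  | s'.+1 => polyC_comp (iter_polyC s')
  end.

Lemma iter_poly_points s : has_points (iter_polyC s).
Proof.
elim: s => [|s IH]; last exact: has_points_poly.
by move=> a a0; exists (GRing.RMorphism.clone _ _ (@idfun k) _).
Qed.

Lemma frac_iter_poly_reduce (L : fieldType) (j : {rmorphism k -> L}) (u : L) s
    (psi : {rmorphism L -> {fraction iter_poly s}}) :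
  (forall c, psi (j c) = tofrac (iter_polyC s c)) ->
  (forall r, u != j r) -> (forall w, algebraic_over_gen j u w) ->
  exists psi' : {rmorphism L -> {fraction {poly k}}},
    forall c, psi' (j c) = tofrac c%:P.
Proof.
move=> psiC uj alg; elim: s psi psiC => [|[|s] IH] psi psiC.
(* With no variable the target is [k] itself, which leaves no room for a nonconstant [u]. *)
- have [a [b [b0 uE]]] := fracP (psi u).
  suff e : psi u = psi (j (a / b)) by move: (uj (a / b)); rewrite (fmorph_inj _ e) eqxx.
  rewrite uE psiC; apply: (canLR (mulfK _)); first by rewrite tofrac_eq0.
  by rewrite -tofracM /= divfK.
- by exists psi.
have [psi' psi'C] := place_step (@iter_poly_points s) psiC uj alg.
exact: IH psi'C.
Qed.

End Specialization.

(** * From multivariate to iterated polynomials *)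

Section MpolyIterated.

Lemma muni_eq0 (R : nzRingType) n (p : {mpoly R[n.+1]}) : muni p = 0 -> p = 0.
Proof.
move=> p0; apply/mpolyP => m; rewrite mcoeff0.
have [mp|] := boolP (m \in msupp p); last exact: memN_msupp_eq0.
pose restr (m : 'X_{1..n.+1}) := [multinom m (widen_ord (leqnSn n) i) | i < n].
have := congr1 (fun q : {poly {mpoly R[n]}} => (q`_(m ord_max))@_(restr m)) p0.
rewrite muniE coef_sum raddf_sum /= coef0 mcoeff0.
rewrite (bigD1_seq m) ?msupp_uniq //= big1_seq ?addr0.
  by rewrite coefZ coefXn eqxx mulr1 mcoeffZ mcoeffX eqxx mulr1.
move=> m' /andP[/eqP ne _]; rewrite coefZ coefXn; case: eqP => [em|_]; last first.
  by rewrite mulr0 mcoeff0.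
rewrite mulr1 mcoeffZ mcoeffX; case: eqP => [er|_]; last by rewrite mulr0.
case: ne; apply/mnmP => i.
case: (unliftP ord_max i) => [j ->|->]; last exact/esym.
have -> : lift ord_max j = widen_ord (leqnSn n) j.
  by apply: val_inj; rewrite /= /bump leqNgt ltn_ord.
by have := congr1 (fun m : 'X_{1..n} => m j) er; rewrite !mnmE.
Qed.

Lemma mpoly_iter_poly (k : closedFieldType) s :
  exists2 e : {rmorphism {mpoly k[s]} -> iter_poly k s}, injective e &
    forall c, e c%:MP = iter_polyC k s c.
Proof.
elim: s => [|s [e einj eC]].
  exists (GRing.RMorphism.clone _ _ (meval (fun=> 0 : k)) _).
    move=> p q; rewrite /= (nvar0_mpolyC p) (nvar0_mpolyC q) !mevalC.
    by move=> ->.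
  by move=> c; rewrite /= mevalC.
exists (GRing.RMorphism.clone _ _ (map_poly e \o @muni s k) _).
  apply: raddf_inj => p /= e0; apply: muni_eq0.
  by apply: (map_inj_poly einj (rmorph0 e)); rewrite e0 rmorph0.
by move=> c; rewrite /= muniC map_polyC /= eC.
Qed.

Lemma frac_mpoly_reduce (k : closedFieldType) s (L : fieldType)
    (j : {rmorphism k -> L}) (psi : {rmorphism L -> {fraction {mpoly k[s]}}}) (u : L) :
  (forall c, psi (j c) = tofrac (c%:MP : {mpoly k[s]})) ->
  (forall r, u != j r) -> (forall w, algebraic_over_gen j u w) ->
  exists psi' : {rmorphism L -> {fraction {poly k}}},
    forall c, psi' (j c) = tofrac c%:P.
Proof.
move=> psiC uj alg; have [e einj eC] := mpoly_iter_poly k s.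
pose pi : {rmorphism {mpoly k[s]} -> {fraction iter_poly k s}} :=
  GRing.RMorphism.clone _ _ (@tofrac _ \o e) _.
have [|f fE] := @place_morphism _ _ _ psi pi.
  move=> w; have [a [b [b0 ->]]] := fracP (psi w); exists a, b; split=> //.
  by rewrite /= tofrac_eq0 raddf_eq0.
apply: (@frac_iter_poly_reduce k L j u s f) => // c.
rewrite (fE _ c%:MP 1) ?rmorph1 ?oner_neq0 ?divr1 ?psiC ?tofrac1 ?divr1 //.
by rewrite /= eC.
Qed.

End MpolyIterated.

(** * Gauss's lemma for polynomials over k[t] *)

Section GaussLemma.
Variable k : closedFieldType.
Implicit Types (P Q H : {poly {poly k}}) (d : {poly k}).

Definition specialize (r : k) : {poly {poly k}} -> {poly k} := map_poly (horner_eval r).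

HB.instance Definition _ r := GRing.RMorphism.on (specialize r).

Lemma specializeC r d : specialize r d%:P = (d.[r])%:P.
Proof. by rewrite /specialize map_polyC. Qed.

Lemma specialize_eq0 r P : specialize r P = 0 -> exists Q, P = ('X - r%:P)%:P * Q.
Proof.
move=> P0; exists (map_poly (fun p => p %/ ('X - r%:P)) P); apply/polyP => i.
rewrite coefCM coef_map_id0 ?div0p // mulrC divpK // dvdp_XsubCl rootE.
by have := congr1 (fun q : {poly k} => q`_i) P0; rewrite /specialize coef_map coef0 => /eqP.
Qed.

(** The primes of [k[t]] are the [t - r], up to constants, so trivial content means that no
    specialization of [t] kills [P]. *)
Definition primitive P := forall r, specialize r P != 0.

Lemma primitive_part P : P != 0 ->
  exists d Q, [/\ d != 0, P = d%:P * Q & primitive Q].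
Proof.
elim: {P}(size (lead_coef P)) {-2}P (leqnn (size (lead_coef P))) => [|n IH] P.
  by rewrite leqn0 size_poly_eq0 lead_coef_eq0 => /eqP ->; rewrite eqxx.
move=> sP P0; have [[r Pr]|np] := EM (exists r, specialize r P = 0); last first.
  exists 1, P; rewrite oner_neq0 mul1r; split=> // r.
  by apply/eqP => e; apply: np; exists r.
have [Q PE] := specialize_eq0 Pr.
have Q0 : Q != 0 by apply: contraNneq P0 => Q0; rewrite PE Q0 mulr0.
have [|//|d [R [d0 QE Rp]]] := IH Q.
  rewrite -ltnS (leq_trans _ sP) // PE lead_coefM lead_coefC.
  by rewrite size_mul ?polyXsubC_eq0 ?lead_coef_eq0 // size_XsubC.
exists (('X - r%:P) * d), R; rewrite mulf_neq0 ?polyXsubC_eq0 //; split=> //.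
by rewrite PE QE polyCM mulrA.
Qed.

(** The linear factors of [d] are cancelled one by one: at a root [r] of [d] the specialization of
    [P] is nonzero, so that of [H] vanishes and [t - r] divides [H]. *)
Lemma gauss P Q H d : primitive P -> d != 0 -> d%:P * Q = P * H ->
  exists H', Q = P * H'.
Proof.
move=> Pp; elim: {d}(size d) {-2}d (leqnn (size d)) H => [|n IH] d.
  by rewrite leqn0 size_poly_eq0 => /eqP ->; rewrite eqxx.
move=> sd H d0 e; have [s1|s1] := eqVneq (size d) 1%N.
  have /size_poly1P[c c0 dE] : size d == 1%N by rewrite s1.
  by exists ((c^-1)%:P%:P * H); rewrite mulrCA -e dE mulrA -!polyCM mulVf // mul1r.
have [r /factor_theorem[d' dE]] := closed_rootP d s1.
have [H' HE] : exists H', H = ('X - r%:P)%:P * H'.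
  apply: specialize_eq0; apply/eqP; have := congr1 (specialize r) e.
  rewrite !rmorphM /= specializeC dE hornerM hornerXsubC subrr mulr0 mul0r.
  by move/esym/eqP; rewrite mulf_eq0 (negPf (Pp r)).
have d'0 : d' != 0 by apply: contraNneq d0 => h; rewrite dE h mul0r.
have X0 : ('X - r%:P)%:P != 0 :> {poly {poly k}} by rewrite polyC_eq0 polyXsubC_eq0.
apply: (IH d' _ H') => //.
  by rewrite -ltnS (leq_trans _ sd) // dE size_mul ?polyXsubC_eq0 // size_XsubC addn2.
apply: (mulfI X0); rewrite [RHS]mulrCA -HE -e dE polyCM mulrA; congr (_ * _); exact: mulrC.
Qed.

Lemma clear_denominators (P : {poly {fraction {poly k}}}) :
  exists d Q, d != 0 /\ map_poly (@tofrac _) Q = tofrac d *: P.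
Proof.
elim/poly_ind: P => [|P c [d [Q [d0 QE]]]].
  by exists 1, 0; rewrite oner_neq0 rmorph0 scaler0.
have [a [b [b0 ->]]] := fracP c.
exists (d * b), (b%:P * Q * 'X + (d * a)%:P); rewrite mulf_neq0 //; split=> //.
have E : tofrac (d * a) = tofrac (d * b) * (tofrac a / tofrac b).
  by rewrite !tofracM -mulrA [tofrac b * _]mulrC divfK ?tofrac_eq0.
have -> : map_poly (@tofrac _) (b%:P * Q * 'X + (d * a)%:P) =
    (tofrac b)%:P * map_poly (@tofrac _) Q * 'X + (tofrac (d * a))%:P.
  by rewrite rmorphD [in LHS]rmorphM [in LHS]rmorphM /= map_polyX !map_polyC.
rewrite QE E tofracM polyCM.
rewrite -[tofrac d *: P]mul_polyC -[RHS]mul_polyC polyCM mulrDr; apply: f_equal2 => //.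
have aux (R : comNzRingType) (x y z t : R) : x * (y * z) * t = y * x * (z * t) by ring.
exact: aux.
Qed.

End GaussLemma.

(** * The generator of a subfield of k(t) *)

Section Luroth.
Variables (k : closedFieldType) (L : fieldType) (j : {rmorphism k -> L}).
Variable phi : {rmorphism L -> {fraction {poly k}}}.
Hypothesis phiC : forall c, phi (j c) = tofrac c%:P.
Implicit Types (w : L) (a b p q : {poly k}).

Let T : {fraction {poly k}} := tofrac 'X.
Local Notation tF := (map_poly (@tofrac {poly k})).

(* The outer variable of {poly {poly k}} is X, the inner one is t. *)
Definition cross a b : {poly {poly k}} :=
  map_poly polyC a * b%:P - a%:P * map_poly polyC b.

Lemma horner_frac_const a : (map_poly phi (map_poly j a)).[T] = tofrac a.
Proof.
rewrite -map_poly_comp; elim/poly_ind: a => [|a c IH].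
  by rewrite !rmorph0 horner0.
rewrite rmorphD !rmorphM /= map_polyX map_polyC hornerMXaddC IH /= phiC.
by rewrite tofracD tofracM.
Qed.

(** A polynomial over [L] with root [t] when [phi w = a / b]; clearing its denominator turns it into
    [cross a b]. *)
Definition annihil a b w : {poly L} := map_poly j a - w *: map_poly j b.

Lemma annihil_root a b w : b != 0 -> phi w = tofrac a / tofrac b ->
  (map_poly phi (annihil a b w)).[T] = 0.
Proof.
move=> b0 wE; rewrite rmorphB /= map_polyZ hornerD hornerN hornerZ.
by rewrite !horner_frac_const /= wE divfK ?subrr ?tofrac_eq0.
Qed.

Lemma annihil_neq0 a b w : b != 0 -> (forall c, w != j c) -> annihil a b w != 0.
Proof.
move=> b0 wj; apply: contraNneq (wj (a`_(size b).-1 / lead_coef b)) => e.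
have := congr1 (fun P : {poly L} => P`_(size b).-1) e.
rewrite coef0 coefB coefZ !coef_map /= -/(lead_coef b) => /eqP.
rewrite subr_eq0 => /eqP e'.
have lb : j (lead_coef b) != 0 by rewrite fmorph_eq0 lead_coef_eq0.
by rewrite rmorphM fmorphV /= e' mulfK.
Qed.

Lemma tF_cross a b w : b != 0 -> phi w = tofrac a / tofrac b ->
  tF (cross a b) = tofrac b *: map_poly phi (annihil a b w).
Proof.
move=> b0 wE; rewrite /cross rmorphB !rmorphM /= !map_polyC /= /annihil.
rewrite rmorphB /= map_polyZ /= wE scalerBr scalerA [tofrac b * _]mulrC.
rewrite divfK ?tofrac_eq0 // mul_polyC mulrC mul_polyC.
have E p : tF (map_poly polyC p) = map_poly phi (map_poly j p).
  by rewrite -!map_poly_comp; apply: eq_map_poly => c /=; rewrite phiC.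
by rewrite !E.
Qed.

Lemma tF_inj : injective tF.
Proof. by apply: map_inj_poly; [move=> x y /eqP; rewrite tofrac_eq => /eqP | exact: tofrac0]. Qed.

(* [F] is the minimal polynomial of [T] over [L] and [Phi] is [F] cleared of its
   denominators; the divisibility is Gauss's lemma. *)
Lemma luroth_minimal_factor w0 : (forall c, w0 != j c) ->
  exists (F : {poly L}) (Phi : {poly {poly k}}) (c : {fraction {poly k}}),
    [/\ F \is monic, (map_poly phi F).[T] = 0, c != 0,
        tF Phi = c *: map_poly phi F & primitive Phi /\
    forall w a b, b != 0 -> phi w = tofrac a / tofrac b ->
      exists M, cross a b = Phi * M].
Proof.
move=> w0j.
pose good n := `[< exists F : {poly L}, [/\ F != 0, (map_poly phi F).[T] = 0 & size F = n] >].
have ex : exists n, good n.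
  have [a [b [b0 wE]]] := fracP (phi w0).
  exists (size (annihil a b w0)); apply/asboolP; exists (annihil a b w0).
  by split=> //; [exact: annihil_neq0 | exact: annihil_root].
have [_ /asboolP[F0 [F00 F0T <-]] Fmin] := ex_minnP ex.
pose F := (lead_coef F0)^-1 *: F0.
have lF0 : (lead_coef F0)^-1 != 0 by rewrite invr_eq0 lead_coef_eq0.
have Fm : F \is monic by rewrite monicE lead_coefZ mulVf // lead_coef_eq0.
have sF : size F = size F0 by rewrite size_scale.
have FT : (map_poly phi F).[T] = 0 by rewrite map_polyZ hornerZ F0T mulr0.
have Fdvd G : (map_poly phi G).[T] = 0 -> F %| G.
  move=> GT; apply/modp_eq0P/eqP; apply: contraT => R0.
  have : good (size (G %% F)).
    apply/asboolP; exists (G %% F); split=> //.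
    have := congr1 (fun P => (map_poly phi P).[T]) (divp_eq G F).
    by rewrite rmorphD rmorphM hornerD hornerM FT mulr0 add0r GT => <-.
  move/Fmin; rewrite -sF leqNgt ltn_modp monic_neq0 //.
have [d [Q [d0 QE]]] := clear_denominators (map_poly phi F).
have F0' : map_poly phi F != 0 by rewrite map_poly_eq0 monic_neq0.
have Q0 : Q != 0.
  apply: contraNneq F0' => Q0; move: QE; rewrite Q0 rmorph0 => /esym/eqP.
  by rewrite scaler_eq0 tofrac_eq0 (negPf d0).
have [e [Phi [e0 QPhi Phip]]] := primitive_part Q0.
have PhiE : tF Phi = (tofrac d / tofrac e) *: map_poly phi F.
  have e0' : tofrac e != 0 by rewrite tofrac_eq0.
  apply: (scalerI e0'); rewrite scalerA mulrCA divff // mulr1 -QE QPhi.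
  by rewrite rmorphM /= map_polyC mul_polyC.
exists F, Phi, (tofrac d / tofrac e); split=> //.
  by rewrite mulf_neq0 ?invr_eq0 ?tofrac_eq0.
split=> // w a b b0 wE.
have /dvdpP[R RE] := Fdvd _ (annihil_root b0 wE).
have [f [Q' [f0 Q'E]]] := clear_denominators (tofrac b * (tofrac e / tofrac d) *: map_poly phi R).
apply: (gauss Phip f0 (H := Q')); apply: tF_inj.
rewrite !rmorphM /= map_polyC /= (tF_cross b0 wE) RE rmorphM /= Q'E PhiE.
have E : (tofrac d / tofrac e)%:P * (tofrac e / tofrac d)%:P = 1.
  by rewrite -polyCM -[tofrac e / _]invf_div divff // mulf_neq0 ?invr_eq0 ?tofrac_eq0.
rewrite -!mul_polyC [(tofrac b * _)%:P]polyCM.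
have aux (R' : comNzRingType) (c c' x y F' R1 : R') : c * c' = 1 ->
    x * (y * (R1 * F')) = c * F' * (x * (y * c' * R1)).
  by move=> e1; rewrite -[LHS]mul1r -e1; ring.
exact: aux.
Qed.

Lemma swap_cross a b : swapXY (cross a b) = - cross a b.
Proof.
by rewrite /cross rmorphB !rmorphM /= !swapXY_map_polyC !swapXY_polyC opprB mulrC.
Qed.

Lemma cross_horner a b x : (cross a b).[x%:P] = a.[x] *: b - b.[x] *: a.
Proof.
rewrite /cross hornerD hornerN !hornerM !hornerC !horner_map /=.
by rewrite [in X in _ - X]mulrC !mul_polyC.
Qed.

Lemma size_cross a b : (size (cross a b) <= maxn (size a) (size b))%N.
Proof.
rewrite (leq_trans (size_polyD _ _)) // size_polyN geq_max; apply/andP; split.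
  by rewrite mulrC mul_polyC (leq_trans (size_scale_leq _ _)) // (leq_trans (size_poly _ _)) // leq_maxl.
by rewrite mul_polyC (leq_trans (size_scale_leq _ _)) // (leq_trans (size_poly _ _)) // leq_maxr.
Qed.

Lemma frac_not_const w a b c : b != 0 -> phi w = tofrac a / tofrac b ->
  (forall c, w != j c) -> a != c *: b.
Proof.
move=> b0 wE wj; apply: contraNneq (wj c) => e; rewrite -(inj_eq (fmorph_inj phi)).
by rewrite wE phiC e -mul_polyC tofracM mulfK ?tofrac_eq0.
Qed.

Lemma cross_neq0 w a b x : b != 0 -> phi w = tofrac a / tofrac b ->
  (forall c, w != j c) -> (a.[x] != 0) || (b.[x] != 0) ->
  (cross a b).[x%:P] != 0.
Proof.
move=> b0 wE wj; rewrite cross_horner subr_eq0.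
have [-> /=|bx _] := eqVneq b.[x] 0.
  by rewrite orbF scale0r => ax; rewrite scaler_eq0 negb_or ax.
apply: contraNneq (frac_not_const (a.[x] / b.[x]) b0 wE wj) => e.
by rewrite mulrC -scalerA e scalerA mulVf // scale1r.
Qed.

(** [u] is a nonconstant coefficient of the minimal polynomial [F] of [t], in lowest terms [p / q].
    Since [p] and [q] divide coefficients of [Phi], the degree of [Phi] in [t] is at least that of
    [cross p q], whose degrees in [X] and [t] agree by antisymmetry. So the cofactor [M] involves
    [X] only, and a root of [M] would contradict coprimality of [p] and [q]; thus [M] is
    constant. *)
Lemma luroth_generator w0 : (forall c, w0 != j c) ->
  exists u p q, [/\ forall c, u != j c, q != 0, phi u = tofrac p / tofrac q &
    forall w a b, b != 0 -> phi w = tofrac a / tofrac b ->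
      exists M, cross a b = cross p q * M].
Proof.
move=> w0j; have [F [Phi [c [Fm FT c0 PhiE [Phip Phidvd]]]]] := luroth_minimal_factor w0j.
(* If all coefficients were constant, [F] would be a nonzero polynomial over [k] with root [t]. *)
have [i Fi] : exists i, forall d, F`_i != j d.
  apply: contrapT => nex.
  have /choice[f fE] : forall i, exists d, F`_i = j d.
    move=> i; apply: contrapT => nd; apply: nex; exists i => d.
    by apply/eqP => e; apply: nd; exists d.
  have FE : F = map_poly j (\poly_(i < size F) f i).
    apply/polyP => i; rewrite coef_map coef_poly; case: ltnP => //= si.
    by rewrite rmorph0 nth_default.
  move: FT; rewrite FE horner_frac_const => /eqP; rewrite tofrac_eq0 => /eqP e.
  by have := monic_neq0 Fm; rewrite FE e rmorph0 eqxx.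
pose m := (size F).-1.
have Fm1 : F`_m = 1 by exact: (monicP Fm).
have cE l : tofrac Phi`_l = c * phi F`_l.
  have := congr1 (fun P : {poly {fraction {poly k}}} => P`_l) PhiE.
  by rewrite coefZ !coef_map.
have cm : tofrac Phi`_m = c by rewrite cE Fm1 rmorph1 mulr1.
have Pm0 : Phi`_m != 0 by rewrite -tofrac_eq0 cm.
pose e := gcdp Phi`_i Phi`_m.
pose p := Phi`_i %/ e; pose q := Phi`_m %/ e.
have pE : Phi`_i = p * e by rewrite divpK // dvdp_gcdl.
have qE : Phi`_m = q * e by rewrite divpK // dvdp_gcdr.
have e0 : e != 0 by rewrite gcdp_eq0 negb_and Pm0 orbT.
have q0 : q != 0 by apply: contraNneq Pm0 => q0; rewrite qE q0 mul0r.
have cpq : coprimep p q by rewrite coprimep_div_gcd // Pm0 orbT.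
have uE : phi F`_i = tofrac p / tofrac q.
  apply: (canRL (mulfK _)); first by rewrite tofrac_eq0.
  have te0 : tofrac e != 0 by rewrite tofrac_eq0.
  by apply: (mulIf te0); rewrite -mulrA -!tofracM -pE -qE cm cE mulrC.
exists F`_i, p, q; split=> //.
have [M ME] := Phidvd _ _ _ q0 uE.
have C0 x : (cross p q).[x%:P] != 0.
  apply: cross_neq0 q0 uE Fi _; have [px|//] := eqVneq p.[x] 0.
  by rewrite (coprimep_root cpq) ?orbT // rootE px.
have G0 : cross p q != 0 by apply: contraNneq (C0 0) => ->; rewrite horner0.
have [Phi0 M0] : Phi != 0 /\ M != 0.
  by apply/andP; rewrite -negb_or -mulf_eq0 -ME.
have sle : (size (cross p q) <= size (swapXY Phi))%N.
  rewrite -sizeYE (leq_trans (size_cross _ _)) // geq_max; apply/andP; split.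
    apply: leq_trans (max_size_coefXY Phi i); have [->|p0] := eqVneq p 0.
      by rewrite size_poly0.
    by rewrite pE size_mul // -subn1 -addnBA ?leq_addr // size_poly_gt0.
  apply: leq_trans (max_size_coefXY Phi m).
  by rewrite qE size_mul // -subn1 -addnBA ?leq_addr // size_poly_gt0.
have sM : (size (swapXY M) <= 1)%N.
  have : size (cross p q) = size (swapXY Phi * swapXY M).
    by rewrite -rmorphM -ME /= swap_cross size_polyN.
  rewrite size_mul ?swapXY_eq0 // => sE; move: sle; rewrite sE.
  have : (0 < size (swapXY Phi))%N by rewrite size_poly_gt0 swapXY_eq0.
  case: (size (swapXY Phi)) => // x _; rewrite addSn /= -[X in (_ <= X)%N]addn1.
  by rewrite leq_add2l.
have ME' : M = map_poly polyC (swapXY M)`_0.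
  by rewrite -swapXY_polyC -size1_polyC ?swapXYK.
have : size (swapXY M)`_0 == 1%N.
  apply: contraT => /closed_rootP[x /eqP Mx]; have := C0 x.
  by rewrite ME hornerM ME' horner_map Mx mulr0 eqxx.
case/size_poly1P => d d0 Md w a b b0 wE.
have [M' M'E] := Phidvd _ _ _ b0 wE.
exists ((d^-1)%:P%:P * M'); rewrite M'E ME ME' Md map_polyC -mulrA; congr (_ * _).
by rewrite mulrA -!polyCM divff // mul1r.
Qed.

End Luroth.

(** * Every element is rational in the generator *)

Section LurothTheorem.
Variables (k : closedFieldType) (L : fieldType) (j : {rmorphism k -> L}).
Implicit Types (u w : L) (p q : {poly k}).

Definition rational_in u w :=
  exists p q, peval j u q != 0 /\ w = peval j u p / peval j u q.

Lemma rational_inC u c : rational_in u (j c).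
Proof. by exists c%:P, 1; rewrite rmorph1 oner_neq0 divr1 pevalC. Qed.

Lemma rational_in_gen u : rational_in u u.
Proof. by exists 'X, 1; rewrite rmorph1 oner_neq0 divr1 pevalX. Qed.

Lemma rational_inM u w w' : rational_in u w -> rational_in u w' -> rational_in u (w * w').
Proof.
move=> [p [q [q0 ->]]] [p' [q' [q0' ->]]].
exists (p * p'), (q * q'); rewrite !rmorphM mulf_neq0 //; split=> //.
by rewrite mulf_div.
Qed.

Lemma rational_inB u w w' : rational_in u w -> rational_in u w' -> rational_in u (w - w').
Proof.
move=> [p [q [q0 ->]]] [p' [q' [q0' ->]]].
exists (p * q' - p' * q), (q * q'); rewrite [peval _ _ (q * q')]rmorphM mulf_neq0 //; split=> //.
by rewrite rmorphB !rmorphM -[in LHS]mulNr addf_div // mulNr.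
Qed.

Lemma rational_inV u w : rational_in u w -> rational_in u w^-1.
Proof.
have [->|w0] := eqVneq w 0; first by rewrite invr0.
move=> [p [q [q0 wE]]]; exists q, p; rewrite wE invf_div; split=> //.
by apply: contraNneq w0 => p0; rewrite wE p0 mul0r.
Qed.

(* Descent on the height of [w], by dividing (w - w(x0)) / (w - w(x1)) by the
   analogous expression in [u]. *)
Theorem luroth (phi : {rmorphism L -> {fraction {poly k}}}) w0 :
  (forall c, phi (j c) = tofrac c%:P) -> (forall c, w0 != j c) ->
  exists u, (forall c, u != j c) /\ forall w, rational_in u w.
Proof.
move=> phiC w0j; have [u [p [q [uj q0 uE div]]]] := luroth_generator phiC w0j.
exists u; split=> // w.
have [a [b [b0 wE]]] := fracP (phi w).
have [n] := ubnP (maxn (size a) (size b)).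
elim: n w a b b0 wE => // n IH w a b b0 wE sab.
have [[c ->]|wj'] := EM (exists c, w = j c); first exact: rational_inC.
have wj c : w != j c by apply/eqP => e; apply: wj'; exists c.
have [x0 _ bx0] := poly_nonroot (GRing.RMorphism.clone _ _ (@idfun k) _) [::] b0.
rewrite /= in bx0.
have C0 : (cross a b).[x0%:P] != 0 by apply: cross_neq0 wE wj _; rewrite ?bx0 ?orbT.
(* [x1] is chosen so that [a / b] takes different values at [x0] and [x1]; this keeps the final
   denominator [den] nonzero. *)
have [x1 _] := poly_nonroot (GRing.RMorphism.clone _ _ (@idfun k) _) [::] (mulf_neq0 C0 b0).
rewrite /= hornerM mulf_eq0 negb_or => /andP[ab01 bx1].
have C1 : (cross a b).[x1%:P] != 0 by apply: cross_neq0 wE wj _; rewrite ?bx1 ?orbT.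
rewrite cross_horner hornerD hornerN !hornerZ in ab01.
have [M ME] := div _ _ _ b0 wE.
have CE x : (cross a b).[x%:P] = (cross p q).[x%:P] * M.[x%:P].
  by rewrite ME hornerM.
(* The factor [(cross p q).[x%:P]] vanishes at [x], so it is nonconstant and its cofactor has
   smaller size. *)
have sM x : (cross a b).[x%:P] != 0 -> (size M.[x%:P] < maxn (size a) (size b))%N.
  move=> Cx; have := Cx; rewrite CE mulf_eq0 negb_or => /andP[px Mx].
  have s2 : (1 < size (cross p q).[x%:P])%N.
    apply: (@root_size_gt1 _ x) => //; rewrite rootE cross_horner.
    by rewrite hornerD hornerN !hornerZ mulrC subrr.
  have sC : (size (cross a b).[x%:P] <= maxn (size a) (size b))%N.
    rewrite cross_horner (leq_trans (size_polyD _ _)) // size_polyN maxnC.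
    by rewrite geq_max !(leq_trans (size_scale_leq _ _)) // ?leq_maxl ?leq_maxr.
  apply: leq_trans sC; rewrite CE size_mul //.
  by case: (size _) s2 => [|[|s]] // _; rewrite !addSn /= ltnS leq_addl.
pose A x := j a.[x] - w * j b.[x]; pose P x := j p.[x] - u * j q.[x].
have AE x : phi (A x) = tofrac (cross a b).[x%:P] / tofrac b.
  rewrite rmorphB rmorphM /= !phiC wE; apply: (canRL (mulfK _)).
    by rewrite tofrac_eq0.
  rewrite mulrBl mulrAC divfK ?tofrac_eq0 // -!tofracM -tofracB.
  by rewrite cross_horner -!mul_polyC [in RHS](mulrC _ a).
have PE x : phi (P x) = tofrac (cross p q).[x%:P] / tofrac q.
  rewrite rmorphB rmorphM /= !phiC uE; apply: (canRL (mulfK _)).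
    by rewrite tofrac_eq0.
  rewrite mulrBl mulrAC divfK ?tofrac_eq0 // -!tofracM -tofracB.
  by rewrite cross_horner -!mul_polyC [in RHS](mulrC _ p).
have M0 x : (cross a b).[x%:P] != 0 -> M.[x%:P] != 0.
  by rewrite CE mulf_eq0 negb_or => /andP[].
have P0 x : (cross a b).[x%:P] != 0 -> (cross p q).[x%:P] != 0.
  by rewrite CE mulf_eq0 negb_or => /andP[].
pose v := (A x0 / P x0) / (A x1 / P x1).
have vE : phi v = tofrac M.[x0%:P] / tofrac M.[x1%:P].
  have E x : (cross a b).[x%:P] != 0 ->
      phi (A x / P x) = tofrac M.[x%:P] * (tofrac q / tofrac b).
    move=> Cx; rewrite rmorphM fmorphV /= AE PE CE tofracM invf_div mulf_div.
    apply/eqP; rewrite mulrA eqr_div ?mulf_neq0 ?tofrac_eq0 ?P0 //; apply/eqP.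
    ring.
  have qb : tofrac q / tofrac b != 0 by rewrite mulf_neq0 ?invr_eq0 ?tofrac_eq0.
  by rewrite /v rmorphM fmorphV /= (E _ C0) (E _ C1) -mulf_div divff // mulr1.
have vR : rational_in u v.
  apply: IH vE _; first exact: M0.
  rewrite -ltnS; apply: leq_trans sab; rewrite ltnS gtn_max.
  by apply/andP; split; exact: sM.
have PR x : rational_in u (P x).
  apply: rational_inB; first exact: rational_inC.
  by apply: rational_inM; [exact: rational_in_gen | exact: rational_inC].
have A0 x : (cross a b).[x%:P] != 0 -> A x != 0.
  by move=> Cx; rewrite -(fmorph_eq0 phi) AE mulf_neq0 ?invr_eq0 ?tofrac_eq0.
have P0' x : (cross a b).[x%:P] != 0 -> P x != 0.
  by move=> Cx; rewrite -(fmorph_eq0 phi) PE mulf_neq0 ?invr_eq0 ?tofrac_eq0 ?P0.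
pose y := v * (P x0 / P x1).
have yR : rational_in u y.
  by apply: rational_inM => //; apply: rational_inM => //; exact: rational_inV.
have yE : A x0 = y * A x1.
  have [a0 a1] := (A0 _ C0, A0 _ C1); have [p0 p1] := (P0' _ C0, P0' _ C1).
  by rewrite /y /v; field; rewrite a1 p0 p1.
have den : y * j b.[x1] - j b.[x0] != 0.
  apply: contraNneq ab01 => /eqP; rewrite subr_eq0 => /eqP e.
  rewrite -(fmorph_eq0 j) rmorphB !rmorphM /=.
  move: yE; rewrite /A mulrBr mulrCA e => /(congr1 (fun z => z + w * j b.[x0])).
  rewrite !subrK => ->; rewrite -e; apply/eqP; ring.
(* The relation [yE] is affine in [w], with leading coefficient [den] up to sign. *)
have -> : w = (y * j a.[x1] - j a.[x0]) * (y * j b.[x1] - j b.[x0])^-1.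
  apply: (canRL (mulfK den)); rewrite /A in yE.
  have -> : j a.[x0] = y * (j a.[x1] - w * j b.[x1]) + w * j b.[x0].
    by rewrite -yE subrK.
  ring.
have RB x z := rational_inB (rational_inM yR (rational_inC u x)) (rational_inC u z).
by apply: rational_inM => //; apply: rational_inV.
Qed.

End LurothTheorem.

(** * Homogeneous fractions of degree zero *)

Section Subfield.
Variables (F : fieldType) (S : divringClosed F).

Definition subfield := {z : F | z \in S}.

HB.instance Definition _ := [isSub of subfield for @sval _ _].
HB.instance Definition _ := [Choice of subfield by <:].
HB.instance Definition _ := [SubChoice_isSubComUnitRing of subfield by <:].
HB.instance Definition _ := [SubComUnitRing_isSubIntegralDomain of subfield by <:].
HB.instance Definition _ := [SubIntegralDomain_isSubField of subfield by <:].

End Subfield.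

Section DegreeZeroFractions.
Variables (k : fieldType) (B : idomainType) (iota : {rmorphism k -> B}).
Variables (m : nat) (D : grading iota 'rV[int]_m).
Implicit Types (g h : 'rV[int]_m) (z : {fraction B}).

Definition frac_comp g z := exists h x y,
  [/\ D (g + h) x, D h y, y != 0 & z = tofrac x / tofrac y].

Lemma frac_comp0 g : frac_comp g 0.
Proof.
exists 0, 0, 1; rewrite oner_neq0 tofrac0 mul0r; split=> //; first exact: gcomp0.
exact: gcomp1.
Qed.

Lemma frac_compM g h z w : frac_comp g z -> frac_comp h w -> frac_comp (g + h) (z * w).
Proof.
move=> [g' [x [y [Dx Dy y0 ->]]]] [h' [x' [y' [Dx' Dy' y0' ->]]]].
exists (g' + h'), (x * x'), (y * y'); rewrite mulf_neq0 //; split=> //.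
- by rewrite addrACA; exact: gcompM.
- exact: gcompM.
- by rewrite mulf_div -!tofracM.
Qed.

Lemma frac_compB g z w : frac_comp g z -> frac_comp g w -> frac_comp g (z - w).
Proof.
move=> [g' [x [y [Dx Dy y0 ->]]]] [h' [x' [y' [Dx' Dy' y0' ->]]]].
exists (g' + h'), (x * y' - x' * y), (y * y'); rewrite mulf_neq0 //; split=> //.
- apply: gcompB; first by rewrite addrA; exact: gcompM.
  by rewrite [g' + h']addrC addrA; exact: gcompM.
- exact: gcompM.
- by rewrite -mulNr addf_div ?tofrac_eq0 // tofracB !tofracM mulNr.
Qed.

Lemma frac_compV g z : frac_comp g z -> frac_comp (- g) z^-1.
Proof.
have [-> _|z0] := eqVneq z 0; first by rewrite invr0; exact: frac_comp0.
move=> [h [x [y [Dx Dy y0 zE]]]]; exists (g + h), y, x; split=> //.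
- by rewrite addKr.
- by apply: contraNneq z0 => x0; rewrite zE x0 tofrac0 mul0r.
- by rewrite zE invf_div.
Qed.

Lemma frac_comp_hom g x : D g x -> frac_comp g (tofrac x).
Proof.
move=> Dx; exists 0, x, 1; rewrite addr0 oner_neq0 tofrac1 divr1; split=> //.
exact: gcomp1.
Qed.

Lemma frac_compX g z i : frac_comp g z -> frac_comp (g *+ i) (z ^+ i).
Proof.
move=> Dz; elim: i => [|i IH].
  by rewrite expr0 mulr0n -tofrac1; apply: frac_comp_hom; exact: gcomp1.
by rewrite exprS mulrS; exact: frac_compM.
Qed.

Lemma frac_comp_prod (I : Type) (s : seq I) (F : I -> {fraction B}) d :
  (forall i, frac_comp (d i) (F i)) ->
  frac_comp (\sum_(i <- s) d i) (\prod_(i <- s) F i).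
Proof.
move=> h; elim: s => [|i s IH]; last by rewrite !big_cons; exact: frac_compM.
by rewrite !big_nil -tofrac1; apply: frac_comp_hom; exact: gcomp1.
Qed.

(** Over the homogeneous common denominator [Y], all degrees shift by [H] and the claim becomes
    [gcomp_collect]. *)
Lemma frac_collect (I : eqType) (s : seq I) (d : I -> 'rV[int]_m)
    (z : I -> {fraction B}) :
  (forall i, frac_comp (d i) (z i)) -> \sum_(i <- s) z i = 0 ->
  forall g, \sum_(i <- s | d i == g) z i = 0.
Proof.
move=> Dz e g.
have /choice[h /choice[x /choice[y xyP]]] := Dz.
pose Y := \prod_(i <- s) y i; pose H := \sum_(i <- s) h i.
have Y0 : Y != 0 by rewrite prodf_seq_neq0; apply/allP => i _; case: (xyP i).
have /choice[x' x'P] : forall i, exists x', D (d i + H) x' /\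
    (i \in s -> z i = tofrac x' / tofrac Y).
  move=> i; have [is_|is_] := boolP (i \in s); last first.
    by exists 0; split=> //; exact: gcomp0.
  have [Dx Dy y0 zE] := xyP i.
  have tY0 : tofrac (\prod_(j <- rem i s) y j) != 0.
    by rewrite tofrac_eq0 prodf_seq_neq0; apply/allP => j _; case: (xyP j).
  exists (x i * \prod_(j <- rem i s) y j); split=> [|_]; last first.
    by rewrite zE /Y (big_rem _ is_) /= !tofracM -mulf_div divff ?mulr1.
  rewrite /H (big_rem _ is_) addrA; apply: gcompM => //.
  by apply: gcomp_prod => j _; case: (xyP j).
have zE : {in s, forall i, z i * tofrac Y = tofrac (x' i)}.
  by move=> i /(x'P i).2 ->; rewrite divfK ?tofrac_eq0.
have tY : tofrac Y != 0 by rewrite tofrac_eq0.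
apply: (mulIf tY); rewrite mul0r mulr_suml.
rewrite big_seq_cond (eq_bigr (fun i => tofrac (x' i))) -?big_seq_cond; last first.
  by move=> i /andP[/zE].
rewrite -rmorph_sum /= -[RHS]tofrac0; congr tofrac.
rewrite (eq_bigl (fun i => d i + H == g + H)); last first.
  by move=> i; rewrite (can_eq (addrK H)).
apply: (gcomp_collect (D := D)); first by move=> i; case: (x'P i).
apply/eqP; rewrite -tofrac_eq0 rmorph_sum /= big_seq.
rewrite -(eq_bigr _ (fun i si => zE i si)) -big_seq.
by rewrite -mulr_suml e mul0r.
Qed.

Definition deg0_frac_pred : {pred {fraction B}} := fun z => `[< frac_comp 0 z >].

Lemma deg0_fracP z : reflect (frac_comp 0 z) (z \in deg0_frac_pred).
Proof. exact: asboolP. Qed.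

Lemma deg0_frac_closed : divring_closed deg0_frac_pred.
Proof.
split.
- by apply/deg0_fracP; rewrite -tofrac1; apply: frac_comp_hom; exact: gcomp1.
- by move=> z w /deg0_fracP Dz /deg0_fracP Dw; apply/deg0_fracP; exact: frac_compB.
- move=> z w /deg0_fracP Dz /deg0_fracP/frac_compV Dw; apply/deg0_fracP.
  by rewrite -[0]addr0 -{2}oppr0; exact: frac_compM.
Qed.

HB.instance Definition _ :=
  GRing.isDivringClosed.Build {fraction B} deg0_frac_pred deg0_frac_closed.

Definition deg0_frac : fieldType := subfield deg0_frac_pred.

Lemma frac_comp_base c : frac_comp 0 (tofrac (iota c)).
Proof. by apply: frac_comp_hom; exact: gcomp_base. Qed.

Lemma deg0_frac_base : exists j : {rmorphism k -> deg0_frac},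
  forall c, \val (j c) = tofrac (iota c).
Proof.
pose f c : deg0_frac := Sub (tofrac (iota c)) (introT (deg0_fracP _) (frac_comp_base c)).
have [||j jE] := @rmorphism_ex _ _ f.
- by move=> x y; apply: val_inj; rewrite rmorphB /= !rmorphB.
- by split=> [|x y]; apply: val_inj; rewrite ?rmorph1 /= ?rmorph1 // rmorphM /= !rmorphM.
by exists j => c; rewrite jE.
Qed.

Lemma deg0_frac_ex z : frac_comp 0 z -> exists w : deg0_frac, \val w = z.
Proof. by move/deg0_fracP => h; exists (Sub z h). Qed.

End DegreeZeroFractions.

Lemma deg0_field (k : fieldType) (B : idomainType) (iota : {rmorphism k -> B})
    (m : nat) (D : grading iota 'rV[int]_m) :
  exists (L : fieldType) (v : {rmorphism L -> {fraction B}}) (j : {rmorphism k -> L}),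
    (forall c, v (j c) = tofrac (iota c)) /\
    (forall z, frac_comp D 0 z <-> exists w, v w = z).
Proof.
have [j jE] := deg0_frac_base D.
exists (deg0_frac D), (GRing.RMorphism.clone _ _ (\val : deg0_frac D -> _) _), j.
split=> // z; split; first exact: deg0_frac_ex.
by case=> w <-; apply/deg0_fracP; exact: (svalP w).
Qed.

(** * Integer vectors and their rational rank *)

Section IntegerRows.
Variable m : nat.
Implicit Types (g h : 'rV[int]_m) (s t : seq 'rV[int]_m).

Definition rat_row g : 'rV[rat]_m := map_mx intr g.

Lemma rat_rowB g h : rat_row (g - h) = rat_row g - rat_row h.
Proof. exact: map_mxB. Qed.

Lemma rat_row_inj : injective rat_row.
Proof.
move=> g h /matrixP e; apply/matrixP => i l; have := e i l; rewrite !mxE.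
exact: intr_inj.
Qed.

Lemma free_rat_row_int_indep t (c : 'I_(size t) -> int) :
  free (map rat_row t) -> \sum_(i < size t) t`_i *~ c i = 0 -> forall i, c i = 0.
Proof.
move=> ft e i.
have := elimT (@freeP _ _ _ (map_tuple rat_row (in_tuple t))) ft (fun i => (c i)%:~R) _ i.
move=> h; apply/eqP; rewrite -(intr_eq0 rat); apply/eqP/h.
transitivity (rat_row (\sum_(i < size t) t`_i *~ c i)); last by rewrite e /rat_row map_mx0.
rewrite /rat_row raddf_sum /=; apply: eq_bigr => l _.
by rewrite (nth_map 0) // raddfMz scaler_int.
Qed.

Lemma not_free_int_relation t : ~~ free (map rat_row t) ->
  exists c : 'I_(size t) -> int, (exists i, c i != 0) /\ \sum_(i < size t) t`_i *~ c i = 0.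
Proof.
move=> nf.
have [a ae [i0 ai0]] : exists2 a : 'I_(size t) -> rat,
    \sum_(i < size t) a i *: rat_row t`_i = 0 & exists i, a i != 0.
  apply: contrapT => h; case/negP: nf; apply/(@freeP _ _ _ (map_tuple rat_row (in_tuple t))).
  move=> a e i; apply: contrapT => /eqP ai; apply: h; exists a; last by exists i.
  rewrite -[RHS]e; apply: eq_bigr => l _; by rewrite /= (nth_map 0).
pose d := \prod_i denq (a i).
have d0 : d != 0 by apply/prodf_neq0 => i _; exact: denq_neq0.
pose c i := numq (a i) * \prod_(l | l != i) denq (a l).
have cE i : (c i)%:~R = d%:~R * a i :> rat.
  rewrite /c /d [X in _ = X%:~R * _](bigD1 i) //= !intrM mulrAC -[X in _ * X * _]divq_num_den.
  by rewrite mulrCA divff ?mulr1 // intr_eq0 denq_eq0.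
exists c; split.
  by exists i0; rewrite -(intr_eq0 rat) cE mulf_neq0 // intr_eq0.
apply: rat_row_inj; rewrite /rat_row map_mx0 raddf_sum /=.
transitivity (d%:~R *: \sum_(i < size t) a i *: rat_row t`_i); last by rewrite ae scaler0.
rewrite scaler_sumr; apply: eq_bigr => i _.
by rewrite scalerA -cE raddfMz scaler_int.
Qed.

Lemma size_free_rat_row t : free (map rat_row t) -> (size t <= m)%N.
Proof.
rewrite /free => /eqP; rewrite size_map => <-.
by rewrite (leq_trans (dimvS (subvf _))) // dimvf /dim /= mul1n.
Qed.

End IntegerRows.

Section EffectiveGrading.
Variables (k : fieldType) (B : idomainType) (iota : {rmorphism k -> B}).
Variables (m : nat) (D : grading iota 'rV[int]_m).

(** The lattice vectors in the rational span of fewer than [m] weights form a proper subgroup, which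
    by effectiveness misses some weight. *)
Lemma effective_independent_weights : effective D ->
  exists t : seq 'rV[int]_m, [/\ size t = m, {in t, forall g, weight D g}
    & free (map (@rat_row m) t)].
Proof.
move=> heff; suff : forall n, (n <= m)%N -> exists t : seq 'rV[int]_m,
    [/\ size t = n, {in t, forall g, weight D g} & free (map (@rat_row m) t)].
  by apply.
elim=> [_|n IH nm]; first by exists [::]; rewrite /= nil_free.
have [t [ts tw tf]] := IH (ltnW nm).
pose H g := rat_row g \in <<map (@rat_row m) t>>%VS.
have [[g [gw gH]]|nH] := EM (exists g, weight D g /\ ~~ H g).
  exists (g :: t); split; rewrite /= ?ts ?free_cons ?tf ?andbT //.
  by move=> h; rewrite inE => /orP[/eqP->|/tw].
have Hall g : H g.
  apply: (heff H); first by rewrite /H /rat_row map_mx0 mem0v.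
    by move=> x y Hx Hy; rewrite /H rat_rowB memvB.
  by move=> x xw; apply: contrapT => /negP xH; apply: nH; exists x.
have : (fullv <= <<map (@rat_row m) t>>)%VS.
  apply/subvP => x _; rewrite (row_sum_delta x); apply: memv_suml => i _.
  apply: memvZ; have := Hall (delta_mx 0 i).
  by rewrite /H /rat_row map_delta_mx.
move/dimvS; rewrite dimvf /dim /= mul1n => h.
have := leq_trans h (dim_span _); rewrite size_map ts => mn.
by have := leq_ltn_trans mn nm; rewrite ltnn.
Qed.

End EffectiveGrading.

(** * Algebraic dependence in degree zero *)

Section DegreeZeroAlgebraic.
Variables (k : closedFieldType) (B : idomainType) (iota : {rmorphism k -> B}).
Variables (m : nat) (D : grading iota 'rV[int]_m).
Variables (L : fieldType) (v : {rmorphism L -> {fraction B}}) (j : {rmorphism k -> L}).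
Hypothesis vj : forall c, v (j c) = tofrac (iota c).
Hypothesis v_deg0 : forall w, frac_comp D 0 (v w).

Lemma peval2_sum (u w : L) (I : Type) (s : seq I) (P : pred I) (a : I -> k) (e f : I -> nat) :
  (map_poly (peval j u) (\sum_(i <- s | P i) (a i *: 'X^(e i))%:P * 'X^(f i))).[w] =
  \sum_(i <- s | P i) j (a i) * u ^+ e i * w ^+ f i.
Proof.
rewrite rmorph_sum horner_sum; apply: eq_bigr => i _.
rewrite rmorphM /= map_polyC map_polyXn hornerM hornerC hornerXn; congr (_ * _).
by rewrite /= -mul_polyC rmorphM rmorphXn /= pevalC pevalX.
Qed.

(** Elements of [m] independent degrees together with [u] and [w] are [m + 2] elements in
    transcendence degree [m + 1]. In a relation among them, passing to one degree fixes all
    exponents of the first [m]; these factor out and leave a relation between [u] and [w]. *)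
Lemma deg0_algebraic : effective D -> domain_trdeg iota m.+1 ->
  forall u w : L, algebraic_over_gen j u w.
Proof.
move=> heff htr u w; apply: contrapT => nalg.
have [t [ts tw tf]] := effective_independent_weights heff.
have /choice[b bP] : forall i : nat, exists y, (i < m)%N -> D t`_i y /\ y != 0.
  move=> i; case: (ltnP i m) => im; last by exists 0.
  by have [|y Dy y0] := tw t`_i; [rewrite mem_nth // ts | exists y].
(* The last two positions lie beyond the end of [t], where the default entry [0] is the degree of
   [v u] and [v w]. *)
pose x (i : 'I_m.+2) := if (i < m)%N then tofrac (b i)
                        else if i == m :> nat then v u else v w.
have Dx (i : 'I_m.+2) : frac_comp D t`_i (x i).
  rewrite /x; case: ltnP => im; first exact/frac_comp_hom/(bP _ im).1.
  by rewrite nth_default ?ts //; case: eqP => _; exact: v_deg0.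
suff : algindep (fun c => tofrac (iota c)) x by move/htr.2; rewrite ltnn.
move=> p p0; apply/mpolyP => n0; rewrite mcoeff0; apply: contrapT => pn0.
have n0s : n0 \in msupp p by rewrite mcoeff_msupp; apply/eqP.
pose d (n : 'X_{1..m.+2}) := \sum_(i < m.+2) t`_i *+ n i.
have Dz n : frac_comp D (d n) (tofrac (iota p@_n) * mmap1 x n).
  rewrite -[d n]add0r; apply: frac_compM; first exact: frac_comp_base.
  by apply: frac_comp_prod => i; exact: frac_compX.
have S0 := frac_collect Dz p0 (d n0).
have d_eq n : d n = d n0 -> forall i : 'I_m.+2, (i < m)%N -> n i = n0 i.
  move=> e i im.
  have im' : (i < size t)%N by rewrite ts.
  pose c (l : 'I_(size t)) : int := (n (inord l))%:Z - (n0 (inord l))%:Z.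
  have := free_rat_row_int_indep (c := c) tf _ (Ordinal im').
  rewrite /c /= inord_val => h; apply/eqP; rewrite -eqz_nat -subr_eq0; apply/eqP/h.
  move/eqP: e; rewrite -subr_eq0 /d -sumrB => /eqP e; rewrite -[RHS]e.
  rewrite !big_ord_recr /= nth_default ?ts // nth_default ?ts // !mul0rn !subrr !addr0.
  apply: eq_bigr => l _; rewrite mulrzBr -!pmulrn.
  suff -> : inord l = widen_ord (leqnSn m.+1) (widen_ord (leqnSn m) l) by [].
  by apply: val_inj; rewrite /= inordK // (leq_trans (ltn_ord l)) // !leqW.
pose i1 : 'I_m.+2 := widen_ord (leqnSn _) ord_max; pose i2 : 'I_m.+2 := ord_max.
pose P : {poly {poly k}} := \sum_(n <- msupp p | d n == d n0) (p@_n *: 'X^(n i1))%:P * 'X^(n i2).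
pose Y := \prod_(i < m) tofrac (b i) ^+ n0 (widen_ord (leqnSn _) (widen_ord (leqnSn _) i)).
have Y0 : Y != 0.
  apply/prodf_neq0 => i _; rewrite expf_neq0 // tofrac_eq0.
  exact: (bP _ (ltn_ord i)).2.
have P0 : P = 0.
  apply: contrapT => /eqP Pn0; apply: nalg; exists P => //.
  apply: (fmorph_inj v); rewrite rmorph0; apply: (mulfI Y0); rewrite mulr0 -S0.
  rewrite peval2_sum rmorph_sum mulr_sumr; apply: eq_bigr => n /eqP dn.
  rewrite !rmorphM !rmorphXn /= vj /mmap1 !big_ord_recr /=.
  have -> : x (widen_ord (leqnSn _) ord_max) = v u by rewrite /x /= ltnn eqxx.
  have -> : x ord_max = v w by rewrite /x /= ltnNge leqnSn /= gtn_eqF.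
  have -> : \prod_(i < m) x (widen_ord (leqnSn m.+1) (widen_ord (leqnSn m) i)) ^+
      n (widen_ord (leqnSn m.+1) (widen_ord (leqnSn m) i)) = Y.
    by apply: eq_bigr => i _; rewrite (d_eq _ dn) /x /= ?ltn_ord.
  ring.
have := congr1 (fun Q : {poly {poly k}} => Q`_(n0 i2)`_(n0 i1)) P0.
rewrite /P coef_sum coef0 coef_sum coef0 (big_rem _ n0s) /= eqxx.
rewrite coefCM coefXn eqxx mulr1 coefZ coefXn eqxx mulr1.
rewrite big1_seq ?addr0 // => n /andP[/eqP dn]; rewrite mem_rem_uniq ?msupp_uniq //.
rewrite !inE => /andP[/eqP nn _].
rewrite coefCM coefXn; case: eqP => [e2|_]; last by rewrite mulr0 coef0.
rewrite mulr1 coefZ coefXn; case: eqP => [e1|_]; last by rewrite mulr0.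
case: nn; apply/mnmP => i; case: (ltnP i m) => im; first exact: d_eq.
have [->|->] : i = i1 \/ i = i2; [|exact: esym|exact: esym].
have := ltn_ord i; rewrite ltnS leq_eqVlt => /orP[/eqP e|]; [right|rewrite ltnS => h; left].
  exact: val_inj.
by apply: val_inj; apply/eqP; rewrite /= eqn_leq h im.
Qed.

End DegreeZeroAlgebraic.

(** More monomials than elements [beta t] would be linearly dependent after multiplication by [q],
    and a linear dependence of monomials is a polynomial relation. *)
Lemma algindep_count (k L : fieldType) (f : {rmorphism k -> L}) (n N : nat)
    (x : 'I_n -> L) (T : finType) (beta : T -> L) (q : L) :
  algindep f x -> q != 0 ->
  (forall e : {ffun 'I_n -> 'I_N}, exists c : T -> k,
     q * \prod_i x i ^+ e i = \sum_t f (c t) * beta t) ->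
  (N ^ n <= #|T|)%N.
Proof.
move=> xind q0 /choice[c cE]; rewrite leqNgt; apply/negP => ltN.
have cX : #|{ffun 'I_n -> 'I_N}| = (N ^ n)%N by rewrite card_ffun !card_ord.
rewrite -cX in ltN.
pose C : 'M[k]_(#|{ffun 'I_n -> 'I_N}|, #|T|) :=
  \matrix_(a, t) c (enum_val a) (enum_val t).
have K0 : kermx C != 0.
  rewrite -mxrank_eq0 mxrank_ker subn_eq0 -ltnNge.
  exact: leq_ltn_trans (rank_leq_col C) ltN.
pose l := nz_row (kermx C).
have l0 : l != 0 by rewrite nz_row_eq0.
have lC : l *m C = 0 by apply/sub_kermxP; exact: nz_row_sub.
pose mon (e : {ffun 'I_n -> 'I_N}) : 'X_{1..n} := [multinom (e i : nat) | i < n].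
have mon_inj : injective mon.
  move=> e e' /mnmP h; apply/ffunP => i; apply: val_inj.
  by have := h i; rewrite !mnmE.
pose p : {mpoly k[n]} := \sum_a l 0 a *: 'X_[mon (enum_val a)].
have p0 : p = 0.
  apply: xind; apply: (mulfI q0); rewrite mulr0 /p raddf_sum /= mulr_sumr.
  transitivity (\sum_a \sum_t f (l 0 a * c (enum_val a) t) * beta t).
    apply: eq_bigr => a _; rewrite mmapZ mmapX mulrCA.
    have -> : mmap1 x (mon (enum_val a)) = \prod_i x i ^+ (enum_val a) i.
      by apply: eq_bigr => i _; rewrite mnmE.
    rewrite cE mulr_sumr; apply: eq_bigr => t _; by rewrite rmorphM mulrA.
  rewrite exchange_big big1 //= => t _; rewrite -mulr_suml -rmorph_sum.
  have := congr1 (fun M : 'M_(_, _) => M 0 (enum_rank t)) lC; rewrite !mxE => e.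
  rewrite [X in f X](_ : _ = 0) ?rmorph0 ?mul0r // -[RHS]e.
  by apply: eq_bigr => a _; rewrite mxE enum_rankK.
case/eqP: l0; apply/rowP => a; rewrite mxE.
have := congr1 (mcoeff (mon (enum_val a))) p0; rewrite mcoeff0 raddf_sum /=.
rewrite (bigD1 a) //= mcoeffZ mcoeffX eqxx mulr1 big1 ?addr0 // => b ba.
by rewrite mcoeffZ mcoeffX (inj_eq mon_inj) (inj_eq enum_val_inj) (negPf ba) mulr0.
Qed.

(** * Counting lattice points *)

Section OneDimensionalPieces.
Variables (k : fieldType) (B : idomainType) (iota : {rmorphism k -> B}).
Variables (m : nat) (D : grading iota 'rV[int]_m).

Definition in_box (C : nat) (x : B) := exists s : seq ('rV[int]_m * B),
  {in s, forall a, D a.1 a.2 /\ forall i, `|a.1 0 i| <= C%:Z} /\ x = \sum_(a <- s) a.2.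

Lemma in_box1 : in_box 0 1.
Proof.
exists [:: (0, 1)]; split; last by rewrite big_seq1.
by move=> a; rewrite inE => /eqP ->; split=> [|i]; [exact: gcomp1 | rewrite mxE normr0].
Qed.

Lemma in_boxM C C' x y : in_box C x -> in_box C' y -> in_box (C + C') (x * y).
Proof.
move=> [s [sP ->]] [t [tP ->]].
exists [seq (a.1 + b.1, a.2 * b.2) | a <- s, b <- t]; split.
  move=> _ /allpairsP[[a b] /= [/sP[Da Ca] /tP[Db Cb] ->]] /=; split.
    exact: gcompM.
  by move=> i; rewrite mxE (le_trans (ler_normD _ _)) // PoszD lerD.
by rewrite big_allpairs_dep big_distrlr.
Qed.

Lemma in_boxX C x n : in_box C x -> in_box (n * C) (x ^+ n).
Proof.
move=> h; elim: n => [|n IH]; first by rewrite expr0; exact: in_box1.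
by rewrite exprS mulSn; exact: in_boxM.
Qed.

Lemma in_box_le C C' x : (C <= C')%N -> in_box C x -> in_box C' x.
Proof.
move=> CC [s [sP ->]]; exists s; split=> // a /sP[Da Ca]; split=> // i.
by rewrite (le_trans (Ca i)).
Qed.

Lemma in_box_ex x : exists C, in_box C x.
Proof.
have [s [f [_ Df _ ->]]] := gcomp_decomp D x.
exists (\max_(g <- s) \max_(i < m) `|g ord0 i|)%N, [seq (g, f g) | g <- s]; split; last first.
  by rewrite big_map.
move=> _ /mapP[g gs ->] /=; split=> // i.
rewrite -abszE lez_nat.
pose F (h : 'rV[int]_m) := (\max_(i < m) `|h ord0 i|)%N.
apply: (@leq_trans (F g)); first exact: (leq_bigmax (F := fun i => `|g ord0 i|%N)).
exact: leq_bigmax_seq.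
Qed.

Lemma in_box_prod (I : finType) (F : I -> B) (C : I -> nat) :
  (forall i, in_box (C i) (F i)) -> in_box (\sum_i C i)%N (\prod_i F i).
Proof.
move=> h; apply: (big_ind2 in_box) => //; first exact: in_box1.
by move=> *; exact: in_boxM.
Qed.

Definition box_point (C : nat) (e : {ffun 'I_m -> 'I_(2 * C).+1}) : 'rV[int]_m :=
  \row_i ((e i : nat)%:Z - C%:Z).

Lemma in_box_span (b : 'rV[int]_m -> B) C x :
  (forall g y, D g y -> exists c, y = iota c * b g) -> in_box C x ->
  exists c : {ffun 'I_m -> 'I_(2 * C).+1} -> k, x = \sum_e iota (c e) * b (box_point e).
Proof.
move=> bP [s [sP ->]]; elim: s sP => [|a s IH] sP.
  by exists (fun=> 0); rewrite big_nil big1 // => e _; rewrite rmorph0 mul0r.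
have [|c cE] := IH; first by move=> y ys; apply: sP; rewrite inE ys orbT.
have [Da Ca] := sP _ (mem_head _ _).
have [ca caE] := bP _ _ Da.
pose e : {ffun 'I_m -> 'I_(2 * C).+1} := [ffun i => inord (absz (a.1 ord0 i + C%:Z))].
have eE : box_point e = a.1.
  apply/rowP => i; rewrite mxE ffunE; have := Ca i; rewrite ler_norml.
  rewrite -[0]/ord0; move: (a.1 ord0 i) => z /andP[zl zr].
  by rewrite inordK; lia.
exists (fun e' => c e' + (e' == e)%:R * ca).
rewrite big_cons cE caE addrC.
under [in RHS]eq_bigr do rewrite rmorphD mulrDl.
rewrite big_split /=; congr (_ + _).
rewrite (bigD1 e) //= eqxx mul1r eE big1 ?addr0 // => e' /negPf ->.
by rewrite mul0r rmorph0 mul0r.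
Qed.

(* Otherwise every graded piece is at most one-dimensional, so the monomials of
   degree < N in n elements, N ^ n in number, lie (up to a common factor) in a
   space of dimension O(N ^ m). *)
Lemma deg0_frac_nonconst (n : nat) : (m < n)%N -> domain_trdeg iota n ->
  exists2 z, frac_comp D 0 z & forall c, z != tofrac (iota c).
Proof.
move=> mn [[x xind] _]; apply: contrapT => nex.
have cst z : frac_comp D 0 z -> exists c, z = tofrac (iota c).
  move=> Dz; apply: contrapT => nc; apply: nex; exists z => // c.
  by apply/eqP => e; apply: nc; exists c.
have /choice[b bP] : forall g, exists b, forall y, D g y -> exists c, y = iota c * b.
  move=> g; have [[b [Db b0]]|nb] := EM (exists b, D g b /\ b != 0); last first.
    exists 0 => y Dy; exists 0; rewrite mulr0; apply: contrapT => /eqP y0.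
    by apply: nb; exists y.
  exists b => y Dy; have [|c cE] := cst (tofrac y / tofrac b).
    by exists g, y, b; rewrite add0r.
  exists c; apply/eqP; rewrite -tofrac_eq tofracM -cE divfK // tofrac_eq0 //.
have /choice[a /choice[q aq]] : forall i, exists a q, q != 0 /\ x i = tofrac a / tofrac q.
  by move=> i; exact: fracP.
have /choice[Ca CaP] := fun i => in_box_ex (a i).
have /choice[Cq CqP] := fun i => in_box_ex (q i).
(* With this [N] one has [(2 * (N * S)).+1 ^ m <= ((2 * S).+1 * N) ^ m < N ^ m.+1 <= N ^ n], so the
   monomials outnumber the pieces. *)
pose S := (\sum_i (Ca i + Cq i))%N; pose N := ((2 * S).+1 ^ m).+1.
pose T := {ffun 'I_m -> 'I_(2 * (N * S)).+1}.
pose Q := \prod_i q i ^+ N.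
have Q0 : tofrac Q != 0.
  by rewrite tofrac_eq0; apply/prodf_neq0 => i _; rewrite expf_neq0 // (aq i).1.
have := @algindep_count k {fraction B} (GRing.RMorphism.clone _ _ (@tofrac B \o iota) _)
  n N x T (fun e => tofrac (b (box_point e))) (tofrac Q) xind Q0 _.
have H : forall e : {ffun 'I_n -> 'I_N}, exists c : T -> k,
    tofrac Q * \prod_i x i ^+ e i = \sum_t tofrac (iota (c t)) * tofrac (b (box_point t)).
  move=> e; pose y := \prod_i (a i ^+ e i * q i ^+ (N - e i)).
  have yE : tofrac Q * \prod_i x i ^+ e i = tofrac y.
    rewrite !rmorph_prod -big_split; apply: eq_bigr => i _ /=.
    have tq0 : tofrac (q i) != 0 by rewrite tofrac_eq0 (aq i).1.
    rewrite (aq i).2 tofracM !tofracXn -{1}(subnK (ltnW (ltn_ord (e i)))) exprD.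
    by rewrite expr_div_n mulrCA mulfK ?expf_neq0.
  have yB : in_box (N * S) y.
    apply: in_box_le (in_box_prod (fun i => in_boxM (in_boxX (e i) (CaP i)) (in_boxX (N - e i) (CqP i)))).
    rewrite /S big_distrr /= leq_sum // => i _; rewrite mulnDr leq_add // leq_mul2r.
      by rewrite ltnW ?orbT.
    by rewrite leq_subr orbT.
  have [c cE] := in_box_span bP yB; exists c; rewrite yE cE rmorph_sum.
  by apply: eq_bigr => t _; rewrite -tofracM.
move=> /(_ H); rewrite card_ffun !card_ord leqNgt => /negP; apply.
have N0 : (0 < N)%N by [].
apply: (@leq_trans (N ^ m.+1)); last by rewrite leq_pexp2l.
apply: (@leq_ltn_trans (((2 * S).+1 * N) ^ m)).
  have le_exp c d e : (c <= d)%N -> (c ^ e <= d ^ e)%N by case: e => // e; rewrite leq_exp2r.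
  have h c d : (0 < c)%N -> ((2 * (c * d)).+1 <= (2 * d).+1 * c)%N by nia.
  exact/le_exp/h.
rewrite expnMn expnS ltn_mul2r expn_gt0 N0; exact: leqnn.
Qed.

End OneDimensionalPieces.

(** * The pencil and its prime factors *)

Section Pencil.
Variables (k : closedFieldType) (B : idomainType) (iota : {rmorphism k -> B}).
Implicit Types (f g x y : B).

(* The members of the pencil spanned by [f] and [g] are indexed by the
   projective line, [None] being the point at infinity. *)
Definition pencil f g (a : option k) : B :=
  if a is Some c then f - iota c * g else g.

Lemma prod_pencil f g (r : seq k) n :
  \prod_(a <- map Some r ++ nseq n None) pencil f g a =
  (\prod_(c <- r) (f - iota c * g)) * g ^+ n.
Proof.
by rewrite big_cat big_map /= big_nseq; congr (_ * _); elim: n => //= n ->; rewrite exprS.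
Qed.

Variables (m : nat) (D : grading iota 'rV[int]_m).

Definition coprime_elts f g :=
  forall p, irreducible_elt p -> dvd p f -> dvd p g -> False.

Definition pencil_generates f g :=
  forall e x y, D e x -> D e y -> x != 0 -> y != 0 ->
    exists c (s t : seq (option k)), [/\ c != 0, size s = size t &
      x * \prod_(a <- t) pencil f g a = iota c * y * \prod_(a <- s) pencil f g a].

(** The linear factors [u - c] of numerator and denominator homogenize to the members [f - c g]. The
    powers of [g] introduced on the way are members at infinity, and they make the two products
    equally long. *)
Lemma rational_pencil_generates f g (L : fieldType) (v : {rmorphism L -> {fraction B}})
    (j : {rmorphism k -> L}) (u : L) :
  (forall c, v (j c) = tofrac (iota c)) -> 
  (forall z, frac_comp D 0 z -> exists w, v w = z) ->
  g != 0 -> v u = tofrac f / tofrac g -> (forall w, rational_in j u w) ->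
  pencil_generates f g.
Proof.
move=> vj vD g0 uE rat e x y Dx Dy x0 y0.
have tg0 : tofrac g != 0 by rewrite tofrac_eq0.
have [w wE] : exists w, v w = tofrac x / tofrac y.
  by apply: vD; exists e, x, y; rewrite add0r.
have [P [Q [Q0 wPQ]]] := rat w.
have [cP [sP [cP0 PE]]] := peval_split j u P.
have [cQ [sQ [cQ0 QE]]] := peval_split j u Q.
have {}cQ0 : cQ != 0.
  by apply: cQ0; apply: contraNneq Q0 => ->; rewrite rmorph0.
have {}cP0 : cP != 0.
  apply: cP0; apply: contraNneq x0 => P0; rewrite -tofrac_eq0.
  have : v w = 0 by rewrite wPQ P0 rmorph0 mul0r rmorph0.
  by rewrite wE => /eqP; rewrite mulf_eq0 invr_eq0 !tofrac_eq0 (negPf y0) orbF.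
have vprod (r : seq k) : v (\prod_(c <- r) (u - j c)) * tofrac g ^+ size r =
    tofrac (\prod_(c <- r) (f - iota c * g)).
  elim: r => [|c r IH]; first by rewrite !big_nil rmorph1 mul1r tofrac1.
  rewrite !big_cons rmorphM exprS mulrACA IH tofracM; congr (_ * _).
  by rewrite rmorphB vj uE mulrBl divfK // tofracB tofracM.
exists (cP / cQ), (map Some sP ++ nseq (size sQ) None), (map Some sQ ++ nseq (size sP) None).
split; first by rewrite mulf_neq0 ?invr_eq0.
  by rewrite !size_cat !size_map !size_nseq addnC.
rewrite !prod_pencil.
have ty0 : tofrac y != 0 by rewrite tofrac_eq0.
have vQ0 : v (\prod_(c <- sQ) (u - j c)) != 0.
  by rewrite fmorph_eq0; apply: contraNneq Q0; rewrite QE => ->; rewrite mulr0.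
have xE : tofrac x = tofrac y * (tofrac (iota (cP / cQ)) * v (\prod_(c <- sP) (u - j c)) /
     v (\prod_(c <- sQ) (u - j c))).
  have -> : tofrac x = v w * tofrac y by rewrite wE divfK.
  rewrite -vj !fmorph_div /= wPQ PE QE fmorph_div !rmorphM /= invfM.
  have aux (F : fieldType) (a b c d z : F) : a * b * (c^-1 * d^-1) * z = z * (a / c * b / d).
    by ring.
  exact: aux.
apply/eqP; rewrite -tofrac_eq !tofracM !tofracXn xE -!vprod; apply/eqP.
have aux (F : fieldType) (a b c z r s : F) : b != 0 ->
    z * (c * a / b) * (b * r * s) = c * z * (a * s * r) by move=> b0; field.
exact: aux.
Qed.

Theorem pencil_exists : is_UFD B -> unirational iota -> effective D ->
  domain_trdeg iota m.+1 ->
  exists d f g, [/\ D d f, D d g, g != 0, forall c, f != iota c * g &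
    coprime_elts f g /\ pencil_generates f g].
Proof.
move=> hU [s [F FE]] heff htr.
have [L [v [j [vj vD]]]] := deg0_field D.
have alg := deg0_algebraic vj (fun w => (vD _).2 (ex_intro _ w erefl)) heff htr.
have [z Dz zc] := deg0_frac_nonconst D (ltnSn m) htr.
have [u0 u0E] := (vD z).1 Dz.
have u0j c : u0 != j c by rewrite -(inj_eq (fmorph_inj v)) vj u0E zc.
pose psi : {rmorphism L -> {fraction {mpoly k[s]}}} :=
  GRing.RMorphism.clone _ _ (F \o v) _.
have psiC c : psi (j c) = tofrac (c%:MP : {mpoly k[s]}) by rewrite /= vj FE.
have [phi phiC] := frac_mpoly_reduce psiC u0j (alg u0).
have [u [uj rat]] := luroth phiC u0j.
have [h [f0 [g0 [Df0 Dg0 g00 vu]]]] := (vD (v u)).2 (ex_intro _ u erefl).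
rewrite add0r in Df0.
have f00 : f0 != 0.
  apply: contraNneq (uj 0) => f00; rewrite -(inj_eq (fmorph_inj v)) vu f00.
  by rewrite tofrac0 mul0r !rmorph0.
(* Cancelling the common factor keeps the fraction homogeneous, because divisors of homogeneous
   elements are homogeneous. *)
have [q [f [g [fE gE cop]]]] := coprime_cofactors hU g0 f00.
have q0 : q != 0 by apply: contraNneq f00 => q0; rewrite fE q0 mul0r.
have f_0 : f != 0 by apply: contraNneq f00 => h0; rewrite fE h0 mulr0.
have g_0 : g != 0 by apply: contraNneq g00 => h0; rewrite gE h0 mulr0.
have [e De] : exists e, D e f by apply: (gcomp_dvd Df0 f00); exists q.
have [e' De'] : exists e, D e g by apply: (gcomp_dvd Dg0 g00); exists q.
have [e1 De1] : exists e, D e q by apply: (gcomp_dvd Df0 f00); exists f; rewrite mulrC.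
have ee : e = e'.
  apply: (addrI e1); transitivity h.
    by apply: gcomp_uniq _ Df0 f00; rewrite fE; exact: gcompM.
  by apply: gcomp_uniq Dg0 _ g00; rewrite gE; exact: gcompM.
have uE : v u = tofrac f / tofrac g.
  rewrite vu; apply/eqP; rewrite eqr_div ?tofrac_eq0 // -!tofracM fE gE.
  by apply/eqP; congr (tofrac _); ring.
exists e, f, g; split=> //; first by rewrite ee.
  move=> c; apply: contraNneq (uj c) => fc; rewrite -(inj_eq (fmorph_inj v)).
  by rewrite uE vj fc tofracM mulfK // tofrac_eq0.
by split=> //; apply: rational_pencil_generates uE rat => // w /vD.
Qed.

End Pencil.

Lemma bounded_enum (T : eqType) (P : T -> Prop) N :
  (forall s : seq T, uniq s -> (forall x, x \in s -> P x) -> (size s <= N)%N) ->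
  exists2 s : seq T, uniq s & forall x, x \in s <-> P x.
Proof.
move=> bd; pose good n := `[< exists s : seq T, [/\ uniq s, forall x, x \in s -> P x & size s = n] >].
have ex : exists n, good n by exists 0%N; apply/asboolP; exists [::].
have ub n : good n -> (n <= N)%N by move=> /asboolP[s [us sP <-]]; exact: bd.
have [_ /asboolP[s [us sP <-]] smax] := ex_maxnP ex ub.
exists s => // x; split; first exact: sP.
move=> Px; apply: contraT => xs; have := smax (size s).+1; rewrite ltnn; apply.
apply/asboolP; exists (x :: s); rewrite /= xs; split=> //.
by move=> y; rewrite inE => /orP[/eqP->|/sP].
Qed.

Definition int_pos (z : int) : nat := if z is Posz n then n else 0%N.
Definition int_neg (z : int) : nat := if z is Negz n then n.+1 else 0%N.

Lemma int_pos_neg (z : int) : z = (int_pos z)%:Z - (int_neg z)%:Z.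
Proof. by case: z => n /=; rewrite ?subr0 // sub0r NegzE. Qed.

(** * Prime factors of the members *)

Section PencilPrimes.
Variables (k : closedFieldType) (B : idomainType) (iota : {rmorphism k -> B}).
Variables (m : nat) (D : grading iota 'rV[int]_m).
Hypotheses (hU : is_UFD B) (hunm : unmixed D) (hB0 : degree0_is_base D).
Variables (d : 'rV[int]_m) (f g : B).
Hypotheses (Df : D d f) (Dg : D d g) (g0 : g != 0).
Hypotheses (fg : forall c, f != iota c * g) (cop : coprime_elts f g).
Hypothesis gen : pencil_generates D f g.
Local Notation F := (pencil iota f g).

Lemma pencil_neq0 a : F a != 0.
Proof. by case: a => [c|] //=; rewrite subr_eq0. Qed.

Lemma pencil_hom a : D d (F a).
Proof. by case: a => [c|] //=; apply: gcompB => //; exact: gcompZ. Qed.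

Lemma pencil_deg_neq0 : d != 0.
Proof.
apply/eqP => d0; move: Df Dg; rewrite d0 => /hB0[c1 fE] /hB0[c2 gE].
have c20 : c2 != 0 by apply: contraNneq g0 => c0; rewrite gE c0 rmorph0.
have /eqP[] := fg (c1 / c2); by rewrite fE gE -rmorphM /= divfK.
Qed.

Lemma pencil_nonunit a : F a \isn't a GRing.unit.
Proof.
apply/negP => /(gcomp_unit hB0 hunm)[c c0 FE].
have Dc : D 0 (F a) by rewrite FE; exact: gcomp_base.
have /eqP := gcomp_uniq (pencil_hom a) Dc (pencil_neq0 a).
by rewrite (negPf pencil_deg_neq0).
Qed.

(** The difference of two distinct finite members is a unit times [g], so a common prime factor
    would divide both [f] and [g]. *)
Lemma pencil_disjoint p a b : irreducible_elt p -> dvd p (F a) -> dvd p (F b) -> a = b.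
Proof.
move=> pI.
have sub x y : dvd p x -> dvd p y -> dvd p (x - y).
  by move=> [z ->] [w ->]; exists (z - w); rewrite mulrBl.
have some_none c : dvd p (F (Some c)) -> dvd p g -> False.
  move=> /= h dg; apply: (cop pI _ dg); rewrite -[f](subrK (iota c * g)).
  rewrite -[X in dvd _ (_ + X)]opprK; apply: (sub) => //.
  by rewrite -mulrN; apply: dvd_mull; case: dg => z ->; exists (- z); rewrite mulNr.
case: a b => [c|] [c'|] //= h h'; [|by case: (some_none c)|by case: (some_none c')].
have [-> //|cc] := eqVneq c c'.
have : dvd p (iota (c' - c) * g).
  by have := sub _ _ h h'; rewrite rmorphB mulrBl opprB addrC addrA subrK.
case/(irreducible_prime hU pI) => [/(irreducible_ndvd_unit pI)[]|/(some_none c h) //].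
by apply: iota_unit; rewrite subr_eq0 eq_sym.
Qed.

(** Valuations are taken in [pencil_generates]. As [p] divides at most one member [F a], only the
    occurrences of [a] in [s] and [t] contribute. *)
Lemma pencil_relation e x y : D e x -> D e y -> x != 0 -> y != 0 ->
  exists s t : seq (option k), [/\ size s = size t,
    forall p a, irreducible_elt p -> dvd p (F a) ->
      (pval p x + count_mem a t * pval p (F a) =
       pval p y + count_mem a s * pval p (F a))%N
    & forall p, irreducible_elt p -> (forall a, ~ dvd p (F a)) -> pval p x = pval p y].
Proof.
move=> Dx Dy x0 y0; have [c [s [t [c0 st E]]]] := gen Dx Dy x0 y0.
have ic0 : iota c != 0 by rewrite fmorph_eq0.
have nz (r : seq (option k)) : \prod_(a <- r) F a != 0.
  by rewrite prodf_seq_neq0; apply/allP => a _; rewrite pencil_neq0.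
have vE p : irreducible_elt p -> (pval p x + \sum_(a <- t) pval p (F a) =
    pval p y + \sum_(a <- s) pval p (F a))%N.
  move=> pI; have := congr1 (pval p) E.
  rewrite !(pvalM hU pI) ?mulf_neq0 // (pval_unit pI (iota_unit iota c0)) add0n.
  by rewrite !(pval_prod hU _ pI) //; move=> a _; exact: pencil_neq0.
have vsum p a (r : seq (option k)) : irreducible_elt p -> dvd p (F a) ->
    (\sum_(b <- r) pval p (F b) = count_mem a r * pval p (F a))%N.
  move=> pI pa; elim: r => [|b r IH]; first by rewrite big_nil.
  rewrite big_cons IH /= mulnDl; congr (_ + _)%N.
  have [->|ba] := eqVneq b a; first by rewrite mul1n.
  rewrite mul0n; apply: pval_ndvd => // pb; case/eqP: ba.
  exact: pencil_disjoint pI pb pa.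
exists s, t; split=> // [p a pI pa|p pI np].
  by have := vE p pI; rewrite !(vsum p a).
have v0 (r : seq (option k)) : (\sum_(b <- r) pval p (F b) = 0)%N.
  by rewrite big1_seq // => b _; exact/pval_ndvd/np.
by have := vE p pI; rewrite !v0 !addn0.
Qed.

Definition hprime p := prime_rep p /\ hom D p.

Lemma hprime_irr p : hprime p -> irreducible_elt p. Proof. by case=> [[]]. Qed.

Lemma hprime_neq0 p : hprime p -> p != 0.
Proof. by move/hprime_irr/irreducible_neq0. Qed.

Lemma hprime_factor e x : D e x -> x != 0 ->
  exists (c : k) (s : seq B), [/\ c != 0, uniq s,
    {in s, forall p, hprime p /\ dvd p x} & x = iota c * \prod_(p <- s) p ^+ pval p x].
Proof.
move=> Dx x0; have [u [s [Uu us sP xE]]] := prime_rep_factor_pval hU x0.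
have [c c0 uE] := gcomp_unit hB0 hunm Uu.
exists c, s; rewrite -uE; split=> // p /sP[pR px]; split=> //; split=> //.
exact: gcomp_dvd Dx x0 px.
Qed.

Lemma pval_prod_hprime (s : seq B) (n : B -> nat) q : uniq s ->
  {in s, forall p, hprime p} -> hprime q ->
  pval q (\prod_(p <- s) p ^+ n p) = if q \in s then n q else 0%N.
Proof.
move=> us sP qP; have qI := hprime_irr qP.
rewrite (pval_prod hU _ qI); last by move=> p /sP /hprime_neq0 p0; rewrite expf_neq0.
rewrite (eq_big_seq (fun p => if q == p then n p else 0%N)); last first.
  move=> p ps; rewrite (pvalX hU _ qI); last exact/hprime_neq0/sP.
  by rewrite (pval_prime_rep qP.1 (sP _ ps).1); case: eqP; rewrite ?muln1 ?muln0.
case: ifP => qs; last first.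
  by rewrite big1_seq // => p /andP[_ ps]; case: eqP => // e; rewrite -e qs in ps.
rewrite (bigD1_seq q) //= eqxx big1 ?addn0 // => p; rewrite eq_sym.
by case: eqP.
Qed.

Lemma hom_prod_hprime (s : seq B) (n : B -> nat) :
  {in s, forall p, hprime p} ->
  D (\sum_(p <- s) deg D p *+ n p) (\prod_(p <- s) p ^+ n p).
Proof. by move=> sP; apply: gcomp_prod => p /sP[_ hp]; exact/gcompX/degP. Qed.

(** The degrees of the primes in [X] are independent. A relation gives [x] and [y] of equal degree
    with prime factors in [X]. A prime dividing no member has equal valuations in both. If [p]
    divides [F a], the partner [q] outside [X] divides neither [x] nor [y], so [a] occurs equally
    often on both sides and the valuations at [p] agree as well; the relation is trivial. *)
Lemma hprime_rank (X : seq B) : uniq X -> {in X, forall p, hprime p} ->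
  {in X, forall p, (forall a, ~ dvd p (F a)) \/
     exists a q, [/\ dvd p (F a), hprime q, dvd q (F a) & q \notin X]} ->
  (size X <= m)%N.
Proof.
move=> uX XP Xd; rewrite leqNgt; apply/negP => mX.
pose t := map (deg D) X.
have nf : ~~ free (map (@rat_row m) t).
  by apply/negP => /size_free_rat_row; rewrite size_map leqNgt mX.
have [c [[i0 ci0] cE]] := not_free_int_relation nf.
have iX (i : 'I_(size t)) : (i < size X)%N by rewrite -(size_map (deg D) X) ltn_ord.
pose cc p : int := if insub (index p X) is Some i then c i else 0.
have ccE (i : 'I_(size t)) : cc X`_i = c i.
  rewrite /cc index_uniq //; case: insubP => [j _ ji|]; last by rewrite ltn_ord.
  by congr c; apply: val_inj.
have sum0 : \sum_(p <- X) deg D p *~ cc p = 0.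
  rewrite -[RHS]cE (big_nth 0) -(size_map (deg D) X) big_mkord. apply: eq_bigr => i _.
  by rewrite ccE (nth_map 0).
(* Splitting the relation by sign gives two monomials of equal degree. *)
pose x := \prod_(p <- X) p ^+ int_pos (cc p); pose y := \prod_(p <- X) p ^+ int_neg (cc p).
have nz (n : B -> nat) : \prod_(p <- X) p ^+ n p != 0.
  rewrite prodf_seq_neq0; apply/allP => p /XP pP; rewrite expf_neq0 //.
  exact: hprime_neq0.
have Dx := hom_prod_hprime (fun p => int_pos (cc p)) XP.
have Dy := hom_prod_hprime (fun p => int_neg (cc p)) XP.
have ee : \sum_(p <- X) deg D p *+ int_pos (cc p) = \sum_(p <- X) deg D p *+ int_neg (cc p).
  apply/eqP; rewrite -subr_eq0 -sumrB; apply/eqP; rewrite -[RHS]sum0; apply: eq_bigr => p _.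
  by rewrite [cc p in RHS]int_pos_neg mulrzBr -!pmulrn.
rewrite -ee in Dy.
have [s [t' [_ rel rel0]]] := pencil_relation Dx Dy (nz _) (nz _).
have pX : X`_i0 \in X by rewrite mem_nth.
have pP := XP _ pX; have pI := hprime_irr pP.
have veq : pval X`_i0 x = pval X`_i0 y.
  case: (Xd _ pX) => [|[a [q [pa qP qa qX]]]]; first exact: rel0.
  have qI := hprime_irr qP.
  have := rel _ _ qI qa; rewrite !pval_prod_hprime // (negPf qX) !add0n.
  have vq : (0 < pval q (F a))%N by apply/(pval_gt0 hU qI (pencil_neq0 a)).
  move/eqP; rewrite eqn_pmul2r // => /eqP ec.
  by have := rel _ _ pI pa; rewrite ec !pval_prod_hprime // => /eqP; rewrite eqn_add2r => /eqP.
move: veq; rewrite !pval_prod_hprime // pX ccE => h.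
by move: ci0; rewrite [c i0]int_pos_neg h subrr eqxx.
Qed.

Definition special a := ~ irreducible_elt (F a).

Lemma pencil_factor a : exists (c : k) (s : seq B), [/\ c != 0, uniq s, s != [::],
    {in s, forall p, hprime p /\ dvd p (F a)}
    & F a = iota c * \prod_(p <- s) p ^+ pval p (F a)].
Proof.
have [c [s [c0 us sP FE]]] := hprime_factor (pencil_hom a) (pencil_neq0 a).
exists c, s; split=> //; apply/eqP => s0.
have := pencil_nonunit a; rewrite FE s0 big_nil mulr1.
by rewrite iota_unit.
Qed.

Lemma hprime_dvd_prod (s : seq B) (n : B -> nat) (c : k) q :
  c != 0 -> {in s, forall p, hprime p} -> hprime q ->
  dvd q (iota c * \prod_(p <- s) p ^+ n p) -> q \in s.
Proof.
move=> c0 sP qP; have qI := hprime_irr qP.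
case/(irreducible_prime hU qI) => [/(irreducible_ndvd_unit qI)[]|]; first exact: iota_unit.
elim: s sP => [_|p s IH sP].
  by rewrite big_nil => /(irreducible_ndvd_unit qI); rewrite unitr1 => /(_ isT).
rewrite big_cons inE => /(irreducible_prime hU qI)[|/IH h]; last first.
  by rewrite h ?orbT // => r rs; apply: sP; rewrite inE rs orbT.
have pP := sP _ (mem_head _ _); have pI := hprime_irr pP.
move/(pval_gt0 hU qI (expf_neq0 _ (hprime_neq0 pP))).
rewrite (pvalX hU _ qI (hprime_neq0 pP)) (pval_prime_rep qP.1 pP.1).
by case: eqP => [-> //|]; rewrite muln0.
Qed.

(** Up to constants [F a] and [F b] are [l]-th powers of some [x] and [y], whose degrees agree since
    the lattice is torsion-free. At a prime factor of [F a], [pencil_relation] then reads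
    [1 + u * l = w * l] after division by the valuation of [x]. *)
Lemma pencil_coprime a b l : a != b -> (1 < l)%N ->
  (forall p, hprime p -> dvd p (F a) -> (l %| pval p (F a))%N) ->
  (forall p, hprime p -> dvd p (F b) -> (l %| pval p (F b))%N) -> False.
Proof.
move=> ab l1 la lb.
have root a' : (forall p, hprime p -> dvd p (F a') -> (l %| pval p (F a'))%N) ->
    exists e x, [/\ D e x, x != 0, e *+ l = d & forall p, hprime p ->
      (pval p x * l)%N = pval p (F a')].
  move=> la'; have [c [s [c0 us sn sP FE]]] := pencil_factor a'.
  have hs : {in s, forall p, hprime p} by move=> p /sP[].
  pose n p := (pval p (F a') %/ l)%N.
  have Dx := hom_prod_hprime n hs.
  have x0 : \prod_(p <- s) p ^+ n p != 0.
    by rewrite prodf_seq_neq0; apply/allP => p /hs/hprime_neq0 p0; rewrite expf_neq0.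
  have FE' : F a' = iota c * (\prod_(p <- s) p ^+ n p) ^+ l.
    rewrite {1}FE -prodrXl; congr (_ * _); apply: eq_big_seq => p /sP[pP pa].
    by rewrite -exprM divnK // la'.
  exists (\sum_(p <- s) deg D p *+ n p), (\prod_(p <- s) p ^+ n p); split; [exact: Dx | exact: x0 | |].
    apply: gcomp_uniq (pencil_hom a') (pencil_neq0 a'); rewrite FE'.
    by apply: gcompZ; exact: gcompX.
  move=> p pP; have pI := hprime_irr pP.
  have := congr1 (pval p) FE'; rewrite (pvalM hU pI) ?expf_neq0 ?fmorph_eq0 //.
  by rewrite (pval_unit pI (iota_unit iota c0)) add0n (pvalX hU _ pI) // mulnC => ->.
have [e [x [Dx x0 ed xv]]] := root a la.
have [e' [y [Dy y0 ed' yv]]] := root b lb.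
have ee : e' = e.
  apply/rowP => i; have := congr1 (fun r : 'rV[int]_m => r 0 i) (etrans ed' (esym ed)).
  rewrite !mulmxnE => /eqP; rewrite -subr_eq0 -mulrnBl mulrn_eq0 subr_eq0.
  by case: (l) l1 => //= l' _ /eqP.
rewrite ee in Dy.
have [s [t [_ rel _]]] := pencil_relation Dx Dy x0 y0.
have [c [r [_ _ rn rP _]]] := pencil_factor a.
case: r rn rP => // p r _ /(_ p (mem_head _ _))[pP pa].
have pI := hprime_irr pP.
have vy : pval p y = 0%N.
  apply/eqP; rewrite -(eqn_pmul2r (ltnW l1)) mul0n yv // pval_ndvd // => pb.
  by case/eqP: ab; exact: pencil_disjoint pI pa pb.
have := rel _ _ pI pa; rewrite vy add0n -xv //.
have : (0 < pval p (F a))%N by apply/(pval_gt0 hU pI (pencil_neq0 a)).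
rewrite -xv //; move: (count_mem a t) (count_mem a s) (pval p x) => u w v v0 E.
have {}E : (1 + u * l = w * l)%N.
  by apply/eqP; rewrite -(eqn_pmul2l (m := v)) ?(leq_trans _ v0) //; [apply/eqP; nia|nia].
have : (l %| 1)%N by rewrite -(dvdn_addl 1 (dvdn_mull u (dvdnn l))) E dvdn_mull.
by rewrite dvdn1 => /eqP l_1; rewrite l_1 in l1.
Qed.

(* In the second case [F a] is a constant times a proper power of a prime. *)
Lemma special_cases a : special a ->
  (exists p q, [/\ hprime p, hprime q, dvd p (F a), dvd q (F a) & p != q]) \/
  (exists2 n, (1 < n)%N & (exists e, e *+ n = d) /\
     forall p, hprime p -> dvd p (F a) -> pval p (F a) = n).
Proof.
move=> sa; have [c [s [c0 us sn sP FE]]] := pencil_factor a.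
case: s us sn sP FE => // p [|q s] us _ sP FE; last first.
  left; exists p, q; have [pP pa] := sP p (mem_head _ _).
  have [|qP qa] := sP q; first by rewrite !inE eqxx orbT.
  by split=> //; move: us => /= /andP[]; rewrite inE negb_or => /andP[].
have [pP pa] := sP p (mem_head _ _); have pI := hprime_irr pP.
right; exists (pval p (F a)).
  have : (0 < pval p (F a))%N by apply/(pval_gt0 hU pI (pencil_neq0 a)).
  rewrite leq_eqVlt => /orP[/eqP v1|//]; case: sa.
  rewrite FE big_seq1 -v1 expr1; apply: irreducible_associates pI.
  by exists (iota c); rewrite // iota_unit.
split.
  exists (deg D p); apply: gcomp_uniq (pencil_hom a) (pencil_neq0 a).
  by rewrite {2}FE big_seq1; apply/gcompZ/gcompX/degP; case: pP.
move=> q qP; rewrite {1}FE => /(hprime_dvd_prod c0 _ qP) h.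
have : q \in [:: p] by apply: h => r /sP[].
by rewrite inE => /eqP ->.
Qed.

(** One prime from each member with two distinct prime factors gives a family as in [hprime_rank],
    so there are at most [m] such members. The other special members are proper prime powers up to
    constants; by [pencil_coprime] their exponents are distinct, and each divides the nonzero
    coordinate [d 0 i], which bounds their number by [M]. *)
Lemma finitely_many_special : exists2 S : seq (option k), uniq S & forall a, a \in S <-> special a.
Proof.
have [i di] : exists i, d 0 i != 0.
  apply: contrapT => h; case/eqP: pencil_deg_neq0; apply/rowP => i; rewrite mxE.
  by apply: contrapT => /eqP di; apply: h; exists i.
pose M := absz (d 0 i).
apply: (@bounded_enum _ _ (m + M)%N) => S uS SP.
pose two a := `[< exists p q, [/\ hprime p, hprime q, dvd p (F a), dvd q (F a) & p != q] >].
rewrite -(count_predC two) -!size_filter leq_add //.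
  have /choice[p /choice[q pq]] : forall a, exists p q, two a ->
      [/\ hprime p, hprime q, dvd p (F a), dvd q (F a) & p != q].
    move=> a; have [/asboolP[p [q h]]|] := boolP (two a); last by exists 0, 0.
    by exists p, q.
  have inj : {in [seq a <- S | two a] &, injective p}.
    move=> a b; rewrite !mem_filter => /andP[/pq[pP _ pa _ _] _] /andP[/pq[_ _ pb _ _] _] e.
    by apply: pencil_disjoint (hprime_irr pP) pa _; rewrite e.
  rewrite -(size_map p); apply: hprime_rank.
  - by rewrite map_inj_in_uniq // filter_uniq.
  - by move=> _ /mapP[a ha ->]; move: ha; rewrite mem_filter => /andP[/pq[pP _ _ _ _] _].
  move=> _ /mapP[a ha ->]; right; exists a, (q a).
  have := ha; rewrite mem_filter => /andP[/pq[pP qP pa qa pqa] _]; split=> //.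
  apply/mapP => -[b hb qb]; move: (hb); rewrite mem_filter => /andP[/pq[_ _ pb _ _] _].
  have ab : a = b by apply: pencil_disjoint (hprime_irr qP) qa _; rewrite qb.
  by move: pqa; rewrite qb ab eqxx.
have /choice[n nP] : forall a, exists n, a \in [seq a <- S | predC two a] ->
    (1 < n)%N /\ (exists e, e *+ n = d) /\ forall p, hprime p -> dvd p (F a) -> pval p (F a) = n.
  move=> a; have [|] := boolP (a \in _); last by exists 0%N.
  rewrite mem_filter => /andP[/asboolP ntwo /SP/special_cases[//|[n n1 h]]].
  by exists n.
have inj : {in [seq a <- S | predC two a] &, injective n}.
  move=> a b ha hb nab; apply: contrapT => /eqP ab.
  have [n1 [_ na]] := nP _ ha; have [_ [_ nb]] := nP _ hb.
  by apply: (pencil_coprime ab n1) => p pP pa; rewrite ?(na _ pP pa) ?(nb _ pP pa) ?nab.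
rewrite -(size_map n) -(size_iota 1 M); apply: uniq_leq_size.
  by rewrite map_inj_in_uniq // filter_uniq.
move=> _ /mapP[a /nP[n1 [[e ed] _]] ->]; rewrite mem_iota (ltnW n1) add1n ltnS.
apply: dvdn_leq; first by rewrite absz_gt0.
by rewrite /M -ed mulmxnE -mulr_natr abszM dvdn_mull // natz.
Qed.

Lemma finitely_many_base_free : exists2 Y : seq B, uniq Y &
  forall p, p \in Y <-> hprime p /\ forall a, ~ dvd p (F a).
Proof.
apply: (bounded_enum (N := m)) => Y uY YP; apply: hprime_rank => // p /YP[] //.
by left.
Qed.

End PencilPrimes.

(** * Trinomial presentations *)

Lemma rmorphism_inverse (R S : pzRingType) (f : {rmorphism R -> S}) : bijective f ->
  exists g : {rmorphism S -> R}, cancel f g /\ cancel g f.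
Proof.
case=> h fK hK.
have [||g gE] := @rmorphism_ex _ _ h.
- by move=> x y; apply: (can_inj fK); rewrite rmorphB !hK.
- by split=> [|x y]; apply: (can_inj fK); rewrite ?rmorph1 ?rmorphM !hK.
by exists g; split=> x; rewrite gE.
Qed.

Section QuotientLift.
Local Open Scope quotient_scope.

Lemma ideal_quot_lift (A : comNzRingType) (I : idealr A) (S : pzRingType)
    (h : {rmorphism A -> S}) :
  (forall p, p \in (I : pred A) -> h p = 0) ->
  exists e : {rmorphism {ideal_quot I} -> S}, forall p, e (\pi_({ideal_quot I}) p) = h p.
Proof.
move=> hI; pose e0 (x : {ideal_quot I}) : S := h (repr x).
have e0E p : e0 (\pi_({ideal_quot I}) p) = h p.
  apply/eqP; rewrite -subr_eq0 -rmorphB; apply/eqP/hI.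
  by rewrite Quotient.idealrBE reprK.
have [||e eE] := @rmorphism_ex _ _ e0.
- move=> x z; rewrite -[x]reprK -[z]reprK -rmorphB !e0E; exact: rmorphB.
- split=> [|x z]; first by rewrite -(rmorph1 (\pi_({ideal_quot I}))) e0E rmorph1.
  by rewrite -[x]reprK -[z]reprK -rmorphM !e0E; exact: rmorphM.
by exists e => p; rewrite eE e0E.
Qed.

End QuotientLift.

(** * Factoring the evaluation through the quotient *)

Section TrinomialIso.
Variables (k : fieldType) (Delta : trinomial_data k) (B : comNzRingType).
Variables (iota : {rmorphism k -> B}) (t : 'I_(td_N Delta) -> B) (n : nat) (y : 'I_n -> B).
Hypothesis t_ideal : forall p, p \in trinomial_ideal (Delta := Delta) -> mmap iota t p = 0.
Hypothesis ker : forall P : {mpoly {mpoly k[td_N Delta]}[n]},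
  mmap (mmap iota t) y P = 0 -> forall mu, P@_mu \in trinomial_ideal (Delta := Delta).
Hypothesis surj : forall x, exists P, mmap (mmap iota t) y P = x.

Local Open Scope quotient_scope.
Local Notation Q := (trinomial_ring Delta).
Local Notation piQ := (\pi_({ideal_quot (trinomial_ideal (Delta := Delta))})).

Lemma trinomial_ring_eval : exists e : {rmorphism Q -> B},
  forall p, e (piQ p) = mmap iota t p.
Proof. exact: (ideal_quot_lift t_ideal). Qed.

(** Evaluation factors through coefficientwise reduction [pr]; the hypothesis [ker] makes the
    induced map injective, and inverting it gives the isomorphism. *)
Lemma trinomial_iso : exists f : {rmorphism B -> {mpoly Q[n]}},
  bijective f /\ forall c, f (iota c) = (trinomial_const Delta c)%:MP.
Proof.
have [e eE] := trinomial_ring_eval.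
pose F : {rmorphism {mpoly Q[n]} -> B} := GRing.RMorphism.clone _ _ (mmap e y) _.
pose pr : {rmorphism {mpoly {mpoly k[td_N Delta]}[n]} -> {mpoly Q[n]}} :=
  GRing.RMorphism.clone _ _ (map_mpoly (GRing.RMorphism.clone _ Q piQ _)) _.
have FC x : F x%:MP = e x by rewrite /F /= mmapC.
have FE P : F (pr P) = mmap (mmap iota t) y P.
  rewrite [LHS](congr1 (fun P => F (pr P)) (mpolyE P)) (raddf_sum pr) (raddf_sum F).
  rewrite [RHS]/mmap; apply: eq_bigr => mu _ /=.
  by rewrite map_mpolyZ map_mpolyX mmapZ mmapX /= eE.
have pr_surj U : exists P, pr P = U.
  exists (\sum_(mu <- msupp U) repr (U@_mu : {ideal_quot (trinomial_ideal (Delta := Delta))}) *: 'X_[mu]).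
  rewrite raddf_sum [RHS]mpolyE. apply: eq_bigr => mu _ /=.
  by rewrite map_mpolyZ map_mpolyX /= reprK.
have F0 U : F U = 0 -> U = 0.
  have [P <-] := pr_surj U; rewrite FE => /ker PI.
  apply/mpolyP => mu; rewrite /= mcoeff_map_mpoly mcoeff0 /=.
  apply/eqP; rewrite -(rmorph0 piQ) -Quotient.idealrBE subr0; exact: PI.
have F_inj : injective F.
  move=> U V UV; apply/eqP; rewrite -subr_eq0; apply/eqP/F0.
  by rewrite rmorphB UV subrr.
have F_surj x : exists U, F U = x by have [P <-] := surj x; exists (pr P).
have /choice[G GK] := F_surj.
have [f [fK Kf]] : exists f : {rmorphism B -> {mpoly Q[n]}}, cancel F f /\ cancel f F.
  by apply: rmorphism_inverse; exists G => // U; apply: F_inj; rewrite GK.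
exists f; split; first by exists F.
move=> c; apply: F_inj; rewrite Kf FC /trinomial_const.
have -> : e (piQ c%:MP) = iota c by rewrite eE mmapC.
by [].
Qed.

End TrinomialIso.

(** Division by [y ^+ S] leaves a polynomial in [x / y]; if it were nonzero, one of its linear
    factors would vanish and [x / y] would be a constant. *)
Lemma binary_form_eq0 (k : closedFieldType) (B : idomainType) (iota : {rmorphism k -> B})
    (x y : B) (S : nat) (p : {poly k}) :
  y != 0 -> (forall c, x != iota c * y) ->
  \sum_(i < S.+1) iota p`_i * (x ^+ i * y ^+ (S - i)) = 0 ->
  forall i, (i <= S)%N -> p`_i = 0.
Proof.
move=> y0 xy e i iS.
pose j : {rmorphism k -> {fraction B}} := GRing.RMorphism.clone _ _ (@tofrac B \o iota) _.
pose q := \poly_(i < S.+1) p`_i.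
have ty0 : tofrac y != 0 by rewrite tofrac_eq0.
have qe : peval j (tofrac x / tofrac y) q = 0.
  apply: (mulIf (expf_neq0 S ty0)); rewrite mul0r -[RHS]tofrac0 -e.
  rewrite pevalE (horner_coef_wide (n := S.+1)); last first.
    by rewrite (leq_trans (size_poly _ _)) // size_poly.
  rewrite mulr_suml rmorph_sum; apply: eq_bigr => l _ /=.
  rewrite coef_map coef_poly ltn_ord /= !tofracM !tofracXn -mulrA; congr (_ * _).
  have lS : (l <= S)%N by rewrite -ltnS.
  have -> : tofrac y ^+ S = tofrac y ^+ l * tofrac y ^+ (S - l) by rewrite -exprD subnKC.
  by rewrite mulrA expr_div_n divfK ?expf_neq0.
have q0 : q = 0.
  apply: contrapT => /eqP q0; have [c [s [/(_ q0) c0 qE]]] := peval_split j (tofrac x / tofrac y) q.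
  move/eqP: qe; rewrite qE mulf_eq0 fmorph_eq0 (negPf c0) /=; apply/negP.
  rewrite prodf_seq_neq0; apply/allP => a _ /=; rewrite subr_eq0.
  apply: contra (xy a) => /eqP h; rewrite -tofrac_eq tofracM.
  by rewrite -[tofrac x](divfK ty0) h.
by have := congr1 (fun u : {poly k} => u`_i) q0; rewrite coef_poly ltnS iS coef0.
Qed.

(** * Normal forms modulo the trinomials *)

Section BlockRelations.
Variables (N r : nat) (blk : 'I_N -> 'I_r.+1) (b : 'I_N -> nat).
Hypothesis b_gt0 : forall l, (0 < b l)%N.
Hypothesis blk_surj : forall i, exists l, blk l = i.
Implicit Types (nu rho : 'X_{1..N}) (c e : 'I_r.+1 -> nat).

(** This is how equality of degrees appears on exponents: [e i] and [e' i] count the copies of the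
    [i]-th block monomial multiplied onto either side. *)
Definition block_related nu nu' := exists e e',
  (\sum_i e i = \sum_i e' i)%N /\
  forall l, (nu l + e (blk l) * b l = nu' l + e' (blk l) * b l)%N.

(** [c] extracts as many block monomials as possible, leaving a remainder [rho] divisible by
    none. *)
Definition block_reduced nu rho c :=
  (forall l, nu l = rho l + c (blk l) * b l)%N /\
  forall i, exists l, blk l = i /\ (rho l < b l)%N.

Lemma block_reduce nu : exists rho c, block_reduced nu rho c.
Proof.
have /choice[c cP] : forall i, exists c : nat, [forall l, (blk l == i) ==> (c * b l <= nu l)%N]
    /\ exists l, blk l = i /\ (nu l < c.+1 * b l)%N.
  move=> i; have [l0 l0i] := blk_surj i.
  pose P (c : nat) := [forall l, (blk l == i) ==> (c * b l <= nu l)%N].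
  have ex : exists c : nat, P c by exists 0%N; apply/forallP => l; rewrite mul0n implybT.
  have ub (c : nat) : P c -> (c <= nu l0)%N.
    move/forallP/(_ l0); rewrite l0i eqxx /=; apply: leq_trans.
    by rewrite leq_pmulr.
  have [c Pc cmax] := ex_maxnP ex ub; exists c; split=> //.
  have : ~~ P c.+1 by apply/negP => /cmax; rewrite ltnn.
  rewrite negb_forall => /existsP[l]; rewrite negb_imply -ltnNge => /andP[/eqP li h].
  by exists l.
have cle l : (c (blk l) * b l <= nu l)%N.
  by have [/forallP/(_ l) + _] := cP (blk l); rewrite eqxx.
exists [multinom (nu l - c (blk l) * b l)%N | l < N], c; split=> [l|i].
  by rewrite mnmE subnK.
have [_ [l [li h]]] := cP i; exists l; split=> //.
by rewrite mnmE ltn_subLR // li addnC -mulSn.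
Qed.

(** In each block an index with [rho l < b l] bounds how many block monomials the other side can
    contain. Used in both directions, this equates the numbers [c i + e i] and [c' i + e' i]. *)
Lemma block_related_reduced nu nu' rho rho' c c' : block_related nu nu' ->
  block_reduced nu rho c -> block_reduced nu' rho' c' ->
  rho = rho' /\ (\sum_i c i = \sum_i c' i)%N.
Proof.
move=> [e [e' [se E]]] [nuE rs] [nuE' rs'].
have ce i : (c i + e i = c' i + e' i)%N.
  have le l (c1 c2 e1 e2 : nat) (r1 r2 : 'X_{1..N}) : (r1 l + c1 * b l + e1 * b l = r2 l + c2 * b l + e2 * b l)%N ->
      (r1 l < b l)%N -> (c2 + e2 <= c1 + e1)%N.
    move=> h lt; rewrite -!addnA -!mulnDl in h.
    rewrite -ltnS -(ltn_pmul2r (b_gt0 l)) mulSn.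
    by rewrite (@leq_ltn_trans (r2 l + (c2 + e2) * b l)) ?leq_addl // -h ltn_add2r.
  apply/eqP; rewrite eqn_leq; apply/andP; split.
    have [l [<- lt]] := rs' i; apply: (le l _ _ _ _ rho' rho) => //.
    by rewrite -nuE -nuE' E.
  have [l [<- lt]] := rs i; apply: (le l _ _ _ _ rho rho') => //.
  by rewrite -nuE -nuE' E.
split.
  apply/mnmP => l; have := E l; rewrite nuE nuE' -!addnA -!mulnDl ce => /eqP.
  by rewrite eqn_add2r => /eqP.
apply/eqP; rewrite -(eqn_add2r (\sum_i e i)) {2}se -!big_split; apply/eqP.
by apply: eq_bigr.
Qed.

Variables (k : closedFieldType) (lambda : 'I_r.+1 -> k) (I : {mpoly k[N]} -> Prop).
Hypotheses (I0 : I 0) (ID : forall p q, I p -> I q -> I (p + q))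
  (IM : forall p q, I p -> I (q * p)).

Definition block_monom i : {mpoly k[N]} := \prod_(l | blk l == i) 'X_l ^+ b l.

Hypothesis I_trinomial : forall i : 'I_r.+1, (2 <= i)%N ->
  I (block_monom (inord 0) + lambda i *: block_monom (inord 1) + block_monom i).

Let T0 := block_monom (inord 0).
Let T1 := block_monom (inord 1).

Definition block_form (S : nat) (p : {poly k}) : {mpoly k[N]} :=
  \sum_(i < S.+1) p`_i *: (T0 ^+ i * T1 ^+ (S - i)).

(* Polynomials that are congruent to a binary form of degree [S] in the first
   two block monomials. *)
Definition near_form S (Q : {mpoly k[N]}) := exists p, I (Q - block_form S p).

Lemma IZ (c : k) p : I p -> I (c *: p).
Proof. by move=> h; rewrite -mul_mpolyC; exact: IM. Qed.

Lemma block_formD S p q : block_form S (p + q) = block_form S p + block_form S q.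
Proof. by rewrite -big_split; apply: eq_bigr => i _; rewrite coefD scalerDl. Qed.

Lemma block_formZ S (c : k) p : block_form S (c *: p) = c *: block_form S p.
Proof. by rewrite scaler_sumr; apply: eq_bigr => i _; rewrite coefZ scalerA. Qed.

Lemma near_formD S Q Q' : near_form S Q -> near_form S Q' -> near_form S (Q + Q').
Proof.
by move=> [p h] [q h']; exists (p + q); rewrite block_formD opprD addrACA; exact: ID.
Qed.

Lemma near_formZ S (c : k) Q : near_form S Q -> near_form S (c *: Q).
Proof. by move=> [p h]; exists (c *: p); rewrite block_formZ -scalerBr; exact: IZ. Qed.

Lemma near_form1 : near_form 0 1.
Proof. by exists 1; rewrite /block_form big_ord1 coefC scale1r !expr0 mulr1 subrr. Qed.

Lemma near_formT0 S Q : near_form S Q -> near_form S.+1 (T0 * Q).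
Proof.
move=> [p h]; exists (p * 'X); have := IM T0 h; rewrite mulrBr; congr (I (_ - _)).
rewrite /block_form [RHS]big_ord_recl coefMX scale0r add0r mulr_sumr.
by apply: eq_bigr => i _; rewrite coefMX /= -scalerAr mulrA -exprS subSS.
Qed.

Lemma near_formT1 S Q : near_form S Q -> near_form S.+1 (T1 * Q).
Proof.
(* The coefficient of [p] at index [S.+1] is ignored in degree [S] but would count in degree [S.+1],
   so it is cut off. *)
move=> [p h]; exists (take_poly S.+1 p); have := IM T1 h; rewrite mulrBr.
congr (I (_ - _)); rewrite /block_form [RHS]big_ord_recr /= coef_take_poly ltnn scale0r addr0.
rewrite mulr_sumr; apply: eq_bigr => i _; rewrite coef_take_poly ltn_ord /=.
by rewrite -scalerAr mulrCA -exprS subSn // -ltnS.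
Qed.

Lemma near_form_block i S Q : near_form S Q -> near_form S.+1 (block_monom i * Q).
Proof.
move=> h; case: (ltngtP i 1%N) => [i0|i2|i1].
- have -> : i = inord 0 by apply: val_inj; rewrite /= inordK //; apply/eqP; rewrite -leqn0 -ltnS.
  exact: near_formT0.
(* Modulo the trinomial the block monomial is [- T0 - lambda i *: T1]. *)
- have [p hp] : near_form S.+1 (-1 *: (T0 * Q) + (- lambda i) *: (T1 * Q)).
    apply: near_formD; apply: near_formZ; [exact: near_formT0 | exact: near_formT1].
  exists p; have := ID (IM Q (I_trinomial i2)) hp; congr I.
  rewrite -/T0 -/T1 scaleN1r scaleNr -!mul_mpolyC; ring.
- have -> : i = inord 1.
    by apply: val_inj; rewrite /= i1 inordK // -i1 ltn_ord.
  exact: near_formT1.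
Qed.

Lemma near_form_prod c (s : seq 'I_r.+1) :
  near_form (\sum_(i <- s) c i)%N (\prod_(i <- s) block_monom i ^+ c i).
Proof.
elim: s => [|i s IH]; first by rewrite !big_nil; exact: near_form1.
rewrite !big_cons; elim: (c i) => [|n IHn]; first by rewrite expr0 mul1r.
by rewrite exprS -mulrA addSn; exact: near_form_block.
Qed.

Lemma block_reduced_monom nu rho c : block_reduced nu rho c ->
  'X_[nu] = 'X_[rho] * \prod_i block_monom i ^+ c i :> {mpoly k[N]}.
Proof.
case=> nuE _; rewrite mpolyXE_id [X in _ = X * _]mpolyXE_id.
have -> : \prod_i block_monom i ^+ c i = \prod_l ('X_l ^+ b l) ^+ c (blk l) :> {mpoly k[N]}.
  rewrite [RHS](partition_big blk xpredT) //=; apply: eq_bigr => i _.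
  by rewrite /block_monom -prodrXl; apply: eq_bigr => l /eqP ->.
rewrite -big_split; apply: eq_bigr => l _.
by rewrite nuE exprD /= -exprM [(b l * _)%N]mulnC.
Qed.

Variables (B : idomainType) (iota : {rmorphism k -> B}) (t : 'I_N -> B).
Hypothesis t0 : forall l, t l != 0.
Hypothesis I_eval : forall p, I p -> mmap iota t p = 0.
Hypothesis T1_indep : forall c : k, mmap iota t T0 != iota c * mmap iota t T1.

Lemma block_monom_eval i : mmap iota t (block_monom i) = \prod_(l | blk l == i) t l ^+ b l.
Proof.
rewrite rmorph_prod; apply: eq_bigr => l _; rewrite rmorphXn /= mmapX mmap1U //.
Qed.

Lemma mmap1_neq0 nu : mmap1 t nu != 0.
Proof. by apply/prodf_neq0 => l _; rewrite expf_neq0. Qed.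

(** All monomials of [Q] share the remainder [rho] and the number [S] of extracted blocks. After
    ['X_[rho]] is factored out, [Q] is congruent to one binary form of degree [S], which evaluates
    to zero and hence is zero. *)
Lemma related_kernel (Q : {mpoly k[N]}) :
  {in msupp Q &, forall nu nu', block_related nu nu'} ->
  mmap iota t Q = 0 -> I Q.
Proof.
move=> rel Q0; have [-> //|] := eqVneq Q 0.
rewrite -msupp_eq0 -size_eq0 -lt0n => sz; pose nu0 := nth 0%MM (msupp Q) 0.
have nu0Q : nu0 \in msupp Q by exact: mem_nth.
have [rho [c0 red0]] := block_reduce nu0; pose S := (\sum_i c0 i)%N.
have /choice[M MP] : forall nu, exists M : {mpoly k[N]}, nu \in msupp Q ->
    'X_[nu] = 'X_[rho] * M /\ near_form S M.
  move=> nu; have [nuQ|] := boolP (nu \in msupp Q); last by exists 0.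
  have [rho' [c red]] := block_reduce nu.
  have [er ec] := block_related_reduced (rel _ _ nuQ nu0Q) red red0.
  rewrite /S -er -ec.
  exists (\prod_i block_monom i ^+ c i) => _; split; last exact: near_form_prod.
  exact: block_reduced_monom.
pose Q1 := \sum_(nu <- msupp Q) Q@_nu *: M nu.
have QE : Q = 'X_[rho] * Q1.
  rewrite [LHS]mpolyE mulr_sumr; apply: eq_big_seq => nu /MP[-> _].
  by rewrite scalerAr.
have [p Ip] : near_form S Q1.
  rewrite /Q1 big_seq; apply: (big_ind (near_form S)).
  - by exists 0; rewrite /block_form big1 ?subr0 // => i _; rewrite coef0 scale0r.
  - exact: near_formD.
  - by move=> nu /MP[_ h]; exact: near_formZ.
have Q10 : mmap iota t Q1 = 0.
  have nz := mmap1_neq0 rho; apply: (mulfI nz).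
  by rewrite mulr0 -Q0 [in RHS]QE rmorphM /= mmapX.
have T10 : mmap iota t T1 != 0.
  by rewrite block_monom_eval; apply/prodf_neq0 => l _; rewrite expf_neq0.
have form0 : block_form S p = 0.
  have := I_eval Ip; rewrite rmorphB /= Q10 sub0r => /eqP; rewrite oppr_eq0 => /eqP e.
  rewrite /block_form big1 // => i _; rewrite (binary_form_eq0 T10 T1_indep _ (S := S)) ?scale0r //.
    rewrite -[RHS]e rmorph_sum; apply: eq_bigr => l _ /=.
    by rewrite mmapZ rmorphM !rmorphXn.
  by rewrite -ltnS.
by rewrite QE; apply: IM; move: Ip; rewrite form0 subr0.
Qed.

End BlockRelations.

(** * Linear relations between members *)

Section PencilMembers.
Variables (k : closedFieldType) (B : idomainType) (iota : {rmorphism k -> B}).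
Variables (m : nat) (D : grading iota 'rV[int]_m).
Hypotheses (hU : is_UFD B) (hunm : unmixed D) (hB0 : degree0_is_base D).
Variables (d : 'rV[int]_m) (f g : B).
Hypotheses (Df : D d f) (Dg : D d g) (g0 : g != 0).
Hypotheses (fg : forall c, f != iota c * g) (cop : coprime_elts f g).
Local Notation F := (pencil iota f g).

Lemma pencil_span (a b c : option k) : a != b ->
  exists u v, F c = iota u * F a + iota v * F b.
Proof.
have two (x y : option k) (u v u' v' : k) : F x = iota u * f + iota v * g ->
    F y = iota u' * f + iota v' * g -> u * v' - v * u' != 0 ->
    exists w w', F c = iota w * F x + iota w' * F y.
  move=> -> ->; set e := _ - _ => e0.
  have [s [t ->]] : exists s t, F c = iota s * f + iota t * g.
    case: c => [c|] /=; first by exists 1, (- c); rewrite rmorph1 rmorphN mul1r mulNr.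
    by exists 0, 1; rewrite rmorph0 rmorph1 mul0r mul1r add0r.
  (* Cramer's rule, with determinant [e]. *)
  exists ((s * v' - t * u') / e), ((t * u - s * v) / e).
  rewrite !mulrDr !mulrA -!rmorphM addrACA -!mulrDl -!rmorphD /=.
  by congr (iota _ * _ + iota _ * _); rewrite /e; field.
have fS x : F (Some x) = iota 1 * f + iota (- x) * g.
  by rewrite rmorph1 rmorphN mul1r mulNr.
have gS : F None = iota 0 * f + iota 1 * g.
  by rewrite rmorph0 rmorph1 mul0r mul1r add0r.
case: a b => [x|] [y|] // ne.
- apply: two (fS x) (fS y) _; rewrite mul1r mulr1 opprK addrC subr_eq0.
  by apply: contraNneq ne => ->.
- by apply: two (fS x) gS _; rewrite mul1r mulr0 subr0 oner_neq0.
- by apply: two gS (fS y) _; rewrite mul0r mulr1 sub0r oppr_eq0 oner_neq0.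
Qed.

Lemma pencil_prime a : exists2 p, hprime D p & dvd p (F a).
Proof.
have [c [s [_ _ sn sP _]]] := pencil_factor hU hunm hB0 Df Dg g0 fg a.
case: s sn sP => // p s _ sP.
by have [pP pa] := sP p (mem_head _ _); exists p.
Qed.

Lemma pencil_proportional a b u : F a = iota u * F b -> a = b.
Proof.
have [p pP pa] := pencil_prime a; have pI := hprime_irr pP.
move=> E; apply: (pencil_disjoint hU cop pI pa).
have u0 : u != 0.
  by apply: contraNneq (pencil_neq0 g0 fg a) => u0; rewrite E u0 rmorph0 mul0r.
move: pa; rewrite E => /(irreducible_prime hU pI)[/(irreducible_ndvd_unit pI)[]|//].
exact: iota_unit.
Qed.

Lemma pencil_span_neq0 a b c : a != b -> c != a -> c != b ->
  exists u v, [/\ u != 0, v != 0 & F c = iota u * F a + iota v * F b].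
Proof.
move=> ab ca cb; have [u [v E]] := pencil_span c ab; exists u, v; split=> //.
  by apply: contraNneq cb => u0; apply/eqP/(@pencil_proportional _ _ v); rewrite E u0 rmorph0 mul0r add0r.
by apply: contraNneq ca => v0; apply/eqP/(@pencil_proportional _ _ u); rewrite E v0 rmorph0 mul0r addr0.
Qed.

Lemma closed_field_root_ex (x : k) n : (0 < n)%N -> exists z, z ^+ n = x.
Proof.
move=> n0; have [|z] := closed_rootP ('X^n - x%:P) _.
  by rewrite size_XnsubC // eqSS -lt0n.
by rewrite rootE !hornerE subr_eq0 => /eqP; exists z.
Qed.

(** The constants are absorbed by rescaling the first prime by a root of [w * c], of order its
    multiplicity. The trinomials can thus hold with coefficient one at the last monomial. *)
Lemma scaled_factor a w : w != 0 -> exists ps ts : seq B,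
  [/\ uniq ps, (0 < size ps)%N, {in ps, forall p, hprime D p /\ dvd p (F a)},
      forall q, hprime D q -> dvd q (F a) -> q \in ps &
      (forall j, (j < size ps)%N -> exists2 z, z != 0 & ts`_j = iota z * ps`_j) /\
      \prod_(j < size ps) ts`_j ^+ pval ps`_j (F a) = iota w * F a].
Proof.
move=> w0; have [c [s [c0 us sn sP FE]]] := pencil_factor hU hunm hB0 Df Dg g0 fg a.
have all_s q : hprime D q -> dvd q (F a) -> q \in s.
  by move=> qP; rewrite {1}FE; apply: (hprime_dvd_prod hU c0 _ qP) => p /sP[].
case: s us sn sP FE all_s => // p s us _ sP FE all_s.
have [pP pa] := sP p (mem_head _ _); have pI := hprime_irr pP.
have e0 : (0 < pval p (F a))%N by apply/(pval_gt0 hU pI (pencil_neq0 g0 fg a)).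
have [z zE] := closed_field_root_ex (w * c) e0.
have z0 : z != 0.
  apply: contraTneq (mulf_neq0 w0 c0) => z0.
  by rewrite -zE z0 expr0n gtn_eqF // eqxx.
exists (p :: s), (iota z * p :: s); split=> //; split.
  move=> [|j] _ /=; first by exists z.
  by exists 1; rewrite ?oner_neq0 // rmorph1 mul1r.
rewrite [in RHS]FE big_cons big_ord_recl /= exprMn -rmorphXn zE rmorphM -!mulrA.
by rewrite (big_nth 0) big_mkord.
Qed.

End PencilMembers.

(** * Generators and relations, with variables in one list *)

Section FlatAssembly.
Variables (k : closedFieldType) (B : idomainType) (iota : {rmorphism k -> B}).
Variables (m : nat) (D : grading iota 'rV[int]_m).
Hypotheses (hU : is_UFD B) (hunm : unmixed D) (hB0 : degree0_is_base D).
Variables (d : 'rV[int]_m) (f g : B).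
Hypotheses (Df : D d f) (Dg : D d g) (g0 : g != 0).
Hypotheses (fg : forall c, f != iota c * g) (cop : coprime_elts f g).
Hypothesis gen : pencil_generates D f g.
Local Notation F := (pencil iota f g).

Variables (N r n : nat) (blk : 'I_N -> 'I_r.+1) (pp tt : 'I_N -> B) (yy : 'I_n -> B).
Variable a : 'I_r.+1 -> option k.
Hypothesis a_inj : injective a.
Hypothesis pp_hprime : forall l, hprime D (pp l).
Hypothesis pp_dvd : forall l, dvd (pp l) (F (a (blk l))).
Hypothesis pp_inj : injective pp.
Hypothesis pp_all : forall i q, hprime D q -> dvd q (F (a i)) -> exists l, pp l = q.
Hypothesis tt_unit : forall l, exists2 z, z != 0 & tt l = iota z * pp l.
Hypothesis yy_hprime : forall l, hprime D (yy l).
Hypothesis yy_base : forall l c, ~ dvd (yy l) (F c).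
Hypothesis yy_inj : injective yy.
Hypothesis yy_all : forall q, hprime D q -> (forall c, ~ dvd q (F c)) -> exists l, yy l = q.

Let b l := pval (pp l) (F (a (blk l))).

Lemma block_exponent_gt0 l : (0 < b l)%N.
Proof. exact/(pval_gt0 hU (hprime_irr (pp_hprime l)) (pencil_neq0 g0 fg _))/pp_dvd. Qed.

Definition mono_deg (nu : 'X_{1..N}) (mu : 'X_{1..n}) : 'rV[int]_m :=
  \sum_l deg D (pp l) *+ nu l + \sum_l deg D (yy l) *+ mu l.

Lemma mono_hom nu mu : D (mono_deg nu mu) (mmap1 tt nu * mmap1 yy mu).
Proof.
apply: gcompM; apply: gcomp_prod => l _; apply: gcompX.
  have [z _ ->] := tt_unit l; apply/gcompZ/degP; exact: (pp_hprime l).2.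
apply: degP; exact: (yy_hprime l).2.
Qed.

Lemma tt_neq0 l : tt l != 0.
Proof.
have [z z0 ->] := tt_unit l.
by rewrite mulf_neq0 ?fmorph_eq0 // (hprime_neq0 (pp_hprime l)).
Qed.

Lemma mono_neq0 nu mu : mmap1 tt nu * mmap1 yy mu != 0.
Proof.
apply: mulf_neq0; apply/prodf_neq0 => l _; rewrite expf_neq0 ?tt_neq0 //.
exact: hprime_neq0 (yy_hprime l).
Qed.

Lemma mono_val q nu mu : hprime D q -> pval q (mmap1 tt nu * mmap1 yy mu) =
  (\sum_l nu l * (q == pp l) + \sum_l mu l * (q == yy l))%N.
Proof.
move=> qP; have qI := hprime_irr qP.
have := mono_neq0 nu mu; rewrite mulf_eq0 negb_or => /andP[h1 h2].
rewrite (pvalM hU qI) // !(pval_prod hU _ qI); last 2 first.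
- by move=> l _; rewrite expf_neq0 // (hprime_neq0 (yy_hprime l)).
- by move=> l _; rewrite expf_neq0 // tt_neq0.
congr (_ + _)%N; apply: eq_bigr => l _.
  have [z z0 tE] := tt_unit l; rewrite (pvalX hU _ qI (tt_neq0 l)) tE.
  rewrite (pvalM hU qI) ?fmorph_eq0 ?(hprime_neq0 (pp_hprime l)) //.
  by rewrite (pval_unit qI (iota_unit iota z0)) add0n (pval_prime_rep qP.1 (pp_hprime l).1).
by rewrite (pvalX hU _ qI (hprime_neq0 (yy_hprime l))) (pval_prime_rep qP.1 (yy_hprime l).1).
Qed.

Lemma pp_neq_yy l l' : pp l != yy l'.
Proof. by apply/eqP => e; apply: (@yy_base l' (a (blk l))); rewrite -e. Qed.

Lemma mono_val_pp l nu mu : pval (pp l) (mmap1 tt nu * mmap1 yy mu) = nu l.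
Proof.
rewrite mono_val // [X in (_ + X)%N]big1 ?addn0; last first.
  by move=> l' _; rewrite (negPf (pp_neq_yy _ _)) muln0.
rewrite (bigD1 l) //= eqxx muln1 big1 ?addn0 // => l' ll.
by rewrite (inj_eq pp_inj) eq_sym (negPf ll) muln0.
Qed.

Lemma mono_val_yy l nu mu : pval (yy l) (mmap1 tt nu * mmap1 yy mu) = mu l.
Proof.
rewrite mono_val // big1 ?add0n; last first.
  by move=> l' _; rewrite eq_sym (negPf (pp_neq_yy _ _)) muln0.
rewrite (bigD1 l) //= eqxx muln1 big1 ?addn0 // => l' ll.
by rewrite (inj_eq yy_inj) eq_sym (negPf ll) muln0.
Qed.

(** Valuations at the [yy l] give [mu = mu'], those at the [pp l] give the block equations. For the
    totals, [s] and [t] have equal size, and a member outside the range of [a] occurs equally often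
    in both, because its prime factors divide neither monomial. *)
Lemma mono_deg_related nu mu nu' mu' : mono_deg nu mu = mono_deg nu' mu' ->
  mu = mu' /\ block_related blk b nu nu'.
Proof.
move=> e; have Dn := mono_hom nu mu; rewrite e in Dn.
have [s [t [st rel rel0]]] := pencil_relation hU g0 fg cop gen Dn (mono_hom nu' mu')
  (mono_neq0 nu mu) (mono_neq0 nu' mu').
split.
  apply/mnmP => l; have := rel0 _ (hprime_irr (yy_hprime l)) (@yy_base l).
  by rewrite !mono_val_yy.
exists (fun i => count_mem (a i) t), (fun i => count_mem (a i) s); split; last first.
  by move=> l; have := rel _ _ (hprime_irr (pp_hprime l)) (pp_dvd l); rewrite !mono_val_pp.
pose R : pred (option k) := fun c => c \in codom a.
have sum_count (u : seq (option k)) : (\sum_i count_mem (a i) u = count R u)%N.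
  elim: u => [|c u IH]; first by rewrite big1.
  rewrite /= big_split /= IH; congr (_ + _)%N; rewrite /R.
  case: (boolP (c \in codom a)) => [/codomP[i ->]|nc].
    rewrite (bigD1 i) //= eqxx big1 ?addn0 // => l li.
    by rewrite (inj_eq a_inj) eq_sym (negPf li).
  rewrite big1 // => i _; case: eqP => // ci; by rewrite ci codom_f in nc.
rewrite !sum_count.
have off c : c \notin codom a -> count_mem c s = count_mem c t.
  move=> nc; have [q qP qc] := pencil_prime hU hunm hB0 Df Dg g0 fg c.
  have qI := hprime_irr qP.
  have v0 (nu1 : 'X_{1..N}) (mu1 : 'X_{1..n}) : pval q (mmap1 tt nu1 * mmap1 yy mu1) = 0%N.
    rewrite mono_val // !big1 // => l _; case: eqP => [ql|_]; rewrite ?muln0 //.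
      by case: (@yy_base l c); rewrite -ql.
    case/negP: nc; apply/codomP; exists (blk l).
    by apply: (pencil_disjoint hU cop qI qc); rewrite ql.
  have := rel _ _ qI qc; rewrite !v0 !add0n => /eqP; rewrite eqn_pmul2r => [/eqP //|].
  exact/(pval_gt0 hU qI (pencil_neq0 g0 fg c)).
apply/eqP; rewrite -(eqn_add2r (count (predC R) s)) [X in _ == X]count_predC.
have -> : count (predC R) s = count (predC R) t.
  rewrite -!size_filter; apply/perm_size/allP => c _; rewrite /= !count_filter.
  apply/eqP; case: (boolP (c \in codom a)) => nc.
    rewrite !(eq_count (a2 := pred0)) ?count_pred0 // => c' /=; rewrite /R;
    by case: eqP => //= ->; rewrite nc.
  rewrite !(eq_count (a2 := pred1 c)) ?off // => c' /=; rewrite /R;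
  by case: eqP => //= ->; rewrite nc.
by rewrite count_predC st.
Qed.

Section Kernel.
Variables (lambda : 'I_r.+1 -> k) (I : {mpoly k[N]} -> Prop).
Hypotheses (I0 : I 0) (ID : forall p q, I p -> I q -> I (p + q))
  (IM : forall p q : {mpoly k[N]}, I p -> I (q * p)).
Hypothesis blk_surj : forall i, exists l, blk l = i.
Hypothesis I_trinomial : forall i : 'I_r.+1, (2 <= i)%N ->
  I (block_monom blk b k (inord 0) + lambda i *: block_monom blk b k (inord 1) +
     block_monom blk b k i).
Hypothesis I_eval : forall p, I p -> mmap iota tt p = 0.
Hypothesis T1_indep : forall c,
  mmap iota tt (block_monom blk b k (inord 0)) !=
  iota c * mmap iota tt (block_monom blk b k (inord 1)).

(** Monomials of equal degree have equal [mu], so each homogeneous component of the relation that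
    meets [P@_mu] involves this coefficient only. Its pieces by degree have pairwise related
    exponents and fall under [related_kernel]. *)
Lemma flat_kernel (P : {mpoly {mpoly k[N]}[n]}) : mmap (mmap iota tt) yy P = 0 ->
  forall mu, I P@_mu.
Proof.
move=> P0 mu; have [muP|/memN_msupp_eq0 -> //] := boolP (mu \in msupp P).
pose J := ('X_{1..n} * 'X_{1..N})%type.
pose s : seq J := [seq (mu', nu) | mu' <- msupp P, nu <- msupp P@_mu'].
pose w (q : J) := iota P@_q.1@_q.2 * (mmap1 tt q.2 * mmap1 yy q.1).
have Dw (q : J) : D (mono_deg q.2 q.1) (w q) by apply: gcompZ; exact: mono_hom.
have sw : \sum_(q <- s) w q = 0.
  rewrite big_allpairs_dep -[RHS]P0; apply: eq_bigr => mu' _; rewrite mulr_suml.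
  by apply: eq_bigr => nu _; rewrite /w /= mulrA.
pose dg nu := mono_deg nu mu.
pose Qg de := \sum_(nu <- msupp P@_mu | dg nu == de) P@_mu@_nu *: 'X_[nu].
have Qg_supp de nu : nu \in msupp (Qg de) -> dg nu = de.
  move=> h; apply: contraTeq h => ne; rewrite mcoeff_msupp negbK raddf_sum /=.
  rewrite big1 // => nu' /eqP e; rewrite mcoeffZ mcoeffX; case: eqP => [e'|]; rewrite ?mulr0 //.
  by rewrite e' in e; rewrite e eqxx in ne.
have IQ nu0 : nu0 \in msupp P@_mu -> I (Qg (dg nu0)).
  move=> nu0s; apply: (related_kernel block_exponent_gt0 blk_surj I0 ID IM I_trinomial tt_neq0 I_eval T1_indep).
    move=> nu nu' /Qg_supp e /Qg_supp e'.
    by have [_] := mono_deg_related (etrans e (esym e')).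
  have := gcomp_collect Dw sw (dg nu0).
  rewrite big_mkcond big_allpairs_dep (bigD1_seq mu) ?msupp_uniq //=.
  rewrite [X in _ + X]big1 ?addr0; last first.
    move=> mu' mumu; rewrite big1 // => nu' _; case: eqP => // e.
    by have [e'] := mono_deg_related e; rewrite e' eqxx in mumu.
  rewrite -big_mkcond /= => e.
  have nz : mmap1 yy mu != 0.
    by have := mono_neq0 nu0 mu; rewrite mulf_eq0 negb_or => /andP[].
  apply: (mulIf nz); rewrite mul0r -[RHS]e /Qg raddf_sum mulr_suml.
  by apply: eq_bigr => nu _; rewrite /w /= mmapZ mmapX mulrA.
rewrite (_ : P@_mu = \sum_(de <- undup (map dg (msupp P@_mu))) Qg de).
  rewrite big_seq; apply: (big_ind I) => // de.
  by rewrite mem_undup => /mapP[nu0 nu0s ->]; exact: IQ.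
rewrite /Qg (exchange_big_dep predT) //= [LHS]mpolyE.
apply: eq_big_seq => nu nus; rewrite (big_mkcond (fun de => dg nu == de)).
rewrite (bigD1_seq (dg nu)) ?undup_uniq ?mem_undup ?map_f //= eqxx.
by rewrite big1 ?addr0 // => de; rewrite eq_sym; case: eqP.
Qed.

End Kernel.

Hypothesis special_hit : forall c, (forall i, c != a i) -> irreducible_elt (F c).
Hypothesis tt_prod : forall i, exists w, \prod_(l | blk l == i) tt l ^+ b l = iota w * F (a i) /\ w != 0.

Definition flat_image x := exists P : {mpoly {mpoly k[N]}[n]}, mmap (mmap iota tt) yy P = x.

Lemma flat_imageD x y : flat_image x -> flat_image y -> flat_image (x + y).
Proof. by move=> [P <-] [Q <-]; exists (P + Q); rewrite rmorphD. Qed.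

Lemma flat_imageM x y : flat_image x -> flat_image y -> flat_image (x * y).
Proof. by move=> [P <-] [Q <-]; exists (P * Q); rewrite rmorphM. Qed.

Lemma flat_imageC c : flat_image (iota c).
Proof. by exists (c%:MP)%:MP; rewrite mmapC /= mmapC. Qed.

Lemma flat_image_tt l : flat_image (tt l).
Proof. by exists ('X_l)%:MP; rewrite mmapC /= mmapX mmap1U. Qed.

Lemma flat_image_yy l : flat_image (yy l).
Proof. by exists 'X_l; rewrite mmapX mmap1U. Qed.

Lemma flat_image_prod (J : eqType) (s : seq J) (Q : pred J) (G : J -> B) (e : J -> nat) :
  {in s, forall i, flat_image (G i)} -> flat_image (\prod_(i <- s | Q i) G i ^+ e i).
Proof.
move=> h; rewrite big_seq_cond; apply: (big_ind flat_image).
- by rewrite -(rmorph1 iota); exact: flat_imageC.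
- exact: flat_imageM.
move=> i /andP[/h hi _]; elim: (e i) => [|l IH].
  by rewrite expr0 -(rmorph1 iota); exact: flat_imageC.
by rewrite exprS; exact: flat_imageM.
Qed.

Lemma flat_image_scale c x : c != 0 -> flat_image (iota c * x) -> flat_image x.
Proof.
move=> c0 h; have := flat_imageM (flat_imageC c^-1) h.
by rewrite mulrA -rmorphM mulVf // rmorph1 mul1r.
Qed.

Hypothesis r_gt0 : (0 < r)%N.

Lemma flat_image_pencil c : flat_image (F c).
Proof.
have ha i : flat_image (F (a i)).
  have [w [e w0]] := tt_prod i; apply: (flat_image_scale w0); rewrite -e.
  by apply: flat_image_prod => l _; exact: flat_image_tt.
have ne : a (inord 0) != a (inord 1).
  rewrite (inj_eq a_inj); apply/eqP => /(congr1 (@nat_of_ord _)) /=.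
  by rewrite !inordK.
have [u [v ->]] := pencil_span iota f g c ne.
by apply: flat_imageD; apply: flat_imageM => //; exact: flat_imageC.
Qed.

(** A prime that is neither some [yy l] nor some [pp l] is associate to an irreducible member, which
    is a combination of the first two chosen members. *)
Lemma flat_image_hprime q : hprime D q -> flat_image q.
Proof.
move=> qP; have qI := hprime_irr qP.
have [[c qc]|nb] := EM (exists c, dvd q (F c)); last first.
  have [|l <-] := yy_all qP; last exact: flat_image_yy.
  by move=> c qc; apply: nb; exists c.
have [[i ci]|nc] := EM (exists i, c = a i).
  rewrite ci in qc; have [l <-] := pp_all qP qc; have [z z0 tE] := tt_unit l.
  by apply: (flat_image_scale z0); rewrite -tE; exact: flat_image_tt.
have Fc : irreducible_elt (F c).
  by apply: special_hit => i; apply/eqP => e; apply: nc; exists i.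
have [u Uu FE] := irreducible_dvdP qI Fc qc.
have [z z0 uE] := gcomp_unit hB0 hunm Uu.
by apply: (flat_image_scale z0); rewrite -uE -FE; exact: flat_image_pencil.
Qed.

Lemma flat_surjective x : flat_image x.
Proof.
have [s [h [Dh ->]]] := gcomp_span D x.
apply: (big_ind flat_image); first by rewrite -(rmorph0 iota); exact: flat_imageC.
  exact: flat_imageD.
move=> e _; have [->|h0] := eqVneq (h e) 0.
  by rewrite -(rmorph0 iota); exact: flat_imageC.
have [c [t [c0 _ tP ->]]] := hprime_factor hU hunm hB0 (Dh e) h0.
apply: flat_imageM; first exact: flat_imageC.
by apply: flat_image_prod => p /tP[pP _]; exact: flat_image_hprime.
Qed.

End FlatAssembly.

Lemma prod_tagnat_block (R : comNzSemiRingType) (r : nat) (n_ : 'I_r -> nat)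
    (G : 'I_(\sum_i n_ i) -> R) i :
  \prod_(l | tagnat.sig1 l == i) G l = \prod_(j < n_ i) G (tagnat.Rank i j).
Proof.
rewrite (reindex (@tagnat.rank r n_)) /=; last exact/onW_bij/tagnat.rank_bij.
pose H i' (j : 'I_(n_ i')) := G (tagnat.Rank i' j).
rewrite (eq_big (fun p : {i' & 'I_(n_ i')} => (tag p == i) && true)
  (fun p => H (tag p) (tagged p))); last 2 first.
- by move=> p; rewrite tagnat.rankE tagnat.Rank1K andbT.
- by move=> p _; rewrite tagnat.rankE.
by rewrite -(sig_big_dep (fun i' => i' == i) (fun _ _ => true) H) big_pred1_eq.
Qed.

(** Points are added only when [S] has fewer than two, so [r >= 2] forces every [a i] into [S];
    reducedness of the trinomial data rests on this. *)
Lemma pencil_points (k : fieldType) (S : seq (option k)) : uniq S ->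
  exists r (a : 'I_r.+1 -> option k), [/\ (0 < r)%N, injective a,
    forall c, c \in S -> exists i, c = a i &
    r = 1%N \/ (2 <= r)%N /\ forall i, a i \in S].
Proof.
move=> uS.
have mk (A : seq (option k)) : uniq A -> (2 <= size A)%N -> {subset S <= A} ->
    size A = 2 \/ (3 <= size A)%N /\ A = S ->
  exists r (a : 'I_r.+1 -> option k), [/\ (0 < r)%N, injective a,
    forall c, c \in S -> exists i, c = a i &
    r = 1%N \/ (2 <= r)%N /\ forall i, a i \in S].
  move=> uA sA SA cases; case sAE : (size A) sA cases => [|[|r]] // _ cases.
  exists r.+1, (fun i => nth None A i); split=> //.
  - move=> i i' /eqP; rewrite nth_uniq ?sAE // => /eqP; exact: ord_inj.
  - move=> c /SA cA; have ci := cA; rewrite -index_mem sAE in ci.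
    by exists (Ordinal ci); rewrite /= nth_index.
  - case: cases => [[->]|[r2 AS]]; [by left|right; split=> // i].
    by rewrite -AS mem_nth // sAE.
case sS : (size S) => [|[|[|s]]].
- apply: (mk [:: None; Some 0]) => //; last by left.
  by move: sS => /size0nil ->.
- case: S uS sS mk => // c [|//] _ _ mk.
  pose c' : option k := if c is None then Some 0 else None.
  apply: (mk [:: c; c']) => //; last by left.
    by rewrite /= inE andbT /c'; case: (c).
  by move=> x; rewrite !inE => ->.
- by apply: (mk S); rewrite ?sS //; left.
- by apply: (mk S); rewrite ?sS //; right.
Qed.

Lemma gcdn_ones n : (0 < n)%N -> \big[gcdn/0%N]_(j < n) 1%N = 1%N.
Proof.
case: n => // n _; apply/eqP; rewrite -dvdn1.
exact: (@biggcdn_inf _ ord0).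
Qed.

(** * The trinomial data and the isomorphism *)

Section Assembly.
Variables (k : closedFieldType) (B : idomainType) (iota : {rmorphism k -> B}).
Variables (m : nat) (D : grading iota 'rV[int]_m).
Hypotheses (hU : is_UFD B) (hunm : unmixed D) (hB0 : degree0_is_base D).
Variables (d : 'rV[int]_m) (f g : B).
Hypotheses (Df : D d f) (Dg : D d g) (g0 : g != 0).
Hypotheses (fg : forall c, f != iota c * g) (cop : coprime_elts f g).
Hypothesis gen : pencil_generates D f g.
Local Notation F := (pencil iota f g).

Lemma pencil_coefficients r (a : 'I_r.+1 -> option k) : (0 < r)%N -> injective a ->
  exists w lambda : 'I_r.+1 -> k, forall i : 'I_r.+1, [/\ w i != 0,
    (i < 2)%N -> w i = 1 & (2 <= i)%N -> lambda i != 0 /\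
      F (a (inord 0)) + iota (lambda i) * F (a (inord 1)) + iota (w i) * F (a i) = 0].
Proof.
move=> r0 a_inj.
suff /choice[w /choice[lambda h]] : forall i : 'I_r.+1, exists w lambda : k, [/\ w != 0,
    (i < 2)%N -> w = 1 & (2 <= i)%N -> lambda != 0 /\
      F (a (inord 0)) + iota lambda * F (a (inord 1)) + iota w * F (a i) = 0].
  by exists w, lambda.
move=> i; case: (ltnP i 2) => i2; first by exists 1, 0; rewrite oner_neq0.
have neq (l l' : 'I_r.+1) : l != l' :> nat -> a l != a l'.
  by move=> ll; rewrite (inj_eq a_inj); apply: contraNneq ll => ->.
have [|||u [v [u0 v0 E]]] := pencil_span_neq0 hU hunm hB0 Df Dg g0 fg cop
  (a := a (inord 0)) (b := a (inord 1)) (c := a i).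
- by apply: neq; rewrite !inordK.
- by apply: neq; rewrite inordK // gtn_eqF // ltnW.
- by apply: neq; rewrite inordK // gtn_eqF.
(* Dividing the expression of [F (a i)] by [u] makes the coefficient of the first member one, as in
   a trinomial; the remaining factor [w i] is left to [scaled_factor]. *)
exists (- u^-1), (v / u); split=> // [|_]; first by rewrite oppr_eq0 invr_eq0.
split; first by rewrite mulf_neq0 // invr_eq0.
have e1 : - u^-1 * u = -1 by rewrite mulNr mulVf.
have e2 : - u^-1 * v = - (v / u) by rewrite mulNr mulrC.
rewrite E mulrDr !mulrA -!rmorphM e1 e2 !rmorphN rmorph1; ring.
Qed.

Lemma pencil_trinomial_iso : exists (Delta : trinomial_data k) (n : nat)
    (h : {rmorphism B -> {mpoly (trinomial_ring Delta)[n]}}),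
  [/\ td_reduced Delta, bijective h & forall c, h (iota c) = (trinomial_const Delta c)%:MP].
Proof.
have [S uS SP] := finitely_many_special hU hunm hB0 Df Dg g0 fg cop gen.
have [r [a [r0 a_inj aS ra]]] := pencil_points uS.
have [w [lambda wl]] := pencil_coefficients r0 a_inj.
have w0 i : w i != 0 by case: (wl i).
have /choice[ps /choice[ts pst]] := fun i => scaled_factor hU hunm hB0 Df Dg g0 fg (a i) (w0 i).
have [Y uY YP] := finitely_many_base_free hU g0 fg cop gen.
pose n_ i := size (ps i).
pose beta i (j : 'I_(n_ i)) := pval (ps i)`_j (F (a i)).
have psP i (j : 'I_(n_ i)) : hprime D (ps i)`_j /\ dvd (ps i)`_j (F (a i)).
  by case: (pst i) => _ _ h _ _; apply: h; rewrite mem_nth.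
have n0 i : (0 < n_ i)%N by case: (pst i).
have beta0 i j : (0 < beta i j)%N.
  have [pP pa] := psP i j.
  exact/(pval_gt0 hU (hprime_irr pP) (pencil_neq0 g0 fg _)).
have cop_beta i i' : i != i' ->
    coprime (\big[gcdn/0%N]_(j < n_ i) beta i j) (\big[gcdn/0%N]_(j < n_ i') beta i' j).
  move=> ii; rewrite /coprime eqn_leq gcdn_gt0.
  have dv i1 (j : 'I_(n_ i1)) : (\big[gcdn/0%N]_(j < n_ i1) beta i1 j %| beta i1 j)%N.
    exact: (@biggcdn_inf _ j).
  rewrite (dvdn_gt0 (beta0 _ (Ordinal (n0 i))) (dv _ _)) andbT leqNgt.
  apply/negP => l1; have ai : a i != a i' by rewrite (inj_eq a_inj).
  apply: (pencil_coprime hU hunm hB0 Df Dg g0 fg cop gen ai l1) => p pP pa.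
    case: (pst i) => _ _ _ /(_ p pP pa) pps _.
    have ip : (index p (ps i) < n_ i)%N by rewrite index_mem.
    rewrite (dvdn_trans (dvdn_gcdl _ _)) // (dvdn_trans (dv i (Ordinal ip))) //.
    by rewrite /beta /= nth_index.
  case: (pst i') => _ _ _ /(_ p pP pa) pps _.
  have ip : (index p (ps i') < n_ i')%N by rewrite index_mem.
  rewrite (dvdn_trans (dvdn_gcdr _ _)) // (dvdn_trans (dv i' (Ordinal ip))) //.
  by rewrite /beta /= nth_index.
have l0 (i : 'I_r.+1) : (2 <= i)%N -> lambda i != 0.
  by move=> i2; have [_ _ /(_ i2)[]] := wl i.
have l_inj (i i' : 'I_r.+1) : (2 <= i)%N -> (2 <= i')%N -> lambda i = lambda i' -> i = i'.
  move=> i2 i2' ll; apply: a_inj.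
  have [_ _ /(_ i2)[_ E]] := wl i; have [_ _ /(_ i2')[_ E']] := wl i'.
  apply: (pencil_proportional hU hunm hB0 Df Dg g0 fg cop (u := w i' / w i)).
  have : iota (w i) * F (a i) = iota (w i') * F (a i').
    by move: E; rewrite ll -[RHS]E' => /addrI.
  move=> e; rewrite [w i' / w i]mulrC rmorphM -mulrA -e mulrA -rmorphM mulVf // rmorph1.
  by rewrite mul1r.
pose N := (\sum_(i < r.+1) n_ i)%N.
pose blk (l : 'I_N) := tagnat.sig1 l.
pose pp (l : 'I_N) := (ps (blk l))`_(tagnat.sig2 l).
pose tt (l : 'I_N) := (ts (blk l))`_(tagnat.sig2 l).
pose b (l : 'I_N) := pval (pp l) (F (a (blk l))).
pose yy (l : 'I_(size Y)) := Y`_l.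
have RankE (G : forall i, nat -> B) i (j : 'I_(n_ i)) :
    G (blk (tagnat.Rank i j)) (tagnat.sig2 (tagnat.Rank i j)) = G i j.
  by rewrite tagnat.Rank2K /= /blk tagnat.Rank1K.
have ppR i (j : 'I_(n_ i)) : pp (tagnat.Rank i j) = (ps i)`_j.
  exact: (RankE (fun i j => (ps i)`_j)).
have ttR i (j : 'I_(n_ i)) : tt (tagnat.Rank i j) = (ts i)`_j.
  exact: (RankE (fun i j => (ts i)`_j)).
have bR i (j : 'I_(n_ i)) : b (tagnat.Rank i j) = beta i j.
  by rewrite /b ppR /blk tagnat.Rank1K.
have pp_hprime l : hprime D (pp l) by case: (psP _ (tagnat.sig2 l)).
have pp_dvd l : dvd (pp l) (F (a (blk l))) by case: (psP _ (tagnat.sig2 l)).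
have pp_inj : injective pp.
  move=> l l' e; have bl : blk l = blk l'.
    apply: a_inj; apply: (pencil_disjoint hU cop (hprime_irr (pp_hprime l)) (pp_dvd l)).
    by rewrite e.
  rewrite -(tagnat.sig2K l) -(tagnat.sig2K l'); apply/ord_inj/eqP.
  have sz i i' (j : 'I_(n_ i)) : i = i' -> (j < size (ps i'))%N by move=> <-.
  rewrite tagnat.eq_Rank; apply/andP; split; first exact/eqP.
  case: (pst (blk l')) => us _ _ _ _; rewrite -(nth_uniq 0 _ _ us) //; last exact: sz.
  by apply/eqP; move: e; rewrite /pp bl.
have pp_all i q : hprime D q -> dvd q (F (a i)) -> exists l, pp l = q.
  move=> qP qa; case: (pst i) => _ _ _ /(_ q qP qa) qps _.
  have iq : (index q (ps i) < n_ i)%N by rewrite index_mem.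
  by exists (tagnat.Rank i (Ordinal iq)); rewrite ppR nth_index.
have tt_unit l : exists2 z, z != 0 & tt l = iota z * pp l.
  by case: (pst (blk l)) => _ _ _ _ [h _]; apply: h.
have yyP l : hprime D (yy l) /\ forall c, ~ dvd (yy l) (F c).
  by apply/YP; rewrite mem_nth.
have yy_hprime l : hprime D (yy l) by case: (yyP l).
have yy_base l c : ~ dvd (yy l) (F c) by case: (yyP l).
have yy_inj : injective yy.
  by move=> l l' /eqP; rewrite nth_uniq // => /eqP; exact: ord_inj.
have yy_all q : hprime D q -> (forall c, ~ dvd q (F c)) -> exists l, yy l = q.
  move=> qP qn; have qY : q \in Y by apply/YP.
  have iq : (index q Y < size Y)%N by rewrite index_mem.
  by exists (Ordinal iq); rewrite /yy nth_index.
have tt_prod i : \prod_(l | blk l == i) tt l ^+ b l = iota (w i) * F (a i).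
  rewrite (prod_tagnat_block (fun l => tt l ^+ b l)).
  case: (pst i) => _ _ _ _ [_ <-]; apply: eq_bigr => j _.
  by rewrite ttR bR.
have blk_surj i : exists l, blk l = i.
  by exists (tagnat.Rank i (Ordinal (n0 i))); rewrite /blk tagnat.Rank1K.
have hit c : (forall i, c != a i) -> irreducible_elt (F c).
  move=> ca; apply: contrapT => /SP/aS[i ci]; have := ca i.
  by rewrite ci eqxx.
have surj x : exists P : {mpoly {mpoly k[N]}[size Y]}, mmap (mmap iota tt) yy P = x.
  apply: (flat_surjective hU hunm hB0 a_inj pp_all tt_unit yy_all hit _ r0).
  by move=> i; exists (w i); split; [exact: tt_prod|].
have w1 (i : 'I_r.+1) : (i < 2)%N -> w i = 1 by case: (wl i).
have Teval i : mmap iota tt (block_monom blk b k i) = iota (w i) * F (a i).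
  by rewrite block_monom_eval; exact: tt_prod.
have T1_indep c : mmap iota tt (block_monom blk b k (inord 0)) !=
    iota c * mmap iota tt (block_monom blk b k (inord 1)).
  rewrite !Teval !w1 ?inordK //.
  rewrite rmorph1 !mul1r; apply/eqP.
  move=> /(pencil_proportional hU hunm hB0 Df Dg g0 fg cop)/a_inj/(congr1 (@nat_of_ord _)).
  by rewrite /= !inordK.
(* The ideal stays a parameter: it is zero for [r = 1], where the data carry other exponents than
   [b], and the trinomial ideal otherwise. *)
have kernel (I : {mpoly k[N]} -> Prop) : I 0 -> (forall p q, I p -> I q -> I (p + q)) ->
    (forall p q : {mpoly k[N]}, I p -> I (q * p)) ->
    (forall i : 'I_r.+1, (2 <= i)%N -> I (block_monom blk b k (inord 0) +
       lambda i *: block_monom blk b k (inord 1) + block_monom blk b k i)) ->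
    (forall p, I p -> mmap iota tt p = 0) ->
    forall P : {mpoly {mpoly k[N]}[size Y]}, mmap (mmap iota tt) yy P = 0 ->
      forall mu, I P@_mu.
  move=> I0 ID IM It Ie P P0 mu.
  exact: (flat_kernel hU hunm hB0 Df Dg g0 fg cop gen a_inj pp_hprime pp_dvd pp_inj
    tt_unit yy_hprime yy_base yy_inj I0 ID IM blk_surj It Ie T1_indep P0 mu).
case: ra => [r1|[r2 aS']].
(* For r = 1 the ideal is 0, so the exponents may be replaced by 1. *)
  have n0' i (j : 'I_(n_ i)) : (0 < (fun _ => 1%N) j)%N by [].
  have cop1 i i' : i != i' -> coprime (\big[gcdn/0%N]_(j < n_ i) 1%N)
      (\big[gcdn/0%N]_(j < n_ i') 1%N) by move=> _; rewrite !gcdn_ones.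
  pose Delta := @TrinomialData k r n_ (fun _ _ => 1%N) lambda r0 n0 n0' cop1 l0 l_inj.
  have no2 (i : 'I_r.+1) : (2 <= i)%N = false.
    by apply/negbTE; rewrite -ltnNge -[X in (_ < X)%N]/(1.+1) -r1.
  have ideal0 (p : {mpoly k[td_N Delta]}) : p \in trinomial_ideal (Delta := Delta) <-> p = 0.
    split=> [/trinomial_idealP[c ->]|->].
      by rewrite big1 // => i; rewrite no2.
    by apply/trinomial_idealP; exists (fun=> 0); rewrite big1 // => i _; rewrite mul0r.
  have [|||h [hb hc]] := @trinomial_iso k Delta B iota tt (size Y) yy.
  - by move=> p /ideal0 ->; rewrite rmorph0.
  - move=> P P0 mu; apply/ideal0; apply: (kernel (fun p => p = 0)) P0 mu => //.
    + by move=> p q -> ->; rewrite addr0.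
    + by move=> p q ->; rewrite mulr0.
    + by move=> i; rewrite no2.
    + by move=> p ->; rewrite rmorph0.
  - exact: surj.
  by exists Delta, (size Y), h; split=> //; left.
pose Delta := @TrinomialData k r n_ beta lambda r0 n0 beta0 cop_beta l0 l_inj.
have monE i : tmonom (Delta := Delta) i = block_monom blk b k i.
  rewrite /tmonom /block_monom (prod_tagnat_block (fun l => 'X_l ^+ b l)).
  by apply: eq_bigr => j _; rewrite bR.
have triE i : trinomial (Delta := Delta) i = block_monom blk b k (inord 0) +
    lambda i *: block_monom blk b k (inord 1) + block_monom blk b k i.
  by rewrite /trinomial !monE.
have tri0 (i : 'I_r.+1) : (2 <= i)%N -> mmap iota tt (trinomial (Delta := Delta) i) = 0.
  move=> i2; have [_ _ /(_ i2)[_ <-]] := wl i.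
  rewrite triE !rmorphD /= mmapZ !Teval (w1 (inord 0)) ?inordK // (w1 (inord 1)) ?inordK //.
  by rewrite rmorph1 !mul1r.
have ideal_eval (p : {mpoly k[td_N Delta]}) : p \in trinomial_ideal (Delta := Delta) ->
    mmap iota tt p = 0.
  move=> /trinomial_idealP[c ->]; rewrite rmorph_sum big1 // => i i2.
  by rewrite rmorphM /= tri0 // mulr0.
have [|||h [hb hc]] := @trinomial_iso k Delta B iota tt (size Y) yy.
- exact: ideal_eval.
- have [I0 _ Icl] := trinomial_ideal_closed Delta.
  apply: (kernel (fun p => p \in trinomial_ideal (Delta := Delta))).
  + exact: I0.
  + by move=> p q Ip Iq; rewrite -[p]mul1r; exact: Icl.
  + by move=> p q Ip; rewrite -[q * p]addr0; exact: Icl.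
  + move=> i i2; apply/trinomial_idealP; exists (fun i' => (i' == i)%:R).
    rewrite (bigD1 i) //= eqxx mul1r big1 ?addr0 ?triE // => i' /andP[_ /negPf ->].
    by rewrite mul0r.
  + exact: ideal_eval.
- exact: surj.
exists Delta, (size Y), h; split=> //; right; split=> // i.
(* A block of size below two is a single prime with exponent one, which would make [F (a i)]
   irreducible although [a i] is special. *)
rewrite leqNgt; apply/negP => small; have /SP := aS' i; apply.
have sum_ge : (n_ i <= td_size (Delta := Delta) i)%N.
  rewrite -[X in (X <= _)%N]card_ord -sum1_card; apply: leq_sum => j _; exact: beta0.
have n1 : n_ i = 1%N.
  by apply/eqP; rewrite eqn_leq n0 -ltnS (leq_ltn_trans sum_ge).
have pI := hprime_irr (psP i (Ordinal (n0 i))).1.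
apply: irreducible_associates pI; case: (pst i) => _ _ _ _ [/(_ 0%N (n0 i))[z z0 tz] tsE].
have b1 : pval (ps i)`_0 (F (a i)) = 1%N.
  have := small; rewrite /td_size /=.
  rewrite (bigD1 (Ordinal (n0 i))) //= => h1; apply/eqP; rewrite eqn_leq.
  by rewrite (beta0 i (Ordinal (n0 i))) andbT (leq_trans (leq_addr _ _) h1).
have E : iota (w i) * F (a i) = iota z * (ps i)`_0.
  rewrite -tsE -tz -[RHS]expr1 -b1 -(big_mkord xpredT (fun j => (ts i)`_j ^+ pval (ps i)`_j (F (a i)))).
  by rewrite -/(n_ i) n1 big_nat1.
have wu : iota (w i) \is a GRing.unit by exact: iota_unit.
exists ((iota (w i))^-1 * iota z); first by rewrite unitrM unitrV wu iota_unit.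
by rewrite -mulrA -E mulKr.
Qed.

End Assembly.

Unset Implicit Arguments.

Theorem theorem5p1 (k : closedFieldType) (B : idomainType)
    (iota : {rmorphism k -> B}) (n : nat) (hn : (1 <= n)%N)
    (hunirat : unirational iota) (hUFD : is_UFD B)
    (htrdeg : domain_trdeg iota n)
    (D : grading iota 'rV[int]_n.-1)
    (heff : effective D) (hunm : unmixed D) (hB0 : degree0_is_base D) :
  exists (Delta : trinomial_data k) (m : nat)
         (f : {rmorphism B -> {mpoly (trinomial_ring Delta)[m]}}),
    [/\ td_reduced Delta, bijective f
      & forall c : k, f (iota c) = (trinomial_const Delta c)%:MP].
Proof.
case: n hn htrdeg D heff hunm hB0 => // m _ htrdeg D heff hunm hB0.
have [d [f [g [Df Dg g0 fg [cop gen]]]]] := pencil_exists hUFD hunirat heff htrdeg.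
exact: (pencil_trinomial_iso hUFD hunm hB0 Df Dg g0 fg cop gen).
Qed.
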